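(* There is a combinatorial algorithm that, given a set $P$ of $n$ points in the plane $\mathbb{R}^2$ and a positive integer $k$ with $2 \le k \le n$, solves the $k$-dispersion problem on $P$ (i.e., outputs a $k$-subset of $P$ whose minimum pairwise Euclidean distance is maximum among all $k$-subsets of $P$) in $O\left(n^{k-1}\log n\right)$ time.
   Context: The $k$-dispersion problem: given a finite set $P$ of $n$ points in $\mathbb{R}^d$ and a positive integer $k\le n$, select $k$ of the points of $P$ so that the minimum Euclidean distance between two distinct selected points is maximized. For fixed $k$, the running time is measured as a function of $n$. $\log$ denotes the logarithm in base $2$. *)

(* Defs.v *)
(* concrete classical reals R.
   We fix a Real-RAM machine model (unit-cost arithmetic on reals and
   integers, indirect addressing, no real-to-integer conversion/floor) to make
   "an algorithm running in O(f(n)) time" precise. *)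
From Stdlib Require Import Reals ZArith List Arith.
Import ListNotations.
Open Scope R_scope.

Definition point := (R * R)%type.

Definition dist (p q : point) : R :=
  sqrt ((fst p - fst q) ^ 2 + (snd p - snd q) ^ 2).

Fixpoint pair_dists (l : list point) : list R :=
  match l with
  | [] => []
  | x :: t => map (dist x) t ++ pair_dists t
  end.

(* minimum pairwise distance (only meaningful for lists of length >= 2) *)
Definition min_dist (l : list point) : R :=
  match pair_dists l with
  | [] => 0
  | d :: ds => fold_right Rmin d ds
  end.

(* S is a list of k distinct indices into P (a k-subset of P, since the
   points of P are distinct) *)
Definition k_selection (P : list point) (k : nat) (S : list nat) : Prop :=
  length S = k /\ NoDup S /\ Forall (fun i => (i < length P)%nat) S.

Definition selected (P : list point) (S : list nat) : list point :=
  map (fun i => nth i P (0, 0)) S.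

Definition is_k_dispersion (P : list point) (k : nat) (S : list nat) : Prop :=
  k_selection P k S /\
  forall T, k_selection P k T -> min_dist (selected P T) <= min_dist (selected P S).

Inductive instr : Type :=
| IConst (d : nat) (z : Z)
| IAdd (d a b : nat)
| ISub (d a b : nat)
| ILoad (d a : nat)
| IStore (a s : nat)
| RFromI (d a : nat)
| RAdd (d a b : nat)
| RSub (d a b : nat)
| RMul (d a b : nat)
| RDiv (d a b : nat)
| RSqrt (d a : nat)                 (* sqrt, 0 on negatives *)
| RLoad (d a : nat)
| RStore (a s : nat)
| JLtR (a b t : nat)
| JLeI (a b t : nat)
| Jmp (t : nat)
| Halt.

Definition program := list instr.

Record state : Type := mkState { pc : nat; ireg : nat -> Z; rreg : nat -> R }.

Definition upd {A : Type} (f : nat -> A) (i : nat) (v : A) : nat -> A :=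
  fun j => if Nat.eqb j i then v else f j.

(* one step; None when the machine has halted (Halt or pc out of range) *)
Definition step (p : program) (s : state) : option state :=
  let I := ireg s in let Rg := rreg s in let nx := S (pc s) in
  match nth (pc s) p Halt with
  | IConst d z => Some (mkState nx (upd I d z) Rg)
  | IAdd d a b => Some (mkState nx (upd I d (I a + I b)%Z) Rg)
  | ISub d a b => Some (mkState nx (upd I d (I a - I b)%Z) Rg)
  | ILoad d a => Some (mkState nx (upd I d (I (Z.to_nat (I a)))) Rg)
  | IStore a s' => Some (mkState nx (upd I (Z.to_nat (I a)) (I s')) Rg)
  | RFromI d a => Some (mkState nx I (upd Rg d (IZR (I a))))
  | RAdd d a b => Some (mkState nx I (upd Rg d (Rg a + Rg b)))
  | RSub d a b => Some (mkState nx I (upd Rg d (Rg a - Rg b)))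
  | RMul d a b => Some (mkState nx I (upd Rg d (Rg a * Rg b)))
  | RDiv d a b =>
      Some (mkState nx I (upd Rg d (if Req_EM_T (Rg b) 0 then 0 else Rg a / Rg b)))
  | RSqrt d a => Some (mkState nx I (upd Rg d (sqrt (Rg a))))
  | RLoad d a => Some (mkState nx I (upd Rg d (Rg (Z.to_nat (I a)))))
  | RStore a s' => Some (mkState nx I (upd Rg (Z.to_nat (I a)) (Rg s')))
  | JLtR a b t =>
      Some (mkState (if Rlt_dec (Rg a) (Rg b) then t else nx) I Rg)
  | JLeI a b t =>
      Some (mkState (if Z.leb (I a) (I b) then t else nx) I Rg)
  | Jmp t => Some (mkState t I Rg)
  | Halt => None
  end.

(* run p t s = Some s' iff the machine started in s halts in s' after
   at most t steps (each instruction costs one unit of time) *)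
Fixpoint run (p : program) (t : nat) (s : state) : option state :=
  match step p s with
  | None => Some s
  | Some s' => match t with O => None | S t' => run p t' s' end
  end.

Definition input_state (P : list point) (k : nat) : state :=
  mkState 0
    (fun j => if Nat.eqb j 0 then Z.of_nat (length P)
              else if Nat.eqb j 1 then Z.of_nat k else 0%Z)
    (fun j => let q := nth (Nat.div j 2) P (0, 0) in
              if Nat.eqb (Nat.modulo j 2) 0 then fst q else snd q).

Definition valid_output (s : state) (k : nat) : Prop :=
  forall j, (j < k)%nat -> (0 <= ireg s j)%Z.

Definition output (s : state) (k : nat) : list nat :=
  map (fun j => Z.to_nat (ireg s j)) (seq 0 k).

Definition log2 (x : R) : R := ln x / ln 2.

(* Main.v *)
Require Import Defs.
From Stdlib Require Import Reals ZArith List Arith Lia Lra Bool.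
Import ListNotations.
Open Scope R_scope.

(* Fix k - 2 of the selected points (n^(k-2) tuples T) and let w(p) be the least
   distance occurring in T and p. It remains to maximize min(w(p), w(q), |pq|) over
   pairs p, q in O(n log n) time. Sort the points by w. For a threshold t let D(t) be
   the diameter of the points of weight at least t: the optimum is the maximum of
   min(t, D(t)) over the weights t, and as D decreases with t a binary search finds it
   with O(log n) diameter computations. Each of these is linear, given one global
   presorting by abscissa: the upper and lower hulls of the heavy points are built by a
   monotone chain and merged by slope (rotating calipers). A diametral pair (p, q) is
   found because p is the only maximizer and q the only minimizer of the linear form
   p - q, so neither is ever popped from its chain, and the slopes before and after
   them keep the calipers from passing by. Squared distances are used throughout, and
   starting from the value 0 excludes repeated points. *)

(** * Structured code and its translation to jumps *)

(** One program has to serve every [k], so the tuple [T] lives in an array that is advanced like an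
    odometer; only the constant of the time bound depends on [k]. Such a program is unmanageable as
    bare jumps, hence a while language over arrays and a verified compiler. Expressions compile to
    loop-free code, so a source step costs at most the size of the compiled program, whatever the
    input. The machine has neither integer multiplication nor division: addresses are scaled by
    doublings, and midpoints and tree parents are read from a table of halves. For [k = 2] the tuple
    is empty and [w] would be infinite; a cap above all squared distances replaces infinity. Each
    probe of the search certifies the part it discards: if [D(t) < t], pairs whose lighter weight is
    at least [t] are at most [D(t)] apart, a value just achieved; otherwise [t] is achieved and
    bounds every pair whose lighter weight is at most [t]. The proof therefore tracks only which
    thresholds are still open. *)

Definition mem := ((nat -> Z) * (nat -> R))%type.

Definition at_pc (pc : nat) (m : mem) : state := mkState pc (fst m) (snd m).

(** Runs the machine's own [step] on a one-instruction program, so that the effects of instructions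
    are not specified a second time. *)
Definition eff (i : instr) (m : mem) : mem :=
  match step [i] (at_pc 0 m) with
  | Some s => (ireg s, rreg s)
  | None => m
  end.

Definition nonjump (i : instr) : bool :=
  match i with JLtR _ _ _ | JLeI _ _ _ | Jmp _ | Halt => false | _ => true end.

Inductive test : Type := TR (a b : nat) | TI (a b : nat).

Definition jump_if (t : test) (target : nat) : instr :=
  match t with TR a b => JLtR a b target | TI a b => JLeI a b target end.

Definition holds (t : test) (m : mem) : bool :=
  match t with
  | TR a b => if Rlt_dec (snd m a) (snd m b) then true else false
  | TI a b => Z.leb (fst m a) (fst m b)
  end.

Inductive low : Type :=
| LSkip
| LPrim (i : instr)
| LSeq (c1 c2 : low)
| LIf (t : test) (c1 c2 : low)
| LWhile (pre : low) (t : test) (body : low).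

(** Times are exact instruction counts: a failed conditional also pays the jump over the other
    branch, leaving a loop pays the test and the jump out, and each iteration pays the jump back. *)
Inductive lexec : low -> mem -> mem -> nat -> Prop :=
| lexec_skip m : lexec LSkip m m 0
| lexec_prim i m : nonjump i = true -> lexec (LPrim i) m (eff i m) 1
| lexec_seq c1 c2 m1 m2 m3 t1 t2 :
    lexec c1 m1 m2 t1 -> lexec c2 m2 m3 t2 -> lexec (LSeq c1 c2) m1 m3 (t1 + t2)
| lexec_if_true t c1 c2 m m' t1 :
    holds t m = true -> lexec c1 m m' t1 -> lexec (LIf t c1 c2) m m' (1 + t1)
| lexec_if_false t c1 c2 m m' t2 :
    holds t m = false -> lexec c2 m m' t2 -> lexec (LIf t c1 c2) m m' (1 + (t2 + 1))
| lexec_while_false pre t body m m' tp :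
    lexec pre m m' tp -> holds t m' = false ->
    lexec (LWhile pre t body) m m' (tp + 2)
| lexec_while_true pre t body m m1 m2 m3 tp tb tw :
    lexec pre m m1 tp -> holds t m1 = true -> lexec body m1 m2 tb ->
    lexec (LWhile pre t body) m2 m3 tw ->
    lexec (LWhile pre t body) m m3 (tp + (1 + (tb + (1 + tw)))).

Fixpoint size (c : low) : nat :=
  match c with
  | LSkip => 0
  | LPrim _ => 1
  | LSeq c1 c2 => size c1 + size c2
  | LIf _ c1 c2 => size c2 + 2 + size c1
  | LWhile pre _ body => size pre + 2 + size body + 1
  end.

(** Jump targets are absolute, hence the load address [off]. The else branch comes first because
    conditional jumps are taken on success. *)
Fixpoint code (c : low) (off : nat) : list instr :=
  match c with
  | LSkip => []
  | LPrim i => [i]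
  | LSeq c1 c2 => code c1 off ++ code c2 (off + size c1)
  | LIf t c1 c2 =>
      [jump_if t (off + size c2 + 2)] ++ code c2 (off + 1) ++
      [Jmp (off + size (LIf t c1 c2))] ++ code c1 (off + size c2 + 2)
  | LWhile pre t body =>
      code pre off ++
      [jump_if t (off + size pre + 2); Jmp (off + size (LWhile pre t body))] ++
      code body (off + size pre + 2) ++ [Jmp off]
  end.

Lemma length_code c off : length (code c off) = size c.
Proof.
  revert off; induction c; intros; simpl; rewrite ?length_app; simpl;
    rewrite ?length_app, ?IHc1, ?IHc2; simpl; rewrite ?IHc1, ?IHc2; simpl; lia.
Qed.

Definition at_code (p : program) (off : nat) (l : list instr) : Prop :=
  forall i, (i < length l)%nat -> nth (off + i) p Halt = nth i l Halt.

Lemma at_code_app p off l1 l2 :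
  at_code p off (l1 ++ l2) -> at_code p off l1 /\ at_code p (off + length l1) l2.
Proof.
  unfold at_code; rewrite length_app; intros H; split; intros i Hi.
  - rewrite H by lia. apply app_nth1; lia.
  - rewrite <- Nat.add_assoc, H by lia.
    rewrite app_nth2 by lia. f_equal; lia.
Qed.

Lemma at_code_cons p off i l :
  at_code p off (i :: l) -> nth off p Halt = i /\ at_code p (off + 1) l.
Proof.
  intros H; destruct (at_code_app p off [i] l H) as [H1 H2]; split; auto.
  specialize (H1 0%nat). rewrite Nat.add_0_r in H1. apply H1; simpl; lia.
Qed.

Fixpoint nsteps (p : program) (n : nat) (s : state) : option state :=
  match n with
  | O => Some s
  | S n' => match step p s with Some s' => nsteps p n' s' | None => None end
  end.

Lemma nsteps_add p a b s s' :
  nsteps p a s = Some s' -> nsteps p (a + b) s = nsteps p b s'.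
Proof.
  revert s; induction a; simpl; intros s H; [congruence|].
  destruct (step p s); [auto|discriminate].
Qed.

Lemma nsteps_run p n s s' :
  nsteps p n s = Some s' -> step p s' = None -> run p n s = Some s'.
Proof.
  revert s; induction n; simpl; intros s H Hs.
  - injection H as ->. rewrite Hs; reflexivity.
  - destruct (step p s); [auto|discriminate].
Qed.

Lemma step_prim p pc m i :
  nth pc p Halt = i -> nonjump i = true ->
  step p (at_pc pc m) = Some (at_pc (S pc) (eff i m)).
Proof. intros H Hi; unfold step; simpl; rewrite H; destruct i; now try discriminate. Qed.

Lemma step_jmp p pc m t :
  nth pc p Halt = Jmp t -> step p (at_pc pc m) = Some (at_pc t m).
Proof. intros H; unfold step; simpl; rewrite H; reflexivity. Qed.

Lemma step_jump_if p pc m t target :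
  nth pc p Halt = jump_if t target ->
  step p (at_pc pc m) = Some (at_pc (if holds t m then target else S pc) m).
Proof.
  intros H; unfold step; simpl; rewrite H; destruct t; simpl; auto.
  destruct Rlt_dec; auto.
Qed.

Lemma code_correct c m m' t :
  lexec c m m' t ->
  forall p off, at_code p off (code c off) ->
  nsteps p t (at_pc off m) = Some (at_pc (off + size c) m').
Proof.
  induction 1; intros p off Hc; simpl code in Hc.
  - simpl. now rewrite Nat.add_0_r.
  - destruct (at_code_cons _ _ _ _ Hc) as [Hi _].
    cbn [nsteps size]. rewrite (step_prim _ _ _ _ Hi H), Nat.add_1_r. reflexivity.
  - destruct (at_code_app _ _ _ _ Hc) as [H1 H2]. rewrite length_code in H2.
    rewrite (nsteps_add _ _ _ _ _ (IHlexec1 _ _ H1)), (IHlexec2 _ _ H2).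
    simpl; do 2 f_equal; lia.
  - destruct (at_code_cons _ _ _ _ Hc) as [Hj H1].
    destruct (at_code_app _ _ _ _ H1) as [_ H2]. rewrite length_code in H2.
    destruct (at_code_cons _ _ _ _ H2) as [_ H3].
    cbn [nsteps plus]. rewrite (step_jump_if _ _ _ _ _ Hj), H.
    replace (off + 1 + size c2 + 1)%nat with (off + size c2 + 2)%nat in H3 by lia.
    rewrite (IHlexec _ _ H3). simpl; do 2 f_equal; lia.
  - destruct (at_code_cons _ _ _ _ Hc) as [Hj H1].
    destruct (at_code_app _ _ _ _ H1) as [H2 H3]. rewrite length_code in H3.
    destruct (at_code_cons _ _ _ _ H3) as [H4 _].
    cbn [nsteps plus]. rewrite (step_jump_if _ _ _ _ _ Hj), H.
    rewrite <- (Nat.add_1_r off), (nsteps_add _ _ _ _ _ (IHlexec _ _ H2)).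
    cbn [nsteps]. rewrite (step_jmp _ _ _ _ H4). reflexivity.
  - destruct (at_code_app _ _ _ _ Hc) as [H1 H2]. rewrite length_code in H2.
    destruct (at_code_cons _ _ _ _ H2) as [H3 H4].
    destruct (at_code_cons _ _ _ _ H4) as [H5 _].
    rewrite (nsteps_add _ _ _ _ _ (IHlexec _ _ H1)).
    cbn [nsteps]. rewrite (step_jump_if _ _ _ _ _ H3), H0.
    rewrite <- (Nat.add_1_r (off + size pre)), (step_jmp _ _ _ _ H5). reflexivity.
  - destruct (at_code_app _ _ _ _ Hc) as [H4 H5]. rewrite length_code in H5.
    destruct (at_code_cons _ _ _ _ H5) as [H6 H7].
    destruct (at_code_cons _ _ _ _ H7) as [_ H8].
    destruct (at_code_app _ _ _ _ H8) as [H9 H10]. rewrite length_code in H10.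
    destruct (at_code_cons _ _ _ _ H10) as [H11 _].
    replace (off + size pre + 1 + 1)%nat with (off + size pre + 2)%nat in * by lia.
    rewrite (nsteps_add _ _ _ _ _ (IHlexec1 _ _ H4)).
    cbn [nsteps plus]. rewrite (step_jump_if _ _ _ _ _ H6), H0.
    rewrite (nsteps_add _ _ _ _ _ (IHlexec2 _ _ H9)).
    cbn [nsteps plus]. rewrite (step_jmp _ _ _ _ H11).
    apply IHlexec3; exact Hc.
Qed.

Fixpoint lseq (l : list instr) : low :=
  match l with [] => LSkip | i :: l' => LSeq (LPrim i) (lseq l') end.

Definition effs (l : list instr) (m : mem) : mem := fold_left (fun m i => eff i m) l m.

Lemma lexec_lseq l m :
  forallb nonjump l = true -> lexec (lseq l) m (effs l m) (length l).
Proof.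
  revert m; induction l as [|i l IH]; simpl; intros m H.
  - constructor.
  - apply andb_prop in H; destruct H.
    apply (lexec_seq _ _ _ _ _ 1 (length l) (lexec_prim i m H)); auto.
Qed.

Fixpoint noloop (c : low) : bool :=
  match c with
  | LSkip | LPrim _ => true
  | LSeq c1 c2 | LIf _ c1 c2 => noloop c1 && noloop c2
  | LWhile _ _ _ => false
  end.

(** Code for expressions may branch, because of truncated subtraction, but never loops; its size
    then bounds its time on every path. *)
Lemma noloop_time c m m' t : lexec c m m' t -> noloop c = true -> (t <= size c)%nat.
Proof.
  induction 1; simpl; intros Hn; try discriminate; try lia;
    apply andb_prop in Hn; destruct Hn; repeat match goal with
    | H : ?a = true -> _, H' : ?a = true |- _ => specialize (H H') end; lia.
Qed.

Lemma noloop_lseq l : noloop (lseq l) = true.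
Proof. induction l; simpl; auto. Qed.

(** * Array programs over natural and real numbers *)

Inductive iexp : Type :=
| IN (z : nat)
| IA (a : nat) (e : iexp)
| IPl (e1 e2 : iexp)
| IMi (e1 e2 : iexp).

Inductive rexp : Type :=
| RN (z : nat)
| RA (a : nat) (e : iexp)
| RPl (e1 e2 : rexp)
| RMi (e1 e2 : rexp)
| RMu (e1 e2 : rexp).

Inductive bexp : Type :=
| BLt (e1 e2 : rexp)
| BLe (e1 e2 : iexp).

Inductive cmd : Type :=
| Skip
| SetI (a : nat) (idx e : iexp)
| SetR (a : nat) (idx : iexp) (e : rexp)
| Seq (c1 c2 : cmd)
| If (b : bexp) (c1 c2 : cmd)
| While (b : bexp) (c : cmd).

Record hstate : Type := mkH { hi : nat -> nat -> nat; hr : nat -> nat -> R }.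

Definition upd2 {A : Type} (f : nat -> nat -> A) (a i : nat) (v : A) : nat -> nat -> A :=
  fun b => if Nat.eqb b a then upd (f b) i v else f b.

Fixpoint evi (e : iexp) (s : hstate) : nat :=
  match e with
  | IN z => z
  | IA a e => hi s a (evi e s)
  | IPl e1 e2 => evi e1 s + evi e2 s
  | IMi e1 e2 => evi e1 s - evi e2 s
  end.

Fixpoint evr (e : rexp) (s : hstate) : R :=
  match e with
  | RN z => IZR (Z.of_nat z)
  | RA a e => hr s a (evi e s)
  | RPl e1 e2 => evr e1 s + evr e2 s
  | RMi e1 e2 => evr e1 s - evr e2 s
  | RMu e1 e2 => evr e1 s * evr e2 s
  end.

Definition evb (b : bexp) (s : hstate) : bool :=
  match b with
  | BLt e1 e2 => if Rlt_dec (evr e1 s) (evr e2 s) then true else false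
  | BLe e1 e2 => Nat.leb (evi e1 s) (evi e2 s)
  end.

Definition seti (s : hstate) (a i v : nat) : hstate := mkH (upd2 (hi s) a i v) (hr s).
Definition setr (s : hstate) (a i : nat) (v : R) : hstate := mkH (hi s) (upd2 (hr s) a i v).

(** An assignment or a test costs one unit however large its expressions; [comp_correct] pays for
    them with the factor [size (comp c)]. *)
Inductive hexec : cmd -> hstate -> hstate -> nat -> Prop :=
| hexec_skip s : hexec Skip s s 1
| hexec_seti a idx e s : hexec (SetI a idx e) s (seti s a (evi idx s) (evi e s)) 1
| hexec_setr a idx e s : hexec (SetR a idx e) s (setr s a (evi idx s) (evr e s)) 1
| hexec_seq c1 c2 s1 s2 s3 t1 t2 :
    hexec c1 s1 s2 t1 -> hexec c2 s2 s3 t2 -> hexec (Seq c1 c2) s1 s3 (t1 + t2)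
| hexec_if_true b c1 c2 s s' t :
    evb b s = true -> hexec c1 s s' t -> hexec (If b c1 c2) s s' (1 + t)
| hexec_if_false b c1 c2 s s' t :
    evb b s = false -> hexec c2 s s' t -> hexec (If b c1 c2) s s' (1 + t)
| hexec_while_false b c s :
    evb b s = false -> hexec (While b c) s s 1
| hexec_while_true b c s1 s2 s3 t1 t2 :
    evb b s1 = true -> hexec c s1 s2 t1 -> hexec (While b c) s2 s3 t2 ->
    hexec (While b c) s1 s3 (1 + t1 + t2).

(* Entry [i] of array [a] lives at address [64 i + a] with [a < 48]; the machine
   registers [48..63] are therefore free to hold temporaries. *)
Definition rel (s : hstate) (m : mem) : Prop :=
  forall a i, (a < 48)%nat ->
    fst m (64 * i + a)%nat = Z.of_nat (hi s a i) /\ snd m (64 * i + a)%nat = hr s a i.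

(** Six doublings multiply the index by 64. The array number passes through register [S d], so [d]
    has to stay below 63. *)
Definition addr_code (a d : nat) : list instr :=
  repeat (IAdd d d d) 6 ++ [IConst (S d) (Z.of_nat a); IAdd d d (S d)].

Arguments addr_code : simpl never.
Arguments lseq : simpl never.

(** The value ends in register [d] and lower registers survive, so a second operand can be evaluated
    in [S d]. The test in the last case implements truncated subtraction. *)
Fixpoint compi (e : iexp) (d : nat) : low :=
  match e with
  | IN z => LPrim (IConst d (Z.of_nat z))
  | IA a e => LSeq (compi e d) (lseq (addr_code a d ++ [ILoad d d]))
  | IPl e1 e2 => LSeq (compi e1 d) (LSeq (compi e2 (S d)) (LPrim (IAdd d d (S d))))
  | IMi e1 e2 =>
      LSeq (compi e1 d) (LSeq (compi e2 (S d))
        (LIf (TI d (S d)) (LPrim (IConst d 0)) (LPrim (ISub d d (S d)))))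
  end.

(** Integer and real registers are separate banks: every array index is computed in integer register
    48 while pending real operands wait below [d]. *)
Fixpoint compr (e : rexp) (d : nat) : low :=
  match e with
  | RN z => lseq [IConst 48 (Z.of_nat z); RFromI d 48]
  | RA a e => LSeq (compi e 48) (lseq (addr_code a 48 ++ [RLoad d 48]))
  | RPl e1 e2 => LSeq (compr e1 d) (LSeq (compr e2 (S d)) (LPrim (RAdd d d (S d))))
  | RMi e1 e2 => LSeq (compr e1 d) (LSeq (compr e2 (S d)) (LPrim (RSub d d (S d))))
  | RMu e1 e2 => LSeq (compr e1 d) (LSeq (compr e2 (S d)) (LPrim (RMul d d (S d))))
  end.

Definition compb (b : bexp) : low :=
  match b with
  | BLt e1 e2 => LSeq (compr e1 48) (compr e2 49)
  | BLe e1 e2 => LSeq (compi e1 48) (compi e2 49)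
  end.

Definition compt (b : bexp) : test :=
  match b with BLt _ _ => TR 48 49 | BLe _ _ => TI 48 49 end.

Fixpoint comp (c : cmd) : low :=
  match c with
  | Skip => LSkip
  | SetI a idx e =>
      LSeq (compi e 48) (LSeq (compi idx 49) (lseq (addr_code a 49 ++ [IStore 49 48])))
  | SetR a idx e =>
      LSeq (compr e 48) (LSeq (compi idx 48) (lseq (addr_code a 48 ++ [RStore 48 48])))
  | Seq c1 c2 => LSeq (comp c1) (comp c2)
  | If b c1 c2 => LSeq (compb b) (LIf (compt b) (comp c1) (comp c2))
  | While b c => LWhile (compb b) (compt b) (comp c)
  end.

(** Boolean, so that for the concrete program the limits on array numbers and on the depth of
    temporaries are checked by computation. *)
Fixpoint wfi (e : iexp) (d : nat) : bool :=
  match e with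
  | IN _ => Nat.ltb d 63
  | IA a e => Nat.ltb a 48 && wfi e d
  | IPl e1 e2 | IMi e1 e2 => wfi e1 d && wfi e2 (S d)
  end.

Fixpoint wfr (e : rexp) (d : nat) : bool :=
  match e with
  | RN _ => Nat.ltb d 63
  | RA a e => Nat.ltb d 63 && (Nat.ltb a 48 && wfi e 48)
  | RPl e1 e2 | RMi e1 e2 | RMu e1 e2 => wfr e1 d && wfr e2 (S d)
  end.

Definition wfb (b : bexp) : bool :=
  match b with
  | BLt e1 e2 => wfr e1 48 && wfr e2 49
  | BLe e1 e2 => wfi e1 48 && wfi e2 49
  end.

Fixpoint wf (c : cmd) : bool :=
  match c with
  | Skip => true
  | SetI a idx e => Nat.ltb a 48 && (wfi idx 49 && wfi e 48)
  | SetR a idx e => Nat.ltb a 48 && (wfi idx 48 && wfr e 48)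
  | Seq c1 c2 => wf c1 && wf c2
  | If b c1 c2 => wfb b && (wf c1 && wf c2)
  | While b c => wfb b && wf c
  end.

Ltac bsplit := repeat match goal with
  | H : (_ && _)%bool = true |- _ => apply andb_prop in H; destruct H
  | H : Nat.ltb _ _ = true |- _ => apply Nat.ltb_lt in H
  end.

(** * Simulation of source programs by machine code *)

Lemma upd_eq {A} (f : nat -> A) i v : upd f i v i = v.
Proof. unfold upd; now rewrite Nat.eqb_refl. Qed.

Lemma upd_neq {A} (f : nat -> A) i j v : j <> i -> upd f i v j = f j.
Proof. intros; unfold upd; now rewrite (proj2 (Nat.eqb_neq j i)). Qed.

Lemma effs_app l1 l2 m : effs (l1 ++ l2) m = effs l2 (effs l1 m).
Proof. apply fold_left_app. Qed.

Lemma addr_code_correct a d m i :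
  fst m d = Z.of_nat i ->
  let m' := effs (addr_code a d) m in
  fst m' d = Z.of_nat (64 * i + a) /\
  (forall d', d' <> d -> d' <> S d -> fst m' d' = fst m d') /\ snd m' = snd m.
Proof.
  intros H; unfold addr_code, effs; cbn [repeat app fold_left].
  cbn [eff step nth at_pc fst snd pc ireg rreg].
  rewrite !upd_eq. rewrite !(upd_neq _ (S d) d) by lia. rewrite !upd_eq.
  repeat split.
  - rewrite H; lia.
  - intros d' H1 H2. now rewrite !upd_neq by auto.
Qed.

Lemma wfi_bound e d : wfi e d = true -> (d < 63)%nat.
Proof. revert d; induction e; simpl; intros; bsplit; auto. Qed.

Lemma wfr_bound e d : wfr e d = true -> (d < 63)%nat.
Proof. revert d; induction e; simpl; intros; bsplit; auto. Qed.

(** For [d >= 48] this covers all array cells: those of index 0 lie below 48, the others above the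
    register block at residues less than 48. *)
Definition same_below {A} (d : nat) (f g : nat -> A) : Prop :=
  forall d', (d' < d)%nat \/ (64 <= d' /\ d' mod 64 < 48)%nat -> f d' = g d'.

Lemma same_below_weaken {A} d d' (f g : nat -> A) :
  (d <= d')%nat -> same_below d' f g -> same_below d f g.
Proof. intros Hd H x [Hx|Hx]; apply H; [left; lia|now right]. Qed.

Lemma same_below_trans {A} d (f g h : nat -> A) :
  same_below d f g -> same_below d g h -> same_below d f h.
Proof. intros H1 H2 x Hx; rewrite H1; auto. Qed.

Lemma same_below_upd {A} d x (v : A) f :
  (d <= x < 64)%nat -> same_below d (upd f x v) f.
Proof. intros Hx y Hy; apply upd_neq; lia. Qed.

Lemma rel_same s m m' :
  rel s m -> same_below 48 (fst m') (fst m) -> same_below 48 (snd m') (snd m) -> rel s m'.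
Proof.
  intros H H1 H2 a i Ha.
  assert (Hx : (64 * i + a < 48 \/ 64 <= 64 * i + a /\ (64 * i + a) mod 64 < 48)%nat).
  { destruct i as [|i]; [left; lia|right; split; [lia|]].
    replace (64 * S i + a)%nat with (a + S i * 64)%nat by lia.
    rewrite Nat.Div0.mod_add, Nat.mod_small; lia. }
  rewrite H1, H2 by exact Hx. now apply H.
Qed.

Lemma compi_correct e s : forall d m,
  rel s m -> (48 <= d)%nat -> wfi e d = true ->
  exists m' t, lexec (compi e d) m m' t /\ fst m' d = Z.of_nat (evi e s) /\
    same_below d (fst m') (fst m) /\ snd m' = snd m.
Proof.
  induction e as [z|a e IH|e1 IH1 e2 IH2|e1 IH1 e2 IH2]; simpl; intros d m Hr Hd Hw; bsplit.
  - eexists _, _; split; [now constructor|]. cbn. rewrite upd_eq.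
    repeat split; auto. apply same_below_upd; lia.
  - destruct (IH d m Hr Hd H0) as (m1 & t & E & V & S1 & S2).
    pose proof (wfi_bound _ _ H0).
    destruct (addr_code_correct a d m1 _ V) as (V' & S1' & S2').
    exists (effs (addr_code a d ++ [ILoad d d]) m1), (t + 9)%nat; split;
      [eapply lexec_seq; [exact E|now apply lexec_lseq]|].
    rewrite effs_app. set (m2 := effs _ m1) in *. cbn -[Nat.mul Nat.add].
    assert (Sm : same_below d (fst m2) (fst m1)).
    { intros x Hx. apply S1'; intros ->; lia. }
    rewrite upd_eq, V', Nat2Z.id.
    repeat split; try congruence.
    + assert (Hm : rel s m2).
      { apply (rel_same s m); [exact Hr| |].
        - apply (same_below_weaken 48 d); [exact Hd|].
          eapply same_below_trans; eassumption.
        - rewrite S2', S2; intros x _; reflexivity. }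
      now apply Hm.
    + eapply same_below_trans; [apply same_below_upd; lia|].
      eapply same_below_trans; eassumption.
  - destruct (IH1 d m Hr Hd H) as (m1 & t1 & E1 & V1 & S1 & S1').
    assert (Hm : rel s m1).
    { apply (rel_same s m); [exact Hr| |].
      - now apply (same_below_weaken 48 d).
      - rewrite S1'; intros x _; reflexivity. }
    destruct (IH2 (S d) m1 Hm ltac:(lia) H0) as (m2 & t2 & E2 & V2 & S2 & S2').
    pose proof (wfi_bound _ _ H0).
    eexists _, _; split; [econstructor; [exact E1|econstructor; [exact E2|now constructor]]|].
    cbn. rewrite upd_eq, V2, (S2 d), V1 by lia.
    repeat split; [lia| |congruence].
    eapply same_below_trans; [apply same_below_upd; lia|].
    eapply same_below_trans; [|exact S1]. now apply (same_below_weaken d (S d)); [lia|].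
  - destruct (IH1 d m Hr Hd H) as (m1 & t1 & E1 & V1 & S1 & S1').
    assert (Hm : rel s m1).
    { apply (rel_same s m); [exact Hr| |].
      - now apply (same_below_weaken 48 d).
      - rewrite S1'; intros x _; reflexivity. }
    destruct (IH2 (S d) m1 Hm ltac:(lia) H0) as (m2 & t2 & E2 & V2 & S2 & S2').
    pose proof (wfi_bound _ _ H0).
    assert (V1' : fst m2 d = Z.of_nat (evi e1 s)) by (rewrite (S2 d); [exact V1|lia]).
    assert (Sm : same_below d (fst m2) (fst m)).
    { eapply same_below_trans; [|exact S1]. now apply (same_below_weaken d (S d)); [lia|]. }
    destruct (holds (TI d (S d)) m2) eqn:Ht;
      (eexists _, _; split; [econstructor; [exact E1|econstructor; [exact E2|]]|]).
    + apply lexec_if_true; [exact Ht|now constructor].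
    + simpl in Ht; rewrite V1', V2 in Ht; apply Z.leb_le in Ht.
      cbn. rewrite upd_eq. repeat split; [lia| |congruence].
      eapply same_below_trans; [apply same_below_upd; lia|exact Sm].
    + apply lexec_if_false; [exact Ht|now constructor].
    + simpl in Ht; rewrite V1', V2 in Ht; apply Z.leb_gt in Ht.
      cbn. rewrite upd_eq, V1', V2. repeat split; [lia| |congruence].
      eapply same_below_trans; [apply same_below_upd; lia|exact Sm].
Qed.

Lemma same_below_refl {A} d (f : nat -> A) : same_below d f f.
Proof. intros x _; reflexivity. Qed.

Lemma compr_correct e s : forall d m,
  rel s m -> (48 <= d)%nat -> wfr e d = true ->
  exists m' t, lexec (compr e d) m m' t /\ snd m' d = evr e s /\
    same_below 48 (fst m') (fst m) /\ same_below d (snd m') (snd m).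
Proof.
  (* The three arithmetic operations differ only in the final instruction and share one argument. *)
  assert (bin : forall e1 e2 (op : nat -> nat -> nat -> instr) (f : R -> R -> R),
    (forall d m, nonjump (op d d (S d)) = true /\
       eff (op d d (S d)) m = (fst m, upd (snd m) d (f (snd m d) (snd m (S d))))) ->
    (forall d m, rel s m -> (48 <= d)%nat -> wfr e1 d = true ->
       exists m' t, lexec (compr e1 d) m m' t /\ snd m' d = evr e1 s /\
       same_below 48 (fst m') (fst m) /\ same_below d (snd m') (snd m)) ->
    (forall d m, rel s m -> (48 <= d)%nat -> wfr e2 d = true ->
       exists m' t, lexec (compr e2 d) m m' t /\ snd m' d = evr e2 s /\
       same_below 48 (fst m') (fst m) /\ same_below d (snd m') (snd m)) ->
    forall d m, rel s m -> (48 <= d)%nat -> (wfr e1 d && wfr e2 (S d))%bool = true ->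
       exists m' t, lexec (LSeq (compr e1 d) (LSeq (compr e2 (S d)) (LPrim (op d d (S d))))) m m' t
       /\ snd m' d = f (evr e1 s) (evr e2 s) /\
       same_below 48 (fst m') (fst m) /\ same_below d (snd m') (snd m)).
  { intros e1 e2 op f Hop IH1 IH2 d m Hr Hd Hw; bsplit.
    destruct (IH1 d m Hr Hd H) as (m1 & t1 & E1 & V1 & S1 & S1').
    assert (Hm : rel s m1).
    { apply (rel_same s m); auto. now apply (same_below_weaken 48 d). }
    destruct (IH2 (S d) m1 Hm ltac:(lia) H0) as (m2 & t2 & E2 & V2 & S2 & S2').
    pose proof (wfr_bound _ _ H0). destruct (Hop d m2) as [Hop1 Hop2].
    eexists _, _; split; [econstructor; [exact E1|econstructor; [exact E2|constructor; exact Hop1]]|].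
    rewrite Hop2; simpl. rewrite upd_eq, V2, (S2' d), V1 by lia.
    repeat split; [eapply same_below_trans; eassumption|].
    eapply same_below_trans; [apply same_below_upd; lia|].
    eapply same_below_trans; [|exact S1']. now apply (same_below_weaken d (S d)); [lia|]. }
  induction e as [z|a e|e1 IH1 e2 IH2|e1 IH1 e2 IH2|e1 IH1 e2 IH2];
    intros d m Hr Hd Hw; simpl in Hw.
  - bsplit. eexists _, _; split; [apply lexec_lseq; reflexivity|]. cbn.
    rewrite !upd_eq. repeat split; apply same_below_upd; lia.
  - bsplit. destruct (compi_correct e s 48 m Hr (Nat.le_refl _) H1) as (m1 & t & E & V & S1 & S2).
    destruct (addr_code_correct a 48 m1 _ V) as (V' & S1' & S2').
    exists (effs (addr_code a 48 ++ [RLoad d 48]) m1), (t + 9)%nat; split;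
      [eapply lexec_seq; [exact E|now apply lexec_lseq]|].
    rewrite effs_app. set (m2 := effs _ m1) in *. cbn -[Nat.mul Nat.add].
    assert (Sm : same_below 48 (fst m2) (fst m)).
    { intros x Hx. rewrite S1', S1; try intros ->; auto; lia. }
    assert (Hm : rel s m2).
    { apply (rel_same s m); auto. rewrite S2', S2. apply same_below_refl. }
    rewrite upd_eq, V', Nat2Z.id. repeat split; auto.
    + now apply Hm.
    + rewrite S2', S2. apply same_below_upd; lia.
  - now apply (bin e1 e2 RAdd Rplus).
  - now apply (bin e1 e2 RSub Rminus).
  - now apply (bin e1 e2 RMul Rmult).
Qed.

Lemma compb_correct b s m :
  rel s m -> wfb b = true ->
  exists m' t, lexec (compb b) m m' t /\ holds (compt b) m' = evb b s /\ rel s m'.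
Proof.
  intros Hr Hw; destruct b as [e1 e2|e1 e2]; simpl in Hw; bsplit.
  - destruct (compr_correct e1 s 48 m Hr (Nat.le_refl _) H) as (m1 & t1 & E1 & V1 & S1 & S1').
    assert (Hm : rel s m1) by now apply (rel_same s m).
    destruct (compr_correct e2 s 49 m1 Hm ltac:(lia) H0) as (m2 & t2 & E2 & V2 & S2 & S2').
    exists m2, (t1 + t2)%nat; split; [econstructor; eassumption|].
    split; [|apply (rel_same s m1); auto; now apply (same_below_weaken 48 49); [lia|]].
    simpl. rewrite V2, (S2' 48%nat), V1 by lia. reflexivity.
  - destruct (compi_correct e1 s 48 m Hr (Nat.le_refl _) H) as (m1 & t1 & E1 & V1 & S1 & S1').
    assert (Hm : rel s m1)
      by (apply (rel_same s m); auto; rewrite S1'; apply same_below_refl).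
    destruct (compi_correct e2 s 49 m1 Hm ltac:(lia) H0) as (m2 & t2 & E2 & V2 & S2 & S2').
    exists m2, (t1 + t2)%nat; split; [econstructor; eassumption|].
    split; [|apply (rel_same s m1); auto;
      [now apply (same_below_weaken 48 49); [lia|]|rewrite S2'; apply same_below_refl]].
    simpl. rewrite V2, (S2 48%nat), V1 by lia.
    destruct (Nat.leb_spec (evi e1 s) (evi e2 s)); [apply Z.leb_le|apply Z.leb_gt]; lia.
Qed.

Lemma addr_inj a b i j :
  (a < 64)%nat -> (b < 64)%nat -> (64 * i + a = 64 * j + b)%nat -> i = j /\ a = b.
Proof. lia. Qed.

Lemma noloop_compi e d : noloop (compi e d) = true.
Proof. revert d; induction e; intros d; simpl; rewrite ?noloop_lseq, ?IHe, ?IHe1, ?IHe2; auto. Qed.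

Lemma noloop_compr e d : noloop (compr e d) = true.
Proof.
  revert d; induction e; intros d; simpl; rewrite ?noloop_lseq, ?noloop_compi, ?IHe1, ?IHe2; auto.
Qed.

Lemma noloop_compb b : noloop (compb b) = true.
Proof. destruct b; simpl; rewrite ?noloop_compi, ?noloop_compr; auto. Qed.

Lemma comp_correct c s s' t :
  hexec c s s' t -> wf c = true -> forall m, rel s m ->
  exists m' t', lexec (comp c) m m' t' /\ rel s' m' /\ (t' <= size (comp c) * t)%nat.
Proof.
  induction 1; simpl wf; intros Hw m Hr; bsplit.
  - exists m, 0%nat; split; [constructor|split; [exact Hr|lia]].
  - destruct (compi_correct e s 48 m Hr (Nat.le_refl _) H1) as (m1 & t1 & E1 & V1 & S1 & S1').
    assert (Hm : rel s m1)
      by (apply (rel_same s m); auto; rewrite S1'; apply same_below_refl).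
    destruct (compi_correct idx s 49 m1 Hm ltac:(lia) H0) as (m2 & t2 & E2 & V2 & S2 & S2').
    assert (Hm2 : rel s m2)
      by (apply (rel_same s m1); auto;
      [now apply (same_below_weaken 48 49); [lia|]|rewrite S2'; apply same_below_refl]).
    destruct (addr_code_correct a 49 m2 _ V2) as (V' & T1 & T2).
    exists (effs (addr_code a 49 ++ [IStore 49 48]) m2), (t1 + (t2 + 9))%nat; split;
      [eapply lexec_seq; [exact E1|eapply lexec_seq; [exact E2|now apply lexec_lseq]]|].
    split.
    + rewrite effs_app.
      set (m3 := effs _ m2) in *. intros b i Hb. cbn -[Nat.mul Nat.add].
      rewrite V', Nat2Z.id, (T1 48%nat), (S2 48%nat), V1 by lia.
      split; [|rewrite T2; now apply Hm2].
      unfold upd2, upd. destruct (Nat.eqb_spec (64 * i + b) (64 * evi idx s + a)).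
      * destruct (addr_inj b a i (evi idx s)) as [-> ->]; try lia.
        now rewrite !Nat.eqb_refl.
      * rewrite T1 by lia.
        destruct (Nat.eqb_spec b a) as [->|]; [|now apply Hm2].
        destruct (Nat.eqb_spec i (evi idx s)) as [->|]; [lia|now apply Hm2].
    + apply noloop_time in E1; [|apply noloop_compi].
      apply noloop_time in E2; [|apply noloop_compi]. simpl; lia.
  - destruct (compr_correct e s 48 m Hr (Nat.le_refl _) H1) as (m1 & t1 & E1 & V1 & S1 & S1').
    assert (Hm : rel s m1) by now apply (rel_same s m).
    destruct (compi_correct idx s 48 m1 Hm ltac:(lia) H0) as (m2 & t2 & E2 & V2 & S2 & S2').
    assert (Hm2 : rel s m2)
      by (apply (rel_same s m1); auto; rewrite S2'; apply same_below_refl).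
    destruct (addr_code_correct a 48 m2 _ V2) as (V' & T1 & T2).
    exists (effs (addr_code a 48 ++ [RStore 48 48]) m2), (t1 + (t2 + 9))%nat; split;
      [eapply lexec_seq; [exact E1|eapply lexec_seq; [exact E2|now apply lexec_lseq]]|].
    split.
    + rewrite effs_app.
      set (m3 := effs _ m2) in *. intros b i Hb. cbn -[Nat.mul Nat.add].
      rewrite V', Nat2Z.id, T2, S2', V1.
      split; [rewrite T1 by lia; now apply Hm2|].
      unfold upd2, upd. destruct (Nat.eqb_spec (64 * i + b) (64 * evi idx s + a)).
      * destruct (addr_inj b a i (evi idx s)) as [-> ->]; try lia.
        now rewrite !Nat.eqb_refl.
      * destruct (Nat.eqb_spec b a) as [->|]; [|now apply Hm].
        destruct (Nat.eqb_spec i (evi idx s)) as [->|]; [lia|now apply Hm].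
    + apply noloop_time in E1; [|apply noloop_compr].
      apply noloop_time in E2; [|apply noloop_compi]. simpl; lia.
  - destruct (IHhexec1 H1 m Hr) as (m1 & u1 & E1 & R1 & T1).
    destruct (IHhexec2 H2 m1 R1) as (m2 & u2 & E2 & R2 & T2).
    eexists _, _; split; [econstructor; eassumption|split; [exact R2|simpl; nia]].
  - destruct (compb_correct b s m Hr H1) as (m1 & u1 & E1 & V1 & R1).
    destruct (IHhexec H2 m1 R1) as (m2 & u2 & E2 & R2 & T2).
    eexists _, _; split;
      [econstructor; [exact E1|apply lexec_if_true; [congruence|exact E2]]|split; [exact R2|]].
    apply noloop_time in E1; [|apply noloop_compb]. simpl; nia.
  - destruct (compb_correct b s m Hr H1) as (m1 & u1 & E1 & V1 & R1).
    destruct (IHhexec H3 m1 R1) as (m2 & u2 & E2 & R2 & T2).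
    eexists _, _; split;
      [econstructor; [exact E1|apply lexec_if_false; [congruence|exact E2]]|split; [exact R2|]].
    apply noloop_time in E1; [|apply noloop_compb]. simpl; nia.
  - destruct (compb_correct b s m Hr H0) as (m1 & u1 & E1 & V1 & R1).
    eexists _, _; split;
      [apply lexec_while_false; [exact E1|congruence]|split; [exact R1|]].
    apply noloop_time in E1; [|apply noloop_compb]. simpl; lia.
  - destruct (compb_correct b s1 m Hr H2) as (m1 & u1 & E1 & V1 & R1).
    destruct (IHhexec1 H3 m1 R1) as (m2 & u2 & E2 & R2 & T2).
    assert (Hw : wf (While b c) = true) by (simpl; now rewrite H2, H3).
    destruct (IHhexec2 Hw m2 R2) as (m3 & u3 & E3 & R3 & T3).
    eexists _, _; split;
      [eapply lexec_while_true; [exact E1|congruence|exact E2|exact E3]|split; [exact R3|]].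
    apply noloop_time in E1; [|apply noloop_compb]. simpl in T3 |- *; nia.
Qed.

(** * Total correctness with running time *)

Definition btrue (b : bexp) (s : hstate) : Prop :=
  match b with
  | BLt e1 e2 => evr e1 s < evr e2 s
  | BLe e1 e2 => (evi e1 s <= evi e2 s)%nat
  end.

Definition bfalse (b : bexp) (s : hstate) : Prop :=
  match b with
  | BLt e1 e2 => evr e2 s <= evr e1 s
  | BLe e1 e2 => (evi e2 s < evi e1 s)%nat
  end.

Lemma evb_spec b s :
  (evb b s = true /\ btrue b s) \/ (evb b s = false /\ bfalse b s).
Proof.
  destruct b; simpl.
  - destruct Rlt_dec; [now left|right; split; [easy|lra]].
  - destruct (Nat.leb_spec (evi e1 s) (evi e2 s)); auto.
Qed.

Definition tc (c : cmd) (s : hstate) (T : nat) (Q : hstate -> Prop) : Prop :=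
  exists s' t, hexec c s s' t /\ (t <= T)%nat /\ Q s'.

Fixpoint modi (c : cmd) : list nat :=
  match c with
  | Skip | SetR _ _ _ => []
  | SetI a _ _ => [a]
  | Seq c1 c2 | If _ c1 c2 => modi c1 ++ modi c2
  | While _ c => modi c
  end.

Fixpoint modr (c : cmd) : list nat :=
  match c with
  | Skip | SetI _ _ _ => []
  | SetR a _ _ => [a]
  | Seq c1 c2 | If _ c1 c2 => modr c1 ++ modr c2
  | While _ c => modr c
  end.

(** The modified arrays are collected syntactically, so a preserved array is recognized by [eq_refl]
    and specifications mention only what changes. *)
Definition frame (c : cmd) (s s' : hstate) : Prop :=
  (forall a, existsb (Nat.eqb a) (modi c) = false -> hi s' a = hi s a) /\
  (forall a, existsb (Nat.eqb a) (modr c) = false -> hr s' a = hr s a).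

Lemma frame_hi a c s s' :
  frame c s s' -> existsb (Nat.eqb a) (modi c) = false -> hi s' a = hi s a.
Proof. intros [H _]; auto. Qed.

Lemma frame_hr a c s s' :
  frame c s s' -> existsb (Nat.eqb a) (modr c) = false -> hr s' a = hr s a.
Proof. intros [_ H]; auto. Qed.

Lemma frame_refl c s : frame c s s.
Proof. split; auto. Qed.

Lemma frame_trans c s1 s2 s3 : frame c s1 s2 -> frame c s2 s3 -> frame c s1 s3.
Proof.
  intros [H1 H2] [H3 H4]; split; intros a Ha.
  - rewrite H3, H1; auto.
  - rewrite H4, H2; auto.
Qed.

Lemma upd2_neq {A} (f : nat -> nat -> A) a i v b : b <> a -> upd2 f a i v b = f b.
Proof. intros; unfold upd2; now rewrite (proj2 (Nat.eqb_neq b a)). Qed.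

Lemma hexec_frame c s s' t : hexec c s s' t -> frame c s s'.
Proof.
  induction 1.
  - apply frame_refl.
  - split; simpl; auto. intros b Hb. rewrite orb_false_r in Hb.
    apply Nat.eqb_neq in Hb. now apply upd2_neq.
  - split; simpl; auto. intros b Hb. rewrite orb_false_r in Hb.
    apply Nat.eqb_neq in Hb. now apply upd2_neq.
  - destruct IHhexec1 as [A1 A2], IHhexec2 as [B1 B2]; split; simpl; intros a Ha;
      rewrite existsb_app in Ha; apply orb_false_elim in Ha; destruct Ha.
    + now rewrite B1, A1.
    + now rewrite B2, A2.
  - destruct IHhexec as [A1 A2]; split; simpl; intros a Ha;
      rewrite existsb_app in Ha; apply orb_false_elim in Ha; destruct Ha; auto.
  - destruct IHhexec as [A1 A2]; split; simpl; intros a Ha;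
      rewrite existsb_app in Ha; apply orb_false_elim in Ha; destruct Ha; auto.
  - apply frame_refl.
  - destruct IHhexec1 as [A1 A2].
    apply (frame_trans _ _ s2); [split; [exact A1|exact A2]|exact IHhexec2].
Qed.

Lemma tc_weaken c s T T' (Q Q' : hstate -> Prop) :
  tc c s T Q -> (T <= T')%nat -> (forall s', frame c s s' -> Q s' -> Q' s') -> tc c s T' Q'.
Proof.
  intros (s' & t & E & Ht & HQ) HT H. exists s', t; split; [exact E|split; [lia|]].
  apply H; auto. exact (hexec_frame _ _ _ _ E).
Qed.

Lemma tc_seq c1 c2 s T1 T2 Q1 Q :
  tc c1 s T1 Q1 ->
  (forall s', frame c1 s s' -> Q1 s' -> tc c2 s' T2 Q) ->
  tc (Seq c1 c2) s (T1 + T2) Q.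
Proof.
  intros (s1 & t1 & E1 & Ht1 & H1) H2.
  destruct (H2 s1 (hexec_frame _ _ _ _ E1) H1) as (s2 & t2 & E2 & Ht2 & HQ).
  exists s2, (t1 + t2)%nat; split; [econstructor; eassumption|split; [lia|exact HQ]].
Qed.

Lemma tc_if b c1 c2 s T Q :
  (btrue b s -> tc c1 s T Q) -> (bfalse b s -> tc c2 s T Q) ->
  tc (If b c1 c2) s (S T) Q.
Proof.
  intros H1 H2; destruct (evb_spec b s) as [[Hv Hb]|[Hv Hb]].
  - destruct (H1 Hb) as (s' & t & E & Ht & HQ).
    exists s', (1 + t)%nat; split; [now constructor|split; [lia|exact HQ]].
  - destruct (H2 Hb) as (s' & t & E & Ht & HQ).
    exists s', (1 + t)%nat; split; [now constructor|split; [lia|exact HQ]].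
Qed.

(** The measure is a parameter of the invariant, not a function of the state, and may drop by more
    than one per iteration. Frames refer to the state before the loop, so facts about untouched
    arrays need no place in the invariant. *)
Lemma tc_while b c s0 (I : nat -> hstate -> Prop) B m (Q : hstate -> Prop) :
  I m s0 ->
  (forall m s, frame c s0 s -> I m s -> btrue b s ->
     tc c s B (fun s' => frame c s0 s' -> exists m', (m' < m)%nat /\ I m' s')) ->
  (forall m s, frame c s0 s -> I m s -> bfalse b s -> Q s) ->
  tc (While b c) s0 (m * (B + 1) + 1) Q.
Proof.
  intros Hi Hb He.
  assert (H : forall m s, frame c s0 s -> I m s -> tc (While b c) s (m * (B + 1) + 1) Q).
  { clear m Hi. induction m as [m IH] using (well_founded_induction lt_wf).
    intros s Hf Hi. destruct (evb_spec b s) as [[Hv Ht]|[Hv Ht]].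
    - destruct (Hb m s Hf Hi Ht) as (s1 & t1 & E1 & Ht1 & H1).
      assert (Hf1 : frame c s0 s1)
        by exact (frame_trans _ _ _ _ Hf (hexec_frame _ _ _ _ E1)).
      destruct (H1 Hf1) as (m' & Hm & Hi').
      destruct (IH m' Hm s1 Hf1 Hi') as (s2 & t2 & E2 & Ht2 & HQ).
      exists s2, (1 + t1 + t2)%nat; split; [eapply hexec_while_true; eassumption|].
      assert (S m' * (B + 1) <= m * (B + 1))%nat by (apply Nat.mul_le_mono_r; lia).
      split; [lia|exact HQ].
    - exists s, 1%nat; split; [now constructor|split; [apply Nat.le_add_l|]]. now apply (He m). }
  apply H; auto. apply frame_refl.
Qed.

(** Meant for straight-line blocks and branches; loops get [False] because they go through
    [tc_while]. *)
Fixpoint wp (c : cmd) (Q : hstate -> Prop) (s : hstate) : Prop :=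
  match c with
  | Skip => Q s
  | SetI a idx e => Q (seti s a (evi idx s) (evi e s))
  | SetR a idx e => Q (setr s a (evi idx s) (evr e s))
  | Seq c1 c2 => wp c1 (wp c2 Q) s
  | If b c1 c2 =>
      (btrue b s -> wp c1 Q s) /\ (bfalse b s -> wp c2 Q s)
  | While _ _ => False
  end.

Fixpoint csize (c : cmd) : nat :=
  match c with
  | Seq c1 c2 => csize c1 + csize c2
  | If _ c1 c2 => 1 + (csize c1 + csize c2)
  | _ => 1
  end.

Lemma tc_wp c : forall s Q, wp c Q s -> tc c s (csize c) Q.
Proof.
  induction c; intros s Q H; simpl in H.
  - exists s, 1%nat; repeat split; auto; constructor.
  - eexists _, 1%nat; split; [constructor|split; [simpl; lia|exact H]].
  - eexists _, 1%nat; split; [constructor|split; [simpl; lia|exact H]].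
  - eapply tc_seq; [apply IHc1; exact H|]. intros s' _ H'. now apply IHc2.
  - destruct H as [H1 H2]. apply (tc_if b c1 c2 s (csize c1 + csize c2)); intros Hb.
    + eapply tc_weaken; [apply IHc1; auto|lia|auto].
    + eapply tc_weaken; [apply IHc2; auto|lia|auto].
  - contradiction.
Qed.


(** Only the assigned array is described and the rest is left to the frame: the new state stays a
    variable, and no nested updates accumulate. *)
Lemma tc_seti_seq a idx e c s T Q :
  (forall s', frame (SetI a idx e) s s' ->
     hi s' a = upd (hi s a) (evi idx s) (evi e s) -> tc c s' T Q) ->
  tc (Seq (SetI a idx e) c) s (1 + T) Q.
Proof.
  intros H. eapply tc_seq; [|exact (fun s' F => H s' F)].
  eexists _, 1%nat; split; [constructor|split; [lia|]].
  simpl; unfold upd2; now rewrite Nat.eqb_refl.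
Qed.

Lemma tc_setr_seq a idx e c s T Q :
  (forall s', frame (SetR a idx e) s s' ->
     hr s' a = upd (hr s a) (evi idx s) (evr e s) -> tc c s' T Q) ->
  tc (Seq (SetR a idx e) c) s (1 + T) Q.
Proof.
  intros H. eapply tc_seq; [|exact (fun s' F => H s' F)].
  eexists _, 1%nat; split; [constructor|split; [lia|]].
  simpl; unfold upd2; now rewrite Nat.eqb_refl.
Qed.

(** * Strict maximizers and calipers on convex chains *)

Definition dist2 (x y : nat -> R) (p q : nat) : R :=
  (x p - x q) * (x p - x q) + (y p - y q) * (y p - y q).

Definition lin (x y : nat -> R) (a b : R) (p : nat) : R := a * x p + b * y p.

(** Twice the signed area of the triangle [p], [q], [r]; it is negative exactly for a clockwise
    turn. *)
Definition cross (x y : nat -> R) (p q r : nat) : R :=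
  (x q - x p) * (y r - y q) - (y q - y p) * (x r - x q).

Definition chain (x y : nat -> R) (c : nat -> nat) (m : nat) : Prop :=
  (forall t, (t + 1 < m)%nat -> x (c t) < x (c (t + 1)%nat)) /\
  (forall t, (t + 2 < m)%nat -> cross x y (c t) (c (t + 1)%nat) (c (t + 2)%nat) < 0).

Definition strict_max (x y : nat -> R) (a b : R) (Q : nat -> Prop) (p : nat) : Prop :=
  Q p /\ forall q, Q q -> q <> p -> lin x y a b q < lin x y a b p.

(* Only the part of the hull that calipers can touch is required: the strict
   maximizers of the linear forms whose second coefficient is nonnegative. *)
Definition upper_hull (x y : nat -> R) (Q : nat -> Prop) (c : nat -> nat) (m : nat) : Prop :=
  chain x y c m /\ (forall t, (t < m)%nat -> Q (c t)) /\
  (forall a b p, 0 <= b -> strict_max x y a b Q p -> exists t, (t < m)%nat /\ c t = p).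

Lemma dist2_sym x y p q : dist2 x y p q = dist2 x y q p.
Proof. unfold dist2; ring. Qed.

Lemma dist2_nonneg x y p q : 0 <= dist2 x y p q.
Proof. apply Rplus_le_le_0_compat; apply Rle_0_sqr. Qed.

Lemma dist2_refl x y p : dist2 x y p p = 0.
Proof. unfold dist2; ring. Qed.

Lemma cross_lin x y a b p q r :
  b * cross x y p q r =
  (x q - x p) * (lin x y a b r - lin x y a b q)
  - (lin x y a b q - lin x y a b p) * (x r - x q).
Proof. unfold cross, lin; ring. Qed.

(** If [q] were a peak of the form between [p] and [r], both terms on the right of [cross_lin] would
    be negative, while the left side is not. *)
Lemma pop_not_max x y a b p q r :
  0 <= b -> x p < x q -> x q < x r -> 0 <= cross x y p q r ->
  lin x y a b p < lin x y a b q -> lin x y a b r < lin x y a b q -> False.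
Proof. intros. pose proof (cross_lin x y a b p q r). nra. Qed.

Lemma chain_x_lt x y c m t t' :
  chain x y c m -> (t < t')%nat -> (t' < m)%nat -> x (c t) < x (c t').
Proof.
  intros [H _]; induction 1 as [|t' Hlt IH]; intros Hm.
  - specialize (H t); rewrite Nat.add_1_r in H; apply H; lia.
  - apply Rlt_trans with (x (c t')); [apply IH; lia|].
    specialize (H t'); rewrite Nat.add_1_r in H; apply H; lia.
Qed.

Lemma chain_inj x y c m t t' :
  chain x y c m -> (t < m)%nat -> (t' < m)%nat -> t <> t' -> c t <> c t'.
Proof.
  intros H Ht Ht' Hn He.
  destruct (Nat.lt_total t t') as [Hl|[Hl|Hl]]; [|lia|];
    pose proof (chain_x_lt _ _ _ _ _ _ H Hl ltac:(assumption)) as Hx;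
    rewrite He in Hx; lra.
Qed.

(** Discrete concavity: along a clockwise chain the increments of a form with [b >= 0] can change
    sign only from plus to minus. This is again the identity [cross_lin]. *)
Lemma chain_step x y c m a b t :
  chain x y c m -> 0 <= b -> (t + 2 < m)%nat ->
  let d t := lin x y a b (c (S t)) - lin x y a b (c t) in
  (d t <= 0 -> d (S t) <= 0) /\ (d t < 0 -> d (S t) < 0).
Proof.
  intros [Hx Hc] Hb Hm d.
  pose proof (Hc t Hm) as Hcr.
  pose proof (Hx t ltac:(lia)) as H1. pose proof (Hx (S t) ltac:(lia)) as H2.
  replace (t + 2)%nat with (S (S t)) in Hcr by lia.
  rewrite Nat.add_1_r in *.
  pose proof (cross_lin x y a b (c t) (c (S t)) (c (S (S t)))) as E.
  fold (d t) (d (S t)) in E.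
  assert (b * cross x y (c t) (c (S t)) (c (S (S t))) <= 0) by nra.
  split; intros Hd; [apply Rnot_lt_le|apply Rnot_le_lt]; intros Hn.
  - assert (0 < (x (c (S t)) - x (c t)) * d (S t)) by (apply Rmult_lt_0_compat; lra).
    assert (0 <= - d t * (x (c (S (S t))) - x (c (S t)))) by (apply Rmult_le_pos; lra).
    lra.
  - assert (0 <= (x (c (S t)) - x (c t)) * d (S t)) by (apply Rmult_le_pos; lra).
    assert (0 < - d t * (x (c (S (S t))) - x (c (S t)))) by (apply Rmult_lt_0_compat; lra).
    lra.
Qed.

Lemma chain_decrease x y c m a b t t' :
  chain x y c m -> 0 <= b -> (t <= t')%nat -> (t' + 1 < m)%nat ->
  let d t := lin x y a b (c (S t)) - lin x y a b (c t) in
  (d t <= 0 -> d t' <= 0) /\ (d t < 0 -> d t' < 0).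
Proof.
  intros Hc Hb Htt' Hm d; induction Htt' as [|t' Hle IH]; [tauto|].
  destruct (IH ltac:(lia)).
  destruct (chain_step x y c m a b t' Hc Hb ltac:(lia)). fold (d t') (d (S t')) in *. tauto.
Qed.

Lemma chain_unimodal x y c m a b Q u :
  chain x y c m -> 0 <= b -> (forall t, (t < m)%nat -> Q (c t)) ->
  (u < m)%nat -> strict_max x y a b Q (c u) ->
  (forall t, (t < u)%nat -> lin x y a b (c t) < lin x y a b (c (t + 1)%nat)) /\
  (forall t, (u <= t)%nat -> (t + 1 < m)%nat ->
     lin x y a b (c (t + 1)%nat) < lin x y a b (c t)).
Proof.
  intros Hc Hb HQ Hu [_ Hmax].
  assert (Hlt : forall t, (t < m)%nat -> t <> u -> lin x y a b (c t) < lin x y a b (c u)).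
  { intros t Ht Hn. apply Hmax; [auto|]. now apply (chain_inj x y c m). }
  split.
  - intros t Ht.
    destruct (Nat.eq_dec (t + 1) u) as [He|Hne].
    { rewrite He. apply Hlt; lia. }
    (* A step before [u] without increase would, by concavity, be followed by no increase up to [u],
       against the strict maximality of [c u]. *)
    apply Rnot_le_lt; intros Hle.
    assert (Hdec : forall t', (t <= t')%nat -> (t' <= u)%nat ->
      lin x y a b (c t') <= lin x y a b (c t)).
    { rewrite Nat.add_1_r in Hle. induction 1 as [|t' H1 IH]; intros H2; [lra|].
      destruct (chain_decrease x y c m a b t t' Hc Hb ltac:(lia) ltac:(lia)) as [Hd _].
      specialize (IH ltac:(lia)). lra. }
    specialize (Hdec u ltac:(lia) ltac:(lia)). specialize (Hlt t ltac:(lia) ltac:(lia)). lra.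
  - intros t Ht Hm.
    destruct (chain_decrease x y c m a b u t Hc Hb Ht Hm) as [_ H].
    assert (lin x y a b (c (S u)) < lin x y a b (c u)) by (apply Hlt; lia).
    rewrite Nat.add_1_r. lra.
Qed.

(** Slopes compared without division; the abscissa differences are positive along chains. *)
Definition steeper (x y : nat -> R) (p p' q q' : nat) : Prop :=
  (y q' - y q) * (x p' - x p) < (y p' - y p) * (x q' - x q).

(** For [b > 0] the slope [-a/b] of the level lines separates the two edges; for [b = 0] the form
    cannot rise along one rightward edge and fall along another. Multiplying the slope difference by
    [b] treats both cases at once. *)
Lemma steeper_lin x y a b p p' q q' :
  0 <= b -> x p < x p' -> x q < x q' ->
  lin x y a b p < lin x y a b p' -> lin x y a b q' < lin x y a b q ->
  steeper x y p p' q q'.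
Proof.
  intros Hb H1 H2 H3 H4; unfold steeper.
  assert (E : b * ((y p' - y p) * (x q' - x q) - (y q' - y q) * (x p' - x p)) =
    (lin x y a b p' - lin x y a b p) * (x q' - x q) +
    (lin x y a b q - lin x y a b q') * (x p' - x p)) by (unfold lin; ring).
  assert (0 < (lin x y a b p' - lin x y a b p) * (x q' - x q))
    by (apply Rmult_lt_0_compat; lra).
  assert (0 < (lin x y a b q - lin x y a b q') * (x p' - x p))
    by (apply Rmult_lt_0_compat; lra).
  apply Rnot_le_lt; intros Hn. nra.
Qed.

(** Written as a subtraction from 0 to be convertible with the value of [yexp true]. *)
Definition mirror (y : nat -> R) (p : nat) : R := 0 - y p.

Definition is_diam (x y : nat -> R) (Q : nat -> Prop) (p q : nat) : Prop :=
  Q p /\ Q q /\ forall p' q', Q p' -> Q q' -> dist2 x y p' q' <= dist2 x y p q.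

(** Mirroring turns minimizers into maximizers without changing the sign of the second coefficient,
    so facts on upper hulls also apply to lower hulls. *)
Lemma lin_mirror x y a b p : lin x (mirror y) (- a) b p = - lin x y a b p.
Proof. unfold lin, mirror; ring. Qed.

(* The disc around [q] through [p] contains [Q] and touches the line through [p]
   orthogonal to [p - q] only at [p]. *)
Lemma diam_strict_max x y Q p q :
  is_diam x y Q p q ->
  (forall p' q', Q p' -> Q q' -> p' <> q' -> 0 < dist2 x y p' q') ->
  strict_max x y (x p - x q) (y p - y q) Q p /\
  strict_max x (mirror y) (- (x p - x q)) (y p - y q) Q q.
Proof.
  intros (Hp & Hq & Hd) Hpos; split; (split; [assumption|]); intros v Hv Hn.
  - pose proof (Hd v q Hv Hq) as H1. pose proof (Hpos v p Hv Hp Hn) as H2.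
    unfold lin, dist2 in *. nra.
  - rewrite !lin_mirror. apply Ropp_lt_contravar.
    pose proof (Hd p v Hp Hv) as H1. pose proof (Hpos v q Hv Hq Hn) as H2.
    unfold lin, dist2 in *. nra.
Qed.

(* With [(u a, l b)] the diametral pair, a caliper position [(i, j)] that is
   componentwise before it is never moved past it. *)
Definition guides (x y : nat -> R) (u l : nat -> nat) (um lm a b : nat) : Prop :=
  (a < um)%nat /\ (b < lm)%nat /\
  (forall i, (i < a)%nat -> (0 < b)%nat ->
     steeper x y (u i) (u (i + 1)%nat) (l (b - 1)%nat) (l b)) /\
  (forall j, (b < j)%nat -> (j < lm)%nat -> (a + 1 < um)%nat ->
     ~ steeper x y (u a) (u (a + 1)%nat) (l (j - 1)%nat) (l j)).

Lemma diam_guides x y Q u um l lm p q :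
  upper_hull x y Q u um -> upper_hull x (mirror y) Q l lm ->
  is_diam x y Q p q -> 0 <= y p - y q ->
  (forall p' q', Q p' -> Q q' -> p' <> q' -> 0 < dist2 x y p' q') ->
  exists a b, u a = p /\ l b = q /\ guides x y u l um lm a b.
Proof.
  intros (Hcu & HQu & Hu) (Hcl & HQl & Hl) Hd Hy Hpos.
  destruct (diam_strict_max x y Q p q Hd Hpos) as [Mp Mq].
  destruct (Hu _ _ _ Hy Mp) as (a & Ha & Ea).
  destruct (Hl _ _ _ Hy Mq) as (b & Hb & Eb).
  exists a, b; do 2 (split; [assumption|]).
  subst p q.
  destruct (chain_unimodal _ _ _ _ _ _ _ _ Hcu Hy HQu Ha Mp) as [U1 U2].
  destruct (chain_unimodal _ _ _ _ _ _ _ _ Hcl Hy HQl Hb Mq) as [L1 L2].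
  set (ax := x (u a) - x (l b)) in *. set (ay := y (u a) - y (l b)) in *.
  split; [exact Ha|split; [exact Hb|split]].
  (* To the left of [a] the upper edges rise along the form [p - q], while the lower edge that ends
     at [b] falls. *)
  - intros i Hi Hb0. apply (steeper_lin x y ax ay); auto.
    + apply (proj1 Hcu); lia.
    + apply (chain_x_lt x (mirror y) l lm); auto; lia.
    + specialize (L1 (b - 1)%nat ltac:(lia)).
      replace (b - 1 + 1)%nat with b in L1 by lia. rewrite !lin_mirror in L1. lra.
  - intros j Hj Hj' Hi Hs.
    specialize (U2 a (le_n a) Hi).
    specialize (L2 (j - 1)%nat ltac:(lia) ltac:(lia)).
    replace (j - 1 + 1)%nat with j in L2 by lia. rewrite !lin_mirror in L2.
    (* Here the upper edge falls and the lower edge rises. The mirrored, negated form reverses both,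
       and the slope inequality it yields is the opposite one. *)
    assert (Hs' : steeper x (mirror y) (u a) (u (a + 1)%nat) (l (j - 1)%nat) (l j)).
    { apply (steeper_lin x (mirror y) (- ax) ay); auto.
      - apply (proj1 Hcu); lia.
      - apply (chain_x_lt x (mirror y) l lm); auto; lia.
      - rewrite !lin_mirror; lra.
      - rewrite !lin_mirror; lra. }
    unfold steeper, mirror in *. lra.
Qed.

Lemma exists_argmax {A} (f : A -> R) (l : list A) :
  l <> [] -> exists p, In p l /\ forall q, In q l -> f q <= f p.
Proof.
  induction l as [|a l IH]; [congruence|intros _].
  destruct l as [|b l].
  - exists a; split; [now left|]. intros q [->|[]]; lra.
  - destruct IH as (p & Hp & Hm); [congruence|].
    destruct (Rle_lt_dec (f a) (f p)).
    + exists p; split; [now right|]. intros q [->|Hq]; auto.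
    + exists a; split; [now left|]. intros q [->|Hq]; [lra|]. specialize (Hm q Hq); lra.
Qed.

(** The pair is ordered by height so that the form [p - q] has a nonnegative second coefficient, the
    only kind about which [upper_hull] speaks. *)
Lemma diam_exists x y Q n :
  (forall p, {Q p} + {~ Q p}) -> (forall p, Q p -> (p < n)%nat) ->
  (exists p, Q p) -> exists p q, is_diam x y Q p q /\ 0 <= y p - y q.
Proof.
  intros dec Hn [p0 Hp0].
  set (l := filter (fun p => if dec p then true else false) (seq 0 n)).
  assert (Hl : forall p, In p l <-> Q p).
  { intros p; unfold l; rewrite filter_In, in_seq.
    destruct (dec p); split; intros H; try tauto; try (destruct H; discriminate).
    split; auto. specialize (Hn p H); lia. }
  destruct (exists_argmax (fun pq => dist2 x y (fst pq) (snd pq)) (list_prod l l))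
    as ([p q] & Hpq & Hm).
  { intros E. assert (In (p0, p0) (list_prod l l)) by (apply in_prod; now apply Hl).
    rewrite E in H; destruct H. }
  apply in_prod_iff in Hpq; rewrite !Hl in Hpq; destruct Hpq as [Hp Hq].
  assert (Hd : forall p' q', Q p' -> Q q' -> dist2 x y p' q' <= dist2 x y p q).
  { intros p' q' H1 H2. apply (Hm (p', q')). apply in_prod; now apply Hl. }
  destruct (Rle_lt_dec (y q) (y p)).
  - exists p, q; repeat split; auto; lra.
  - exists q, p; repeat split; auto; [|lra]. intros; rewrite (dist2_sym x y q p); auto.
Qed.

(** * Tournament sorting *)

(* Natural and real arrays are numbered independently; a scalar variable is entry 0 of
   its array. *)
Notation vn := 0%nat (only parsing).
Notation vk := 1%nat (only parsing).
Notation half := 2%nat (only parsing).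
Notation xs := 3%nat (only parsing).
Notation ws := 4%nat (only parsing).
Notation tree := 5%nat (only parsing).
Notation vo := 6%nat (only parsing).
Notation vv := 7%nat (only parsing).

Notation V x := (IA x (IN 0)) (only parsing).
Notation W x := (RA x (IN 0)) (only parsing).
Notation "x ::= e" := (SetI x (IN 0) e) (at level 60, only parsing).
Notation "x :::= e" := (SetR x (IN 0) e) (at level 60, only parsing).
Notation "c1 ;; c2" := (Seq c1 c2) (at level 65, right associativity, only parsing).

Ltac hcbn := cbn [wp btrue bfalse evi evr csize hi hr seti setr upd2 Nat.eqb Z.of_nat
  Pos.of_succ_nat Pos.succ]; rewrite ?upd_eq.
Ltac hcbn_in H := cbn [wp btrue bfalse evi evr csize hi hr seti setr upd2 Nat.eqb Z.of_nat
  Pos.of_succ_nat Pos.succ] in H; rewrite ?upd_eq in H.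
(* [n] marks an empty slot of the tournament. *)
Definition winner (key : nat -> R) (n a b : nat) : nat :=
  if Nat.leb n a then b else if Nat.leb n b then a
  else if Rlt_dec (key b) (key a) then b else a.

(** A preorder in which an empty slot acts as a key of plus infinity. *)
Definition beats (key : nat -> R) (n a b : nat) : Prop :=
  (n <= b)%nat \/ ((a < n)%nat /\ key a <= key b).

Definition match_ok (key : nat -> R) (n : nat) (t : nat -> nat) (v : nat) : Prop :=
  t v = winner key n (t (v + v)%nat) (t (v + v + 1)%nat).

Definition update (key : nat) : cmd :=
  let l := IA tree (IPl (V vv) (V vv)) in
  let r := IA tree (IPl (IPl (V vv) (V vv)) (IN 1)) in
  If (BLe (V vn) l) (SetI tree (V vv) r)
    (If (BLe (V vn) r) (SetI tree (V vv) l)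
       (If (BLt (RA key r) (RA key l)) (SetI tree (V vv) r) (SetI tree (V vv) l))).

Definition replay (key : nat) : cmd :=
  While (BLe (IN 2) (V vv)) (vv ::= IA half (V vv) ;; update key).

(** Heap-shaped tree for arbitrary [n]: matches at nodes 1 to [n - 1], leaves at [n] to [2 n - 1];
    for [n = 1] the root is the leaf. Each round emits the champion, empties its leaf and replays
    the path to the root. *)
Definition sort (key : nat) : cmd :=
  vv ::= IN 0 ;;
  While (BLe (IPl (V vv) (IN 1)) (V vn))
    (SetI tree (IPl (V vn) (V vv)) (V vv) ;; vv ::= IPl (V vv) (IN 1)) ;;
  vv ::= V vn ;;
  While (BLe (IN 2) (V vv)) (vv ::= IMi (V vv) (IN 1) ;; update key) ;;
  vo ::= IN 0 ;;
  While (BLe (IPl (V vo) (IN 1)) (V vn))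
    (SetI ws (V vo) (IA tree (IN 1)) ;;
     vv ::= IPl (V vn) (IA tree (IN 1)) ;;
     SetI tree (V vv) (V vn) ;;
     replay key ;;
     vo ::= IPl (V vo) (IN 1)).

Definition is_sort (key : nat -> R) (n : nat) (out : nat -> nat) : Prop :=
  (forall o, (o < n)%nat -> (out o < n)%nat) /\
  (forall o o', (o < n)%nat -> (o' < n)%nat -> out o = out o' -> o = o') /\
  (forall o o', (o <= o')%nat -> (o' < n)%nat -> key (out o) <= key (out o')).

Lemma beats_trans key n a b c : beats key n a b -> beats key n b c -> beats key n a c.
Proof. unfold beats; intros [H1|[H1 H1']] [H2|[H2 H2']]; auto; try lia. right; split; auto; lra. Qed.

Lemma winner_beats key n a b :
  beats key n (winner key n a b) a /\ beats key n (winner key n a b) b.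
Proof.
  unfold winner, beats. destruct (Nat.leb_spec n a), (Nat.leb_spec n b);
    try destruct Rlt_dec; split; auto; right; split; auto; lra.
Qed.

Lemma winner_cases key n a b : winner key n a b = a \/ winner key n a b = b.
Proof.
  unfold winner. destruct (Nat.leb n a); auto. destruct (Nat.leb n b); auto.
  destruct Rlt_dec; auto.
Qed.

Lemma root_beats key n t v :
  (forall v, (1 <= v < n)%nat -> match_ok key n t v) ->
  (1 <= v < 2 * n)%nat -> beats key n (t 1%nat) (t v).
Proof.
  intros Hok. induction v as [v IH] using (well_founded_induction lt_wf). intros Hv.
  destruct (Nat.eq_dec v 1) as [->|].
  - unfold beats. destruct (Nat.le_gt_cases n (t 1%nat)); auto. right; split; auto; lra.
  - assert (Hlt : (1 <= v / 2 < n)%nat).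
    { split; [apply Nat.div_le_lower_bound; lia|apply Nat.Div0.div_lt_upper_bound; lia]. }
    pose proof (Nat.div_mod_eq v 2). pose proof (Nat.mod_upper_bound v 2 ltac:(lia)).
    apply (beats_trans _ _ _ (t (v / 2)%nat)); [apply IH; lia|].
    rewrite (Hok _ Hlt).
    destruct (winner_beats key n (t (v / 2 + v / 2)%nat) (t (v / 2 + v / 2 + 1)%nat)) as [B1 B2].
    destruct (Nat.eq_dec (v mod 2) 0).
    + replace v with (v / 2 + v / 2)%nat at 5 by lia. exact B1.
    + replace v with (v / 2 + v / 2 + 1)%nat at 5 by lia. exact B2.
Qed.

(** Matches only copy entries upwards, so a point shown anywhere still occupies its own leaf.
    Applied to the root, this shows that the champion has not been emitted before. The induction
    goes towards the leaves, whose numbers are larger. *)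
Lemma node_from_leaf key n t v :
  (forall v, (1 <= v < n)%nat -> match_ok key n t v) ->
  (forall p, (p < n)%nat -> t (n + p)%nat = p \/ t (n + p)%nat = n) ->
  (1 <= v < 2 * n)%nat -> (t v < n)%nat -> t (n + t v)%nat = t v.
Proof.
  intros Hok Hleaf.
  remember (2 * n - v)%nat as d eqn:Hd; revert v Hd.
  induction d as [d IH] using (well_founded_induction lt_wf); intros v Hd Hv Ht.
  destruct (Nat.lt_ge_cases v n) as [Hl|Hg].
  - pose proof (Hok v ltac:(lia)) as E; unfold match_ok in E.
    destruct (winner_cases key n (t (v + v)%nat) (t (v + v + 1)%nat)) as [Ew|Ew];
      rewrite Ew in E; rewrite E in *.
    + apply (IH (2 * n - (v + v))%nat); auto; lia.
    + apply (IH (2 * n - (v + v + 1))%nat); auto; lia.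
  - destruct (Hleaf (v - n)%nat ltac:(lia)) as [E|E];
      replace (n + (v - n))%nat with v in E by lia; [|lia].
    rewrite E. replace (n + (v - n))%nat with v by lia. exact E.
Qed.

Lemma pigeonhole l n : (length l < n)%nat -> exists p, (p < n)%nat /\ ~ In p l.
Proof.
  intros Hl.
  destruct (Exists_dec (fun p => ~ In p l) (seq 0 n)) as [E|E].
  - intros p; destruct (in_dec Nat.eq_dec p l); [now right|now left].
  - apply Exists_exists in E; destruct E as (p & Hp & E).
    apply in_seq in Hp. exists p; split; [lia|exact E].
  - exfalso. assert (Hi : incl (seq 0 n) l).
    { intros p Hp. destruct (in_dec Nat.eq_dec p l); auto.
      exfalso; apply E, Exists_exists; eauto. }
    apply NoDup_incl_length in Hi; [rewrite length_seq in Hi; lia|apply seq_NoDup].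
Qed.

Lemma is_sort_surj key n out p :
  is_sort key n out -> (p < n)%nat -> exists o, (o < n)%nat /\ out o = p.
Proof.
  intros (H1 & H2 & _) Hp.
  assert (Hi : incl (seq 0 n) (map out (seq 0 n))).
  { apply NoDup_length_incl.
    - apply NoDup_map_NoDup_ForallPairs; [|apply seq_NoDup].
      intros a b Ha Hb; apply in_seq in Ha, Hb; apply H2; lia.
    - now rewrite length_map.
    - intros q Hq; apply in_map_iff in Hq; destruct Hq as (o & <- & Ho).
      apply in_seq in Ho. specialize (H1 o ltac:(lia)). apply in_seq; lia. }
  specialize (Hi p ltac:(apply in_seq; lia)). apply in_map_iff in Hi.
  destruct Hi as (o & E & Ho). apply in_seq in Ho. exists o; split; [lia|exact E].
Qed.

Lemma update_wp key n s (Q : hstate -> Prop) :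
  hi s vn 0%nat = n ->
  Q (seti s tree (hi s vv 0%nat) (winner (hr s key) n (hi s tree (hi s vv 0%nat + hi s vv 0%nat)%nat)
      (hi s tree (hi s vv 0%nat + hi s vv 0%nat + 1)%nat))) ->
  wp (update key) Q s.
Proof.
  intros Hn; unfold update, winner; hcbn. rewrite Hn.
  destruct (Nat.leb_spec n (hi s 5 (hi s 7 0 + hi s 7 0))%nat); [split; intros; [assumption|lia]|].
  intros H1. split; [lia|intros _].
  destruct (Nat.leb_spec n (hi s 5 (hi s 7 0 + hi s 7 0 + 1))%nat); [split; intros; [assumption|lia]|].
  split; [lia|intros _].
  destruct Rlt_dec; split; intros; auto; lra.
Qed.

(** Node [v] is read by its own match and by that of its parent [v / 2], so repairing [v] can spoil
    only the parent. *)
Lemma match_ok_update key n t v :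
  (1 <= v < n)%nat ->
  (forall u, (1 <= u < n)%nat -> u <> v -> match_ok key n t u) ->
  forall u, (1 <= u < n)%nat -> u <> (v / 2)%nat ->
  match_ok key n (upd t v (winner key n (t (v + v)%nat) (t (v + v + 1)%nat))) u.
Proof.
  intros Hv Hok u Hu Hne; unfold match_ok.
  pose proof (Nat.div_mod_eq v 2). pose proof (Nat.mod_upper_bound v 2 ltac:(lia)).
  rewrite (upd_neq _ v (u + u)), (upd_neq _ v (u + u + 1)).
  - destruct (Nat.eq_dec u v) as [->|]; [now rewrite upd_eq|].
    rewrite upd_neq by auto. now apply Hok.
  - intros E; apply Hne. apply (Nat.div_unique v 2 u 1); lia.
  - intros E; apply Hne. apply (Nat.div_unique v 2 u 0); lia.
Qed.

Definition has_half (s : hstate) (n : nat) : Prop :=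
  forall v, (v < 2 * n)%nat -> hi s half v = (v / 2)%nat.

Lemma replay_correct key n m s :
  hi s vn 0%nat = n -> has_half s n ->
  (1 <= hi s vv 0%nat < 2 * n)%nat -> (hi s vv 0%nat < 2 ^ m)%nat ->
  (forall u, (1 <= u < n)%nat -> u <> (hi s vv 0%nat / 2)%nat ->
     match_ok (hr s key) n (hi s tree) u) ->
  tc (replay key) s (m * 9 + 1) (fun s' =>
    (forall u, (1 <= u < n)%nat -> match_ok (hr s' key) n (hi s' tree) u) /\
    (forall p, hi s' tree (n + p)%nat = hi s tree (n + p)%nat)).
Proof.
  intros Hn Hh Hv Hm Hok.
  (* Only the match at the parent of the current node may be wrong; since [2 ^ m] exceeds the node
     number, [m] bounds the levels that remain. *)
  apply (tc_while _ _ s (fun m s' =>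
    (1 <= hi s' vv 0%nat < 2 * n)%nat /\ (hi s' vv 0%nat < 2 ^ m)%nat /\
    (forall u, (1 <= u < n)%nat -> u <> (hi s' vv 0%nat / 2)%nat ->
       match_ok (hr s' key) n (hi s' tree) u) /\
    (forall p, hi s' tree (n + p)%nat = hi s tree (n + p)%nat)) 8).
  - auto.
  - clear m Hm. intros m s1 F (Hv1 & Hm & Hok1 & Hl) Hb.
    hcbn_in Hb.
    assert (Hn1 : hi s1 vn 0%nat = n) by (rewrite (frame_hi _ _ _ _ F); auto).
    assert (Hh1 : has_half s1 n) by (unfold has_half; rewrite (frame_hi half _ _ _ F); auto).
    eapply tc_weaken; [apply tc_wp|simpl; lia|].
    2: { intros s' _ H; exact H. }
    cbn [wp]. apply (update_wp key n); [exact Hn1|].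
    hcbn. intros _.
    assert (Ev := Hh1 _ (proj2 Hv1)). rewrite Ev.
    pose proof (Nat.div_mod_eq (hi s1 vv 0%nat) 2).
    pose proof (Nat.mod_upper_bound (hi s1 vv 0%nat) 2 ltac:(lia)).
    set (v := (hi s1 vv 0 / 2)%nat) in *.
    destruct m as [|m]; [simpl in Hm; lia|].
    exists m. split; [lia|].
    split; [lia|split; [simpl in Hm; lia|split]].
    + apply match_ok_update; [lia|]. intros u Hu Hne. now apply Hok1.
    + intros p. rewrite upd_neq by lia. apply Hl.
  - intros m' s1 F (Hv1 & Hm' & Hok1 & Hl) Hb. hcbn_in Hb.
    (* At the root the exceptional match would have number 0, which is no match. *)
    split; [|exact Hl]. intros u Hu. apply Hok1; [exact Hu|].
    replace (hi s1 vv 0)%nat with 1%nat by lia. simpl; lia.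
Qed.

Definition alive (n o : nat) (t out : nat -> nat) (p : nat) : Prop :=
  t (n + p)%nat = p /\ forall o', (o' < o)%nat -> out o' <> p.

(** Emitted keys are bounded by all living ones; since the champion is a living point, appending it
    keeps the output sorted. *)
Definition selection_inv (key : nat -> R) (n o : nat) (t out : nat -> nat) : Prop :=
  (forall u, (1 <= u < n)%nat -> match_ok key n t u) /\
  (forall p, (p < n)%nat -> alive n o t out p \/
     (t (n + p)%nat = n /\ exists o', (o' < o)%nat /\ out o' = p)) /\
  (forall o', (o' < o)%nat -> (out o' < n)%nat /\
     forall p, (p < n)%nat -> alive n o t out p -> key (out o') <= key p) /\
  (forall o1 o2, (o1 < o)%nat -> (o2 < o)%nat -> out o1 = out o2 -> o1 = o2) /\
  (forall o1 o2, (o1 <= o2)%nat -> (o2 < o)%nat -> key (out o1) <= key (out o2)).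

Lemma root_alive key n o t out :
  selection_inv key n o t out -> (o < n)%nat ->
  (t 1%nat < n)%nat /\ alive n o t out (t 1%nat) /\
  forall p, (p < n)%nat -> alive n o t out p -> key (t 1%nat) <= key p.
Proof.
  intros (Hok & Hleaf & Hout & _ & _) Ho.
  assert (Hb : forall p, (p < n)%nat -> alive n o t out p ->
    (t 1%nat < n)%nat /\ key (t 1%nat) <= key p).
  { intros p Hp [Ha _].
    destruct (root_beats key n t (n + p) Hok ltac:(lia)) as [H|H]; rewrite Ha in H; auto; lia. }
  assert (Hex : exists p, (p < n)%nat /\ alive n o t out p).
  (* Fewer than [n] points have been emitted, so some leaf is still occupied. *)
  { destruct (pigeonhole (map out (seq 0 o)) n) as (p & Hp & Hin).
    - rewrite length_map, length_seq; exact Ho.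
    - exists p; split; [exact Hp|]. destruct (Hleaf p Hp) as [Ha|(_ & o' & Ho' & E)]; [exact Ha|].
      exfalso; apply Hin, in_map_iff; exists o'; split; [exact E|apply in_seq; lia]. }
  destruct Hex as (p & Hp & Ha). destruct (Hb p Hp Ha) as [Hr _].
  split; [exact Hr|split; [|intros; now apply Hb]].
  assert (Hroot : t (n + t 1%nat)%nat = t 1%nat).
  { apply (node_from_leaf key n t 1); auto; [|lia].
    intros q Hq; destruct (Hleaf q Hq) as [[E _]|[E _]]; auto. }
  destruct (Hleaf _ Hr) as [H|[E _]]; [exact H|lia].
Qed.

Lemma selection_step key n o t t' out :
  selection_inv key n o t out -> (o < n)%nat ->
  (forall u, (1 <= u < n)%nat -> match_ok key n t' u) ->
  (forall p, t' (n + p)%nat = upd t (n + t 1%nat) n (n + p)%nat) ->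
  selection_inv key n (S o) t' (upd out o (t 1%nat)).
Proof.
  intros Hinv Ho Hok' Ht'.
  destruct (root_alive _ _ _ _ _ Hinv Ho) as (Hr & [Ha Ha'] & Hmin).
  destruct Hinv as (Hok & Hleaf & Hout & Hinj & Hsort).
  set (r := t 1%nat) in *.
  assert (Halive : forall p, alive n (S o) t' (upd out o r) p -> p <> r /\ alive n o t out p).
  { intros p [E Hp].
    assert (Hne : p <> r) by (intros ->; apply (Hp o); [lia|apply upd_eq]).
    split; [exact Hne|split].
    - rewrite Ht', upd_neq in E by lia. exact E.
    - intros o' Ho'. rewrite <- (upd_neq out o o' r) by lia. apply Hp; lia. }
  split; [exact Hok'|split; [|split; [|split]]].
  - intros p Hp. destruct (Nat.eq_dec p r) as [->|Hne].
    + right. rewrite Ht', upd_eq. split; [reflexivity|].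
      exists o; split; [lia|apply upd_eq].
    + unfold alive; rewrite Ht', upd_neq by lia.
      destruct (Hleaf p Hp) as [[E Hp']|(E & o' & Ho' & E')]; [left|right].
      * split; [exact E|]. intros o' Ho'.
        destruct (Nat.eq_dec o' o) as [->|]; [rewrite upd_eq; auto|].
        rewrite upd_neq by auto. apply Hp'; lia.
      * split; [exact E|]. exists o'; split; [lia|]. rewrite upd_neq by lia; exact E'.
  - intros o' Ho'. destruct (Nat.eq_dec o' o) as [->|].
    + rewrite upd_eq. split; [exact Hr|]. intros p Hp Hal.
      apply Hmin; [exact Hp|]. now apply Halive.
    + rewrite upd_neq by auto. destruct (Hout o' ltac:(lia)) as [H1 H2].
      split; [exact H1|]. intros p Hp Hal. apply H2; [exact Hp|]. now apply Halive.
  - intros o1 o2 H1 H2.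
    destruct (Nat.eq_dec o1 o) as [->|N1], (Nat.eq_dec o2 o) as [->|N2];
      rewrite ?upd_eq, ?(upd_neq _ _ _ _ N1), ?(upd_neq _ _ _ _ N2); auto; intros E.
    + exfalso; apply (Ha' o2); [lia|now symmetry].
    + exfalso; apply (Ha' o1); [lia|exact E].
    + apply Hinj; auto; lia.
  - intros o1 o2 H1 H2.
    destruct (Nat.eq_dec o2 o) as [->|N2].
    + rewrite upd_eq. destruct (Nat.eq_dec o1 o) as [->|N1]; [rewrite upd_eq; lra|].
      rewrite upd_neq by auto. apply (Hout o1); [lia|exact Hr|split; auto].
    + rewrite !upd_neq by lia. apply Hsort; lia.
Qed.

Ltac block := eapply tc_weaken; [apply tc_wp| |intros ? ? HQ; exact HQ].

(** The 2 makes room for [2 * n < 2 ^ lg n], which bounds both the depth of the tournament and the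
    number of halvings in the search. *)
Definition lg (n : nat) : nat := (Nat.log2 n + 2)%nat.

Lemma lg_spec n : (1 <= n)%nat -> (2 * n < 2 ^ lg n)%nat.
Proof.
  intros Hn. unfold lg. replace (Nat.log2 n + 2)%nat with (S (S (Nat.log2 n))) by lia.
  pose proof (Nat.log2_spec n ltac:(lia)). rewrite Nat.pow_succ_r'. lia.
Qed.

Definition env (n : nat) (s : hstate) : Prop := hi s vn 0%nat = n /\ has_half s n.

Lemma env_frame n c s s' :
  env n s -> frame c s s' -> existsb (Nat.eqb vn) (modi c) = false ->
  existsb (Nat.eqb half) (modi c) = false -> env n s'.
Proof.
  unfold env, has_half. intros [H1 H2] F E1 E2.
  now rewrite (frame_hi _ _ _ _ F E1), (frame_hi _ _ _ _ F E2).
Qed.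

Lemma sort_correct key n s :
  (1 <= n)%nat -> env n s ->
  tc (sort key) s (50 * (n * lg n)) (fun s' => is_sort (hr s key) n (hi s' ws)).
Proof.
  intros Hn Henv.
  (* The bound follows the program text, each loop contributing iterations times (body + 1) plus 1.
     The generous 50 absorbs it because [lg n >= 2]. *)
  apply (tc_weaken _ _ (1 + ((n * (2 + 1) + 1) + (1 + ((n * (8 + 1) + 1) + (1 +
    (n * ((3 + ((lg n * 9 + 1) + 1)) + 1) + 1)))))) _ (fun s' => is_sort (hr s key) n (hi s' ws)));
    [|assert (2 <= lg n)%nat by (unfold lg; lia); nia|auto].
  apply tc_seti_seq; intros s1 F1 E1. hcbn_in E1.
  pose proof (env_frame _ _ _ _ Henv F1 eq_refl eq_refl) as Henv1.
  eapply tc_seq.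
  { apply (tc_while _ _ s1 (fun m s' =>
      (hi s' vv 0 + m = n)%nat /\
      forall p, (p < hi s' vv 0)%nat -> hi s' tree (n + p)%nat = p)).
    - rewrite E1, upd_eq. split; [reflexivity|lia].
    - intros m s2 F (Hm & Hl) Hb. hcbn_in Hb.
      destruct (env_frame _ _ _ _ Henv1 F eq_refl eq_refl) as [Hn2 _].
      block; [|apply Nat.le_refl]. hcbn. intros _. rewrite Hn2 in *.
      exists (m - 1)%nat. split; [lia|split; [lia|]].
      intros p Hp. destruct (Nat.eq_dec p (hi s2 vv 0)) as [->|]; [apply upd_eq|].
      rewrite upd_neq by lia. apply Hl; lia.
    - intros m s2 F H Hb. exact (conj Hb (ex_intro _ m H)). }
  intros s2 F2 (Hb & m & Hm & Hl). hcbn_in Hb.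
  pose proof (env_frame _ _ _ _ Henv1 F2 eq_refl eq_refl) as Henv2.
  rewrite (proj1 Henv2) in Hb. replace (hi s2 vv 0)%nat with n in Hl by lia. clear Hb m Hm.
  apply tc_seti_seq; intros s3 F3 E3. hcbn_in E3.
  pose proof (env_frame _ _ _ _ Henv2 F3 eq_refl eq_refl) as Henv3.
  rewrite <- (frame_hi tree _ _ _ F3 eq_refl) in Hl.
  eapply tc_seq.
  { apply (tc_while _ _ s3 (fun m s' =>
      hi s' vv 0%nat = m /\ (1 <= m <= n)%nat /\
      (forall u, (m <= u < n)%nat -> match_ok (hr s key) n (hi s' tree) u) /\
      (forall p, (p < n)%nat -> hi s' tree (n + p)%nat = p))).
    - rewrite E3, upd_eq, (proj1 Henv2). repeat split; auto; lia.
    - intros m s4 F (Hv & Hm & Hok & Hl') Hb. hcbn_in Hb.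
      pose proof (env_frame _ _ _ _ Henv3 F eq_refl eq_refl) as Henv4.
      block; [|apply Nat.le_refl]. cbn [wp]. apply (update_wp key n); [exact (proj1 Henv4)|].
      hcbn. intros _. rewrite Hv in *.
      assert (Ek : hr s4 key = hr s key).
      { rewrite (frame_hr _ _ _ _ F eq_refl), (frame_hr _ _ _ _ F3 eq_refl),
          (frame_hr _ _ _ _ F2 eq_refl). exact (frame_hr _ _ _ _ F1 eq_refl). }
      rewrite Ek. exists (m - 1)%nat. repeat split; try lia.
      + intros u Hu. unfold match_ok.
        rewrite (upd_neq _ _ (u + u)), (upd_neq _ _ (u + u + 1)) by lia.
        destruct (Nat.eq_dec u (m - 1)) as [->|]; [apply upd_eq|].
        rewrite upd_neq by auto. apply Hok; lia.
      + intros p Hp. rewrite upd_neq by lia. now apply Hl'.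
    - intros m s4 F H Hb. exact (conj Hb (ex_intro _ m H)). }
  intros s4 F4 (Hb & m & Hm & Hm' & Hok & Hl4). hcbn_in Hb.
  replace m with 1%nat in Hok by lia. clear Hb m Hm Hm'.
  pose proof (env_frame _ _ _ _ Henv3 F4 eq_refl eq_refl) as Henv4.
  apply tc_seti_seq; intros s5 F5 E5. hcbn_in E5.
  pose proof (env_frame _ _ _ _ Henv4 F5 eq_refl eq_refl) as Henv5.
  assert (Ek : forall c s', frame c s5 s' -> modr c = [] -> hr s' key = hr s key).
  { intros c s' F Hc. rewrite (frame_hr key _ _ _ F) by now rewrite Hc.
    rewrite (frame_hr _ _ _ _ F5 eq_refl), (frame_hr _ _ _ _ F4 eq_refl),
      (frame_hr _ _ _ _ F3 eq_refl), (frame_hr _ _ _ _ F2 eq_refl).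
    exact (frame_hr _ _ _ _ F1 eq_refl). }
  apply (tc_while _ _ s5 (fun m s' =>
      (hi s' vo 0 + m = n)%nat /\
      selection_inv (hr s key) n (hi s' vo 0%nat) (hi s' tree) (hi s' ws))).
  - rewrite E5, upd_eq. split; [reflexivity|].
    rewrite (frame_hi tree _ _ _ F5 eq_refl).
    split; [intros u Hu; apply Hok; lia|split; [|repeat split; intros; lia]].
    intros p Hp. left. split; [now apply Hl4|lia].
  - intros m s6 F (Hm & Hinv) Hb. hcbn_in Hb.
    pose proof (env_frame _ _ _ _ Henv5 F eq_refl eq_refl) as Henv6.
    rewrite (proj1 Henv6) in Hb.
    destruct (root_alive _ _ _ _ _ Hinv ltac:(lia)) as (Hr & _).
    change (3 + (lg n * 9 + 1 + 1))%nat with (1 + (1 + (1 + (lg n * 9 + 1 + 1))))%nat.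
    apply tc_seti_seq; intros s7 F7 E7. hcbn_in E7.
    apply tc_seti_seq; intros s8 F8 E8. hcbn_in E8.
    apply tc_seti_seq; intros s9 F9 E9. hcbn_in E9.
    pose proof (env_frame _ _ _ _ Henv6 F7 eq_refl eq_refl) as Henv7.
    pose proof (env_frame _ _ _ _ Henv7 F8 eq_refl eq_refl) as Henv8.
    pose proof (env_frame _ _ _ _ Henv8 F9 eq_refl eq_refl) as Henv9.
    rewrite (frame_hi tree _ _ _ F8 eq_refl), (frame_hi tree _ _ _ F7 eq_refl) in E9.
    rewrite (frame_hi tree _ _ _ F7 eq_refl), (proj1 Henv7) in E8.
    rewrite (proj1 Henv8), E8, upd_eq in E9.
    assert (Ev : hi s9 vv 0%nat = (n + hi s6 tree 1)%nat)
      by (rewrite (frame_hi vv _ _ _ F9 eq_refl), E8, upd_eq; reflexivity).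
    assert (Ek9 : hr s9 key = hr s key).
    { rewrite (frame_hr _ _ _ _ F9 eq_refl), (frame_hr _ _ _ _ F8 eq_refl),
        (frame_hr _ _ _ _ F7 eq_refl). now apply (Ek _ _ F). }
    eapply tc_seq.
    { apply (replay_correct key n (lg n) s9); try apply Henv9; rewrite Ev.
      - lia.
      - pose proof (lg_spec n Hn). lia.
      (* Emptying the champion's leaf affects only the match at the parent of that leaf. *)
      - intros u Hu Hne. rewrite Ek9, E9. unfold match_ok.
        pose proof (Nat.div_mod_eq (n + hi s6 tree 1) 2).
        pose proof (Nat.mod_upper_bound (n + hi s6 tree 1) 2 ltac:(lia)).
        rewrite !upd_neq; [apply (proj1 Hinv); lia| | |lia];
          intros E; apply Hne.
        + apply (Nat.div_unique _ 2 u 1); lia.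
        + apply (Nat.div_unique _ 2 u 0); lia. }
    intros s10 F10 (Hok10 & Hl10).
    block; [|apply Nat.le_refl]. hcbn. intros _.
    assert (Eo : hi s10 vo 0%nat = hi s6 vo 0%nat).
    { rewrite (frame_hi vo _ _ _ F10 eq_refl), (frame_hi vo _ _ _ F9 eq_refl),
        (frame_hi vo _ _ _ F8 eq_refl), (frame_hi vo _ _ _ F7 eq_refl); reflexivity. }
    assert (Ews : hi s10 ws = upd (hi s6 ws) (hi s6 vo 0%nat) (hi s6 tree 1%nat)).
    { rewrite (frame_hi ws _ _ _ F10 eq_refl), (frame_hi ws _ _ _ F9 eq_refl),
        (frame_hi ws _ _ _ F8 eq_refl). exact E7. }
    exists (m - 1)%nat. rewrite Eo, Ews. split; [lia|split; [lia|]].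
    rewrite Nat.add_1_r. apply (selection_step _ _ _ (hi s6 tree)); auto; [lia| |].
    + intros u Hu. rewrite <- Ek9, <- (frame_hr key _ _ _ F10 eq_refl). now apply Hok10.
    + intros p. rewrite Hl10, E9. reflexivity.
  - intros m s6 F (Hm & Hinv) Hb. hcbn_in Hb.
    pose proof (env_frame _ _ _ _ Henv5 F eq_refl eq_refl) as Henv6.
    rewrite (proj1 Henv6) in Hb.
    destruct Hinv as (_ & _ & Hout & Hinj & Hs).
    replace (hi s6 vo 0)%nat with n in * by lia.
    split; [intros o Ho; now apply Hout|split; [exact Hinj|exact Hs]].
Qed.

(** * The hull of the heavy points *)

Notation vp := 11%nat (only parsing).
Notation uh := 12%nat (only parsing).
Notation us := 13%nat (only parsing).
Notation lh := 14%nat (only parsing).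
Notation ls := 15%nat (only parsing).
Notation vi := 16%nat (only parsing).
Notation vj := 17%nat (only parsing).
Notation px := 2%nat (only parsing).
Notation py := 3%nat (only parsing).
Notation wt := 4%nat (only parsing).
Notation best := 5%nat (only parsing).
Notation tau := 6%nat (only parsing).

Definition seen (i : nat) (out : nat -> nat) (p : nat) : Prop :=
  exists o, (o < i)%nat /\ out o = p.

(** Maximality refers to all of [Q], not to the scanned prefix: such points are never popped, so the
    hull of a prefix need not be described. *)
Definition hull_inv (x y : nat -> R) (Q : nat -> Prop) (out : nat -> nat)
    (i : nat) (c : nat -> nat) (m : nat) : Prop :=
  chain x y c m /\ (forall t, (t < m)%nat -> Q (c t) /\ seen i out (c t)) /\
  (forall a b p, 0 <= b -> strict_max x y a b Q p -> seen i out p ->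
     exists t, (t < m)%nat /\ c t = p).

Lemma seen_S i out p : seen (S i) out p <-> seen i out p \/ out i = p.
Proof.
  split.
  - intros (o & Ho & E). destruct (Nat.eq_dec o i) as [->|]; [now right|].
    left; exists o; split; [lia|exact E].
  - intros [(o & Ho & E)|E]; [exists o|exists i]; split; auto; lia.
Qed.

Lemma hull_inv_skip x y Q out i c m :
  hull_inv x y Q out i c m ->
  (forall a b, 0 <= b -> ~ strict_max x y a b Q (out i)) ->
  hull_inv x y Q out (S i) c m.
Proof.
  intros (Hc & HQ & Hm) Hn; split; [exact Hc|split].
  - intros t Ht; destruct (HQ t Ht); split; auto. apply seen_S; now left.
  - intros a b p Hb Hp Hs; apply seen_S in Hs; destruct Hs as [Hs|<-]; [eauto|].
    now elim (Hn a b).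
Qed.

Lemma hull_inv_push x y Q out i c m :
  hull_inv x y Q out i c m -> Q (out i) ->
  ((1 <= m)%nat -> x (c (m - 1)%nat) < x (out i)) ->
  ((2 <= m)%nat -> cross x y (c (m - 2)%nat) (c (m - 1)%nat) (out i) < 0) ->
  hull_inv x y Q out (S i) (upd c m (out i)) (S m).
Proof.
  intros ([Hx Hc] & HQ & Hm) Hi H1 H2; split; [split|split].
  - intros t Ht. rewrite (upd_neq _ _ t) by lia.
    destruct (Nat.eq_dec (t + 1) m) as [E|].
    + rewrite E, upd_eq. replace t with (m - 1)%nat by lia. apply H1; lia.
    + rewrite upd_neq by lia. apply Hx; lia.
  - intros t Ht. rewrite (upd_neq _ _ t), (upd_neq _ _ (t + 1)%nat) by lia.
    destruct (Nat.eq_dec (t + 2) m) as [E|].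
    + rewrite E, upd_eq. replace t with (m - 2)%nat by lia.
      replace (m - 2 + 1)%nat with (m - 1)%nat by lia. apply H2; lia.
    + rewrite upd_neq by lia. apply Hc; lia.
  - intros t Ht. destruct (Nat.eq_dec t m) as [->|].
    + rewrite upd_eq. split; [exact Hi|]. apply seen_S; now right.
    + rewrite upd_neq by auto. destruct (HQ t ltac:(lia)); split; auto. apply seen_S; now left.
  - intros a b p Hb Hp Hs; apply seen_S in Hs; destruct Hs as [Hs|<-].
    + destruct (Hm a b p Hb Hp Hs) as (t & Ht & E). exists t; split; [lia|].
      rewrite upd_neq by lia; exact E.
    + exists m; split; [lia|apply upd_eq].
Qed.

Lemma hull_inv_pop x y Q out i c m :
  hull_inv x y Q out i c m ->
  (forall a b, 0 <= b -> ~ strict_max x y a b Q (c (m - 1)%nat)) ->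
  hull_inv x y Q out i c (m - 1).
Proof.
  intros ([Hx Hc] & HQ & Hm) Hn; split; [split|split].
  - intros t Ht; apply Hx; lia.
  - intros t Ht; apply Hc; lia.
  - intros t Ht; apply HQ; lia.
  - intros a b p Hb Hp Hs. destruct (Hm a b p Hb Hp Hs) as (t & Ht & E).
    destruct (Nat.eq_dec t (m - 1)) as [->|]; [rewrite <- E in Hp; now elim (Hn a b)|].
    exists t; split; [lia|exact E].
Qed.

Lemma hull_inv_final x y n Q out c m :
  hull_inv x y Q out n c m -> is_sort x n out -> (forall p, Q p -> (p < n)%nat) ->
  upper_hull x y Q c m.
Proof.
  intros (Hc & HQ & Hm) Hs Hn; split; [exact Hc|split].
  - intros t Ht; now apply HQ.
  - intros a b p Hb Hp. apply (Hm a b); auto.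
    apply (is_sort_surj x n); auto. apply Hn, Hp.
Qed.

(* The lower hull is the upper hull of the points with negated ordinates. *)
Definition yexp (low : bool) (e : iexp) : rexp :=
  if low then RMi (RN 0) (RA py e) else RA py e.

Definition yval (low : bool) (y : nat -> R) : nat -> R := if low then mirror y else y.

Lemma evr_yexp low e s : evr (yexp low e) s = yval low (hr s py) (evi e s).
Proof. now destruct low. Qed.

Definition cross_exp (ye : iexp -> rexp) (p q r : iexp) : rexp :=
  RMi (RMu (RMi (RA px q) (RA px p)) (RMi (ye r) (ye q)))
      (RMu (RMi (ye q) (ye p)) (RMi (RA px r) (RA px q))).

(** A pass either consumes the current point or pops and examines it again, which avoids a nested
    loop. Of several heavy points with one abscissa only a highest may stay on the chain. *)
Definition hull_step (low : bool) : cmd :=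
  let top := IA uh (IMi (V us) (IN 1)) in
  let top' := IA uh (IMi (V us) (IN 2)) in
  let next := vi ::= IPl (V vi) (IN 1) in
  let push := SetI uh (V us) (V vp) ;; us ::= IPl (V us) (IN 1) ;; next in
  let pop := us ::= IMi (V us) (IN 1) in
  vp ::= IA xs (V vi) ;;
  If (BLt (RA wt (V vp)) (W tau)) next
    (If (BLe (V us) (IN 0)) push
      (If (BLt (RA px top) (RA px (V vp)))
        (If (BLe (IN 2) (V us))
          (If (BLt (cross_exp (yexp low) top' top (V vp)) (RN 0)) push pop) push)
        (If (BLt (yexp low top) (yexp low (V vp))) pop next))).

Definition hull (low : bool) : cmd :=
  us ::= IN 0 ;;
  vi ::= IN 0 ;;
  While (BLe (IPl (V vi) (IN 1)) (V vn)) (hull_step low).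

Definition heavy (n : nat) (w : nat -> R) (t : R) (p : nat) : Prop := (p < n)%nat /\ t <= w p.

Lemma hull_correct low n s :
  hi s vn 0%nat = n -> is_sort (hr s px) n (hi s xs) ->
  tc (hull low) s (60 * n + 10) (fun s' =>
    (hi s' us 0 <= n)%nat /\
    upper_hull (hr s px) (yval low (hr s py)) (heavy n (hr s wt) (hr s tau 0%nat))
      (hi s' uh) (hi s' us 0%nat)).
Proof.
  intros Hn Hs.
  set (x := hr s px). set (y := yval low (hr s py)).
  set (Q := heavy n (hr s wt) (hr s tau 0%nat)). set (out := hi s xs).
  apply (tc_weaken _ _ (1 + (1 + (2 * n * (22 + 1) + 1))) _ (fun s' =>
    (hi s' us 0 <= n)%nat /\ upper_hull x y Q (hi s' uh) (hi s' us 0%nat))); [|lia|auto].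
  apply tc_seti_seq; intros s1 F1 E1. hcbn_in E1.
  apply tc_seti_seq; intros s2 F2 E2. hcbn_in E2.
  (* The measure is twice the number of unscanned points plus the stack height: a push or a pop
     lowers it by 1, a skip by 2. This is the amortized count that makes the hull linear. *)
  apply (tc_while _ _ s2 (fun m s' =>
    (2 * hi s' vi 0 + m = 2 * n + hi s' us 0)%nat /\ (hi s' vi 0 <= n)%nat /\
    (hi s' us 0 <= hi s' vi 0)%nat /\
    hull_inv x y Q out (hi s' vi 0%nat) (hi s' uh) (hi s' us 0%nat))).
  - rewrite E2, (frame_hi us _ _ _ F2 eq_refl), E1, !upd_eq.
    repeat split; intros; try lia. destruct H1 as (o & Ho & _); lia.
  - intros m s3 F (Hm & Hi & Hu & Hinv) Hb. hcbn_in Hb.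
    assert (En : hi s3 vn 0%nat = n).
    { rewrite (frame_hi vn _ _ _ F eq_refl), (frame_hi vn _ _ _ F2 eq_refl),
        (frame_hi vn _ _ _ F1 eq_refl); exact Hn. }
    assert (Eo : hi s3 xs = out).
    { rewrite (frame_hi xs _ _ _ F eq_refl), (frame_hi xs _ _ _ F2 eq_refl),
        (frame_hi xs _ _ _ F1 eq_refl); reflexivity. }
    assert (Er : forall r, hr s3 r = hr s r).
    { intros r. rewrite (frame_hr r _ _ _ F), (frame_hr r _ _ _ F2 eq_refl),
        (frame_hr r _ _ _ F1 eq_refl); [reflexivity|now destruct low]. }
    rewrite En in Hb. set (i := hi s3 vi 0%nat) in *. set (c := hi s3 uh) in *.
    set (k := hi s3 us 0%nat) in *.
    block; [|destruct low; cbn; lia].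
    unfold hull_step, cross_exp; cbn [wp btrue bfalse evi evr]; rewrite !evr_yexp.
    cbn [wp btrue bfalse evi evr hi hr seti setr upd2 Nat.eqb].
    rewrite ?upd_eq, Eo, !Er. fold i k c x y. change (IZR (Z.of_nat 0)) with 0.
    assert (Hpn : (out i < n)%nat) by (apply Hs; lia).
    assert (Hnew : forall t, (t < k)%nat -> Q (c t) /\ x (c t) <= x (out i) /\ c t <> out i).
    { intros t Ht. destruct Hinv as (_ & HQ & _). destruct (HQ t Ht) as (H1 & o & Ho & E).
      split; [exact H1|split].
      - rewrite <- E. apply Hs; lia.
      - rewrite <- E. intros E'. apply (proj1 (proj2 Hs)) in E'; lia. }
    assert (Hskip : (forall a b, 0 <= b -> ~ strict_max x y a b Q (out i)) ->
      exists m', (m' < m)%nat /\ (2 * (i + 1) + m' = 2 * n + k)%nat /\ (i + 1 <= n)%nat /\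
        (k <= i + 1)%nat /\ hull_inv x y Q out (i + 1) c k).
    { intros H. exists (m - 2)%nat. repeat (split; [lia|]).
      rewrite Nat.add_1_r. now apply hull_inv_skip. }
    assert (Hpop : (1 <= k)%nat -> (forall a b, 0 <= b -> ~ strict_max x y a b Q (c (k - 1)%nat)) ->
      exists m', (m' < m)%nat /\ (2 * i + m' = 2 * n + (k - 1))%nat /\ (i <= n)%nat /\
        (k - 1 <= i)%nat /\ hull_inv x y Q out i c (k - 1)).
    { intros Hk H. exists (m - 1)%nat. repeat (split; [lia|]). now apply hull_inv_pop. }
    assert (Hpush : Q (out i) -> ((1 <= k)%nat -> x (c (k - 1)%nat) < x (out i)) ->
      ((2 <= k)%nat -> cross x y (c (k - 2)%nat) (c (k - 1)%nat) (out i) < 0) ->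
      exists m', (m' < m)%nat /\ (2 * (i + 1) + m' = 2 * n + (k + 1))%nat /\ (i + 1 <= n)%nat /\
        (k + 1 <= i + 1)%nat /\ hull_inv x y Q out (i + 1) (upd c k (out i)) (k + 1)).
    { intros H1 H2 H3. exists (m - 1)%nat. repeat (split; [lia|]).
      rewrite !Nat.add_1_r. now apply hull_inv_push. }
    split; intros Hw.
    { intros _. apply Hskip. intros a b _ [[_ Hq] _]. fold (hr s tau 0%nat) in *. lra. }
    assert (HQ : Q (out i)) by (split; [exact Hpn|exact Hw]).
    split; intros Hk.
    { intros _. apply Hpush; auto; lia. }
    destruct (Hnew (k - 1)%nat ltac:(lia)) as (HQt & Hxt & Hne).
    split; intros Hx; [split; intros Hk2; [split; intros Hcr|]|split; intros Hy]; intros _.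
    + apply Hpush; auto.
    + apply Hpop; [lia|]. intros a b Hb0 [_ Hmax].
      destruct (Hnew (k - 2)%nat ltac:(lia)) as (HQ2 & _ & _).
      assert (Hlt : x (c (k - 2)%nat) < x (c (k - 1)%nat)).
      { apply (chain_x_lt x y c k); [apply Hinv|lia|lia]. }
      apply (pop_not_max x y a b (c (k - 2)%nat) (c (k - 1)%nat) (out i)); auto.
      apply Hmax; auto. intros E. rewrite E in Hlt; lra.
    + apply Hpush; auto. lia.
    (* The abscissas agree, so for [b >= 0] the higher new point scores at least as much as the top.
       The next case is the same with roles exchanged. *)
    + apply Hpop; [lia|]. intros a b Hb0 [_ Hmax].
      specialize (Hmax _ HQ (fun E => Hne (eq_sym E))). unfold lin in Hmax.
      assert (x (out i) = x (c (k - 1)%nat)) as E by lra. rewrite E in Hmax. nra.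
    + apply Hskip. intros a b Hb0 [_ Hmax].
      specialize (Hmax _ HQt Hne). unfold lin in Hmax.
      assert (x (out i) = x (c (k - 1)%nat)) as E by lra. rewrite E in Hmax. nra.
  - intros m s3 F (Hm & Hi & Hu & Hinv) Hb. hcbn_in Hb.
    assert (En : hi s3 vn 0%nat = n).
    { rewrite (frame_hi vn _ _ _ F eq_refl), (frame_hi vn _ _ _ F2 eq_refl),
        (frame_hi vn _ _ _ F1 eq_refl); exact Hn. }
    rewrite En in Hb. replace (hi s3 vi 0)%nat with n in * by lia.
    split; [lia|]. apply (hull_inv_final x y n Q out); auto.
    intros p Hp; apply Hp.
Qed.

(** * The diameter of the heavy points *)

Notation bp := 22%nat (only parsing).
Notation bq := 23%nat (only parsing).
Notation diam := 7%nat (only parsing).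

Definition dist2_exp (p q : iexp) : rexp :=
  RPl (RMu (RMi (RA px p) (RA px q)) (RMi (RA px p) (RA px q)))
      (RMu (RMi (RA py p) (RA py q)) (RMi (RA py p) (RA py q))).

Lemma evr_dist2 p q s :
  evr (dist2_exp p q) s = dist2 (hr s px) (hr s py) (evi p s) (evi q s).
Proof. reflexivity. Qed.

(** The upper pointer moves right from the left end, the lower pointer left from the right end. End
    tests come first, so slopes are compared only where both edges exist; with both chains exhausted
    the upper pointer steps past its end and stops the loop. *)
Definition calipers_step : cmd :=
  let u := IA uh (V vi) in let u' := IA uh (IPl (V vi) (IN 1)) in
  let l := IA lh (IMi (V vj) (IN 1)) in let l' := IA lh (V vj) in
  let right := vi ::= IPl (V vi) (IN 1) in
  let left := vj ::= IMi (V vj) (IN 1) in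
  If (BLt (W diam) (dist2_exp u l'))
    (diam :::= dist2_exp u l' ;; bp ::= u ;; bq ::= l') Skip ;;
  If (BLe (V vj) (IN 0)) right
    (If (BLe (V us) (IPl (V vi) (IN 1))) left
      (If (BLt (RMu (RMi (RA py l') (RA py l)) (RMi (RA px u') (RA px u)))
               (RMu (RMi (RA py u') (RA py u)) (RMi (RA px l') (RA px l)))) right left)).

(** The initial pair consists of one heavy point taken twice, at distance 0, so a single heavy point
    needs no separate treatment. *)
Definition calipers : cmd :=
  vi ::= IN 0 ;;
  vj ::= IMi (V ls) (IN 1) ;;
  bp ::= IA uh (IN 0) ;;
  bq ::= IA uh (IN 0) ;;
  diam :::= RN 0 ;;
  While (BLe (IPl (V vi) (IN 1)) (V us)) calipers_step.

Definition distinct (x y : nat -> R) (n : nat) : Prop :=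
  forall p q, (p < n)%nat -> (q < n)%nat -> p <> q -> 0 < dist2 x y p q.

Lemma calipers_correct n w t s :
  let x := hr s px in let y := hr s py in let Q := heavy n w t in
  distinct x y n -> (exists p, Q p) ->
  upper_hull x y Q (hi s uh) (hi s us 0%nat) ->
  upper_hull x (mirror y) Q (hi s lh) (hi s ls 0%nat) ->
  (hi s us 0 <= n)%nat -> (hi s ls 0 <= n)%nat ->
  tc calipers s (30 * n + 10) (fun s' =>
    Q (hi s' bp 0%nat) /\ Q (hi s' bq 0%nat) /\
    hr s' diam 0%nat = dist2 x y (hi s' bp 0%nat) (hi s' bq 0%nat) /\
    forall p q, Q p -> Q q -> dist2 x y p q <= hr s' diam 0%nat).
Proof.
  intros x y Q Hdist Hex Hu Hl Hun Hln.
  destruct (diam_exists x y Q n) as (p & q & Hd & Hy); auto.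
  { intros v; unfold Q, heavy. destruct (lt_dec v n), (Rle_dec t (w v)); tauto. }
  { intros v Hv; apply Hv. }
  destruct (diam_guides x y Q _ _ _ _ p q Hu Hl Hd Hy) as (a & b & Ea & Eb & Ha & Hb & G1 & G2).
  { intros p' q' H1 H2; apply Hdist; [apply H1|apply H2]. }
  set (u := hi s uh) in *. set (l := hi s lh) in *.
  set (um := hi s us 0%nat) in *. set (lm := hi s ls 0%nat) in *.
  apply (tc_weaken _ _ (1 + (1 + (1 + (1 + (1 + ((um + lm) * (14 + 1) + 1)))))) _ (fun s' =>
    Q (hi s' bp 0%nat) /\ Q (hi s' bq 0%nat) /\
    hr s' diam 0%nat = dist2 x y (hi s' bp 0%nat) (hi s' bq 0%nat) /\
    forall p q, Q p -> Q q -> dist2 x y p q <= hr s' diam 0%nat)); [|lia|auto].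
  apply tc_seti_seq; intros s1 F1 E1. hcbn_in E1.
  apply tc_seti_seq; intros s2 F2 E2. hcbn_in E2.
  apply tc_seti_seq; intros s3 F3 E3. hcbn_in E3.
  apply tc_seti_seq; intros s4 F4 E4. hcbn_in E4.
  apply tc_setr_seq; intros s5 F5 E5. hcbn_in E5.
  assert (Ei : forall a, existsb (Nat.eqb a) [vi; vj; bp; bq] = false -> hi s5 a = hi s a).
  { intros e He. simpl in He. repeat (apply orb_false_elim in He; destruct He as [? He]).
    rewrite (frame_hi e _ _ _ F5 eq_refl), (frame_hi e _ _ _ F4), (frame_hi e _ _ _ F3),
      (frame_hi e _ _ _ F2), (frame_hi e _ _ _ F1); simpl; try (rewrite orb_false_r); auto. }
  assert (Er : forall a, existsb (Nat.eqb a) [diam] = false -> hr s5 a = hr s a).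
  { intros e He. rewrite (frame_hr e _ _ _ F5), (frame_hr e _ _ _ F4), (frame_hr e _ _ _ F3),
      (frame_hr e _ _ _ F2), (frame_hr e _ _ _ F1); auto. }
  (* Last clause: the target [(a, b)] still lies ahead, or its distance has already been counted.
     The measure is the number of moves left on both chains. *)
  apply (tc_while _ _ s5 (fun m s' =>
    (hi s' vi 0 + m = S (um + hi s' vj 0))%nat /\ (hi s' vi 0 <= um)%nat /\ (hi s' vj 0 < lm)%nat /\
    Q (hi s' bp 0%nat) /\ Q (hi s' bq 0%nat) /\
    hr s' diam 0%nat = dist2 x y (hi s' bp 0%nat) (hi s' bq 0%nat) /\
    ((hi s' vi 0 <= a)%nat /\ (b <= hi s' vj 0)%nat \/ dist2 x y p q <= hr s' diam 0%nat))).
  - rewrite E5, (frame_hi vi _ _ _ F5 eq_refl), (frame_hi vi _ _ _ F4 eq_refl),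
      (frame_hi vi _ _ _ F3 eq_refl), (frame_hi vi _ _ _ F2 eq_refl), E1.
    rewrite (frame_hi vj _ _ _ F5 eq_refl), (frame_hi vj _ _ _ F4 eq_refl),
      (frame_hi vj _ _ _ F3 eq_refl), E2, (frame_hi ls _ _ _ F1 eq_refl).
    rewrite (frame_hi bp _ _ _ F5 eq_refl), (frame_hi bp _ _ _ F4 eq_refl), E3,
      (frame_hi uh _ _ _ F2 eq_refl), (frame_hi uh _ _ _ F1 eq_refl).
    rewrite (frame_hi bq _ _ _ F5 eq_refl), E4, (frame_hi uh _ _ _ F3 eq_refl),
      (frame_hi uh _ _ _ F2 eq_refl), (frame_hi uh _ _ _ F1 eq_refl).
    rewrite !upd_eq. fold lm u.
    assert (Q (u 0%nat)) by (apply Hu; fold um; lia).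
    repeat (split; [first [assumption|lia]|]).
    split; [symmetry; apply dist2_refl|]. left; lia.
  - intros m s6 F (Hm & Hi & Hj & Hp & Hq & Hdm & Hinv) Hg. hcbn_in Hg.
    assert (Ei' : forall a, existsb (Nat.eqb a) [vi; vj; bp; bq] = false -> hi s6 a = hi s a).
    { intros e He. rewrite <- (Ei e He). apply (frame_hi e _ _ _ F).
      simpl in *. repeat (apply orb_false_elim in He; destruct He as [? He]).
      now rewrite !orb_false_r, !orb_false_iff. }
    assert (Er' : forall a, existsb (Nat.eqb a) [diam] = false -> hr s6 a = hr s a).
    { intros e He. rewrite <- (Er e He). apply (frame_hr e _ _ _ F).
      simpl in *. now rewrite !orb_false_r in *. }
    rewrite (Ei' us eq_refl) in Hg. fold um in Hg.
    eapply (tc_seq _ _ _ 6 8 (fun s7 =>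
      hi s7 vi 0%nat = hi s6 vi 0%nat /\ hi s7 vj 0%nat = hi s6 vj 0%nat /\
      Q (hi s7 bp 0%nat) /\ Q (hi s7 bq 0%nat) /\
      hr s7 diam 0%nat = dist2 x y (hi s7 bp 0%nat) (hi s7 bq 0%nat) /\
      dist2 x y (u (hi s6 vi 0%nat)) (l (hi s6 vj 0%nat)) <= hr s7 diam 0%nat /\
      hr s6 diam 0%nat <= hr s7 diam 0%nat)).
    { block; [|cbn; lia]. cbn [wp btrue bfalse]; rewrite !evr_dist2; hcbn.
      rewrite (Ei' uh eq_refl), (Ei' lh eq_refl), (Er' px eq_refl), (Er' py eq_refl).
      fold x y u l. split; intros Hc.
      - repeat (split; [solve [reflexivity|assumption|apply Hu; fold um; lia|apply Hl; fold lm; lia|lra]|]).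
        lra.
      - repeat (split; [solve [reflexivity|assumption]|]). lra. }
    intros s7 F7 (Evi & Evj & Hp7 & Hq7 & Hdm7 & Hvis & Hle).
    block; [|cbn; lia]. hcbn.
    rewrite (frame_hi us _ _ _ F7 eq_refl), (frame_hi uh _ _ _ F7 eq_refl),
      (frame_hi lh _ _ _ F7 eq_refl), (frame_hr px _ _ _ F7 eq_refl),
      (frame_hr py _ _ _ F7 eq_refl), (Ei' us eq_refl), (Ei' uh eq_refl), (Ei' lh eq_refl),
      (Er' px eq_refl), (Er' py eq_refl), Evi, Evj.
    fold x y u l um. set (i := hi s6 vi 0%nat) in *. set (j := hi s6 vj 0%nat) in *.
    fold (steeper x y (u i) (u (i + 1)%nat) (l (j - 1)%nat) (l j)).
    assert (Hrest : Q (hi s7 bp 0%nat) /\ Q (hi s7 bq 0%nat) /\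
      hr s7 diam 0%nat = dist2 x y (hi s7 bp 0%nat) (hi s7 bq 0%nat)) by auto.
    assert (Hinv' : (i < a /\ b <= j)%nat \/ (i <= a /\ b < j)%nat \/
      dist2 x y p q <= hr s7 diam 0%nat).
    { destruct Hinv as [[H1 H2]|H]; [|right; right; lra].
      destruct (Nat.eq_dec i a) as [->|]; [|left; lia].
      destruct (Nat.eq_dec j b) as [->|]; [|right; left; lia].
      right; right. rewrite <- Ea, <- Eb. exact Hvis. }
    clear Hinv.
    (* A move to the right loses the target only from [i = a] with [b < j], a move to the left only
       from [j = b] with [i < a]. Either is excluded by an exhausted chain or by [guides]. *)
    assert (Right : (i = a -> b < j -> False)%nat ->
      exists m', (m' < m)%nat /\ (i + 1 + m' = S (um + j))%nat /\ (i + 1 <= um)%nat /\ (j < lm)%nat /\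
        Q (hi s7 bp 0%nat) /\ Q (hi s7 bq 0%nat) /\
        hr s7 diam 0%nat = dist2 x y (hi s7 bp 0%nat) (hi s7 bq 0%nat) /\
        ((i + 1 <= a)%nat /\ (b <= j)%nat \/ dist2 x y p q <= hr s7 diam 0%nat)).
    { intros H. exists (m - 1)%nat. repeat (split; [lia|]).
      repeat (split; [tauto|]).
      destruct Hinv' as [H1|[H1|H1]]; [left; lia| |now right].
      left. destruct (Nat.eq_dec i a); [elim H; lia|lia]. }
    assert (Left : (0 < j)%nat -> (i < a -> j = b -> False)%nat ->
      exists m', (m' < m)%nat /\ (i + m' = S (um + (j - 1)))%nat /\ (i <= um)%nat /\ (j - 1 < lm)%nat /\
        Q (hi s7 bp 0%nat) /\ Q (hi s7 bq 0%nat) /\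
        hr s7 diam 0%nat = dist2 x y (hi s7 bp 0%nat) (hi s7 bq 0%nat) /\
        ((i <= a)%nat /\ (b <= j - 1)%nat \/ dist2 x y p q <= hr s7 diam 0%nat)).
    { intros Hj0 H. exists (m - 1)%nat. repeat (split; [lia|]).
      repeat (split; [tauto|]).
      destruct Hinv' as [H1|[H1|H1]]; [|left; lia|now right].
      left. destruct (Nat.eq_dec j b); [elim H; lia|lia]. }
    split; intros Hj0.
    { intros _. apply Right. lia. }
    split; intros Hiu.
    { intros _. apply Left; [lia|]. lia. }
    split; intros Hs _.
    + apply Right. intros -> Hbj. now apply (G2 j).
    + apply Left; [lia|]. intros Hia Ejb. subst b.
      specialize (G1 i Hia Hj0). unfold steeper in G1. lra.
  - intros m s6 F (Hm & Hi & Hj & Hp & Hq & Hdm & Hinv) Hg. hcbn_in Hg.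
    assert (Eu : hi s6 us 0%nat = um) by (rewrite (frame_hi us _ _ _ F eq_refl), Ei; reflexivity).
    rewrite Eu in Hg. repeat (split; [assumption|]).
    intros p' q' Hp' Hq'. destruct Hd as (_ & _ & Hd).
    (* Beyond the end of the upper chain the target cannot lie ahead. *)
    destruct Hinv as [[H1 _]|H]; [lia|].
    specialize (Hd p' q' Hp' Hq'). lra.
Qed.

(** * Binary search over the weights *)

Notation tup := 8%nat (only parsing).
Notation va := 9%nat (only parsing).
Notation vb := 10%nat (only parsing).
Notation vlo := 18%nat (only parsing).
Notation vhi := 19%nat (only parsing).
Notation mid := 20%nat (only parsing).
Notation res := 21%nat (only parsing).
Notation k2 := 24%nat (only parsing).
Notation val := 8%nat (only parsing).

Definition copy (src dst : nat) : cmd :=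
  vi ::= IN 0 ;;
  While (BLe (IPl (V vi) (IN 1)) (V vn))
    (SetI dst (V vi) (IA src (V vi)) ;; vi ::= IPl (V vi) (IN 1)).

Lemma copy_correct src dst n s :
  hi s vn 0%nat = n ->
  existsb (Nat.eqb dst) [vi; vn; src] = false -> Nat.eqb src vi = false ->
  tc (copy src dst) s (3 * n + 2) (fun s' => forall t, (t < n)%nat -> hi s' dst t = hi s src t).
Proof.
  intros Hn Hdst Hsrc. simpl in Hdst.
  apply orb_false_elim in Hdst; destruct Hdst as [D1 Hdst].
  apply orb_false_elim in Hdst; destruct Hdst as [D2 Hdst].
  apply orb_false_elim in Hdst; destruct Hdst as [D3 _].
  pose proof D1 as D1'; rewrite Nat.eqb_sym in D1'.
  pose proof D2 as D2'; rewrite Nat.eqb_sym in D2'.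
  pose proof D3 as D3'; rewrite Nat.eqb_sym in D3'.
  apply (tc_weaken _ _ (1 + (n * (2 + 1) + 1)) _ (fun s' =>
    forall t, (t < n)%nat -> hi s' dst t = hi s src t)); [|lia|auto].
  apply tc_seti_seq; intros s1 F1 E1. hcbn_in E1.
  apply (tc_while _ _ s1 (fun m s' => (hi s' vi 0 + m = n)%nat /\
    forall t, (t < hi s' vi 0)%nat -> hi s' dst t = hi s src t)).
  - rewrite E1, upd_eq. split; [reflexivity|lia].
  - intros m s2 F (Hm & Hc) Hb. hcbn_in Hb.
    assert (En : hi s2 vn 0%nat = n).
    { rewrite (frame_hi vn _ _ _ F), (frame_hi vn _ _ _ F1 eq_refl); [exact Hn|].
      cbn [modi app existsb]. now rewrite D2'. }
    assert (Es : hi s2 src = hi s src).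
    { rewrite (frame_hi src _ _ _ F), (frame_hi src _ _ _ F1); [reflexivity| |];
        cbn [modi app existsb]; now rewrite ?D3', Hsrc. }
    block; [|apply Nat.le_refl]. hcbn. unfold upd2. rewrite ?D1, ?D1', ?Nat.eqb_refl, Es. intros _.
    rewrite En in Hb. exists (m - 1)%nat.
    split; [lia|split; [lia|]].
    intros t Ht. destruct (Nat.eq_dec t (hi s2 vi 0%nat)) as [->|]; [apply upd_eq|].
    rewrite upd_neq by auto. apply Hc; lia.
  - intros m s2 F (Hm & Hc) Hb. hcbn_in Hb.
    assert (En : hi s2 vn 0%nat = n).
    { rewrite (frame_hi vn _ _ _ F), (frame_hi vn _ _ _ F1 eq_refl); [exact Hn|].
      cbn [modi app existsb]. now rewrite D2'. }
    intros t Ht. apply Hc. lia.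
Qed.

Lemma upper_hull_ext x y Q c c' m n :
  (m <= n)%nat -> (forall t, (t < n)%nat -> c' t = c t) ->
  upper_hull x y Q c m -> upper_hull x y Q c' m.
Proof.
  intros Hm E ([Hx Hc] & HQ & Hmax); split; [split|split].
  - intros t Ht. rewrite !E by lia. now apply Hx.
  - intros t Ht. rewrite !E by lia. now apply Hc.
  - intros t Ht. rewrite E by lia. now apply HQ.
  - intros a b p Hb Hp. destruct (Hmax a b p Hb Hp) as (t & Ht & Et).
    exists t; split; [exact Ht|]. now rewrite E by lia.
Qed.

(** Stored from index [k] on, so that the epilogue can fill the output cells 0 to [k - 1] without
    overwriting an unread entry. *)
Definition record : cmd :=
  va ::= IN 0 ;;
  While (BLe (IPl (V va) (IN 1)) (V k2))
    (SetI res (IPl (V vk) (V va)) (IA tup (V va)) ;; va ::= IPl (V va) (IN 1)) ;;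
  SetI res (IPl (V vk) (V k2)) (V bp) ;;
  SetI res (IPl (IPl (V vk) (V k2)) (IN 1)) (V bq).

Lemma record_correct s :
  tc record s (3 * hi s k2 0 + 4) (fun s' =>
    (forall a, (a < hi s k2 0)%nat -> hi s' res (hi s vk 0 + a)%nat = hi s tup a) /\
    hi s' res (hi s vk 0 + hi s k2 0)%nat = hi s bp 0%nat /\
    hi s' res (hi s vk 0 + hi s k2 0 + 1)%nat = hi s bq 0%nat).
Proof.
  eapply (tc_weaken _ _ (1 + ((hi s k2 0 * (2 + 1) + 1) + (1 + 1)))); [|lia|intros s' _ H; exact H].
  apply tc_seti_seq; intros s1 F1 E1. hcbn_in E1.
  eapply tc_seq.
  { apply (tc_while _ _ s1 (fun m s' => (hi s' va 0 + m = hi s k2 0)%nat /\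
      forall a, (a < hi s' va 0)%nat -> hi s' res (hi s vk 0 + a)%nat = hi s tup a)).
    - rewrite E1, upd_eq. split; [reflexivity|lia].
    - intros m s2 F (Hm & Hc) Hb. hcbn_in Hb.
      rewrite (frame_hi k2 _ _ _ F eq_refl), (frame_hi k2 _ _ _ F1 eq_refl) in Hb.
      block; [|apply Nat.le_refl]. hcbn. intros _.
      rewrite (frame_hi vk _ _ _ F eq_refl), (frame_hi vk _ _ _ F1 eq_refl),
        (frame_hi tup _ _ _ F eq_refl), (frame_hi tup _ _ _ F1 eq_refl).
      exists (m - 1)%nat. split; [lia|split; [lia|]].
      intros a Ha. destruct (Nat.eq_dec a (hi s2 va 0%nat)) as [->|]; [apply upd_eq|].
      rewrite upd_neq by lia. apply Hc; lia.
    - intros m s2 F H Hb. exact (conj Hb (ex_intro _ m H)). }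
  intros s2 F (Hb & m & Hm & Hc). hcbn_in Hb.
  rewrite (frame_hi k2 _ _ _ F eq_refl), (frame_hi k2 _ _ _ F1 eq_refl) in Hb.
  block; [|apply Nat.le_refl]. hcbn.
  rewrite (frame_hi vk _ _ _ F eq_refl), (frame_hi vk _ _ _ F1 eq_refl),
    (frame_hi k2 _ _ _ F eq_refl), (frame_hi k2 _ _ _ F1 eq_refl),
    (frame_hi bp _ _ _ F eq_refl), (frame_hi bp _ _ _ F1 eq_refl),
    (frame_hi bq _ _ _ F eq_refl), (frame_hi bq _ _ _ F1 eq_refl).
  split; [|split; [rewrite upd_neq by lia; apply upd_eq|apply upd_eq]].
  intros a Ha. rewrite !upd_neq by lia. apply Hc; lia.
Qed.

(** [hull] always builds in [uh]; the lower hull is therefore computed first and moved to [lh]. *)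
Definition probe : cmd :=
  mid ::= IA half (IPl (V vlo) (V vhi)) ;;
  tau :::= RA wt (IA ws (V mid)) ;;
  hull true ;; copy uh lh ;; ls ::= V us ;; hull false ;; calipers ;;
  If (BLt (W diam) (W tau))
    (vhi ::= V mid ;; val :::= W diam)
    (vlo ::= IPl (V mid) (IN 1) ;; val :::= W tau) ;;
  If (BLt (W best) (W val)) (record ;; best :::= W val) Skip.

Definition search : cmd :=
  vlo ::= IN 0 ;; vhi ::= V vn ;; While (BLe (IPl (V vlo) (IN 1)) (V vhi)) probe.

Definition spread (x y : nat -> R) (n k : nat) (r : R) (S : nat -> nat) : Prop :=
  (forall a, (a < k)%nat -> (S a < n)%nat) /\
  forall a b, (a < b)%nat -> (b < k)%nat -> r <= dist2 x y (S a) (S b).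

(* The value [best] is only a certified lower bound for the recorded selection;
   a positive one forces the recorded points to be distinct. *)
Definition recorded (x y : nat -> R) (n k : nat) (s : hstate) : Prop :=
  0 <= hr s best 0%nat /\
  (0 < hr s best 0%nat -> spread x y n k (hr s best 0%nat) (fun a => hi s res (k + a)%nat)).

(** Only the upper bounds on [w], which suffice for a recorded selection to be sound. That [w] is no
    smaller than necessary matters for optimality and enters in [covered_spread]. *)
Definition weights (x y : nat -> R) (n m : nat) (T : nat -> nat) (w : nat -> R) : Prop :=
  (forall a, (a < m)%nat -> (T a < n)%nat) /\
  forall p, (p < n)%nat ->
    (forall a b, (a < b)%nat -> (b < m)%nat -> w p <= dist2 x y (T a) (T b)) /\
    (forall a, (a < m)%nat -> w p <= dist2 x y (T a) p).

Lemma spread_extend x y n m T w v p q S :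
  weights x y n m T w -> (p < n)%nat -> (q < n)%nat ->
  v <= w p -> v <= w q -> v <= dist2 x y p q ->
  (forall a, (a < m)%nat -> S a = T a) -> S m = p -> S (m + 1)%nat = q ->
  spread x y n (m + 2) v S.
Proof.
  intros [HT Hw] Hp Hq H1 H2 H3 ES Ep Eq; split.
  - intros a Ha. destruct (Nat.lt_ge_cases a m); [rewrite ES by auto; auto|].
    destruct (Nat.eq_dec a m) as [->|]; [now rewrite Ep|].
    replace a with (m + 1)%nat by lia. now rewrite Eq.
  - intros a b Hab Hb.
    destruct (Hw p Hp) as [W1 W2]. destruct (Hw q Hq) as [_ W3].
    destruct (Nat.lt_ge_cases b m).
    { rewrite !ES by lia. specialize (W1 a b Hab H); lra. }
    destruct (Nat.lt_ge_cases a m).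
    { rewrite (ES a) by auto. specialize (W2 a H0). specialize (W3 a H0).
      destruct (Nat.eq_dec b m) as [->|]; [rewrite Ep; lra|].
      replace b with (m + 1)%nat by lia. rewrite Eq; lra. }
    replace a with m by lia. replace b with (m + 1)%nat by lia. now rewrite Ep, Eq.
Qed.

Definition input_ok (n k : nat) (x y : nat -> R) (s : hstate) : Prop :=
  env n s /\ hi s vk 0%nat = k /\ (hi s k2 0 + 2 = k)%nat /\ hr s px = x /\ hr s py = y /\
  is_sort x n (hi s xs).

Lemma input_ok_frame n k x y c s s' :
  input_ok n k x y s -> frame c s s' ->
  existsb (fun a => existsb (Nat.eqb a) (modi c)) [vn; vk; half; k2; xs] = false ->
  existsb (fun a => existsb (Nat.eqb a) (modr c)) [px; py] = false ->
  input_ok n k x y s'.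
Proof.
  unfold input_ok. intros (H1 & H2 & H3 & H4 & H5 & H6) F E1 E2.
  cbn [existsb] in E1, E2. repeat rewrite orb_false_iff in E1; repeat rewrite orb_false_iff in E2.
  destruct E1 as (e1 & e2 & e3 & e4 & e5 & _), E2 as (e6 & e7 & _).
  rewrite (frame_hi _ _ _ _ F e2), (frame_hi _ _ _ _ F e4), (frame_hr _ _ _ _ F e6),
    (frame_hr _ _ _ _ F e7), (frame_hi _ _ _ _ F e5).
  pose proof (env_frame _ _ _ _ H1 F e1 e3). repeat (split; [assumption|]); assumption.
Qed.

Lemma probe_correct n k x y s :
  input_ok n k x y s -> distinct x y n -> (k <= n)%nat ->
  is_sort (hr s wt) n (hi s ws) ->
  weights x y n (hi s k2 0%nat) (hi s tup) (hr s wt) ->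
  recorded x y n k s ->
  let lo := hi s vlo 0%nat in let h := hi s vhi 0%nat in
  let m := ((lo + h) / 2)%nat in let t := hr s wt (hi s ws m) in
  (lo < h)%nat -> (h <= n)%nat ->
  tc probe s (300 * n) (fun s' =>
    recorded x y n k s' /\ hr s best 0%nat <= hr s' best 0%nat /\
    ((hi s' vlo 0%nat = lo /\ hi s' vhi 0%nat = m /\
      forall p q, heavy n (hr s wt) t p -> heavy n (hr s wt) t q ->
        dist2 x y p q <= hr s' best 0%nat) \/
     (hi s' vlo 0%nat = (m + 1)%nat /\ hi s' vhi 0%nat = h /\ t <= hr s' best 0%nat))).
Proof.
  intros Hin Hdist Hkn Hsort Hwt Hrec lo h m t Hlo Hh.
  assert (Hk : (hi s k2 0 + 2 = k)%nat) by (destruct Hin as (_ & _ & H & _); exact H).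
  assert (Hn : forall s', input_ok n k x y s' -> hi s' vn 0%nat = n)
    by (intros s' [[H _] _]; exact H).
  assert (Hxs : forall s', input_ok n k x y s' -> is_sort (hr s' px) n (hi s' xs))
    by (intros s' (_ & _ & _ & E & _ & H); rewrite E; exact H).
  assert (Hm : (lo <= m < h)%nat).
  { subst m. split; [apply Nat.div_le_lower_bound; lia|apply Nat.Div0.div_lt_upper_bound; lia]. }
  eapply (tc_weaken _ _ (1 + (1 + ((60 * n + 10) + ((3 * n + 2) + (1 + ((60 * n + 10) +
    ((30 * n + 10) + (5 + (3 * hi s k2 0 + 4 + 2)))))))))); [|lia|intros s' _ H; exact H].
  apply tc_seti_seq; intros s1 F1 E1. hcbn_in E1.
  apply tc_setr_seq; intros s2 F2 E2. hcbn_in E2.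
  pose proof (input_ok_frame _ _ _ _ _ _ _ Hin F1 eq_refl eq_refl) as Hin1.
  pose proof (input_ok_frame _ _ _ _ _ _ _ Hin1 F2 eq_refl eq_refl) as Hin2.
  fold lo h in E1. rewrite (proj2 (proj1 Hin) (lo + h)%nat) in E1 by lia. fold m in E1.
  assert (Ew2 : hr s2 wt = hr s wt)
    by (rewrite (frame_hr wt _ _ _ F2 eq_refl), (frame_hr wt _ _ _ F1 eq_refl); reflexivity).
  assert (Et2 : hr s2 tau 0%nat = t).
  { rewrite E2, upd_eq, E1, upd_eq, (frame_hr wt _ _ _ F1 eq_refl), (frame_hi ws _ _ _ F1 eq_refl).
    reflexivity. }
  clear E2.
  eapply tc_seq.
  { exact (hull_correct true n s2 (Hn _ Hin2) (Hxs _ Hin2)). }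
  intros s3 F3 (Hlm & Hl).
  pose proof (input_ok_frame _ _ _ _ _ _ _ Hin2 F3 eq_refl eq_refl) as Hin3.
  eapply tc_seq.
  { exact (copy_correct uh lh n s3 (Hn _ Hin3) eq_refl eq_refl). }
  intros s4 F4 Hcopy.
  apply tc_seti_seq; intros s5 F5 E5. hcbn_in E5.
  pose proof (input_ok_frame _ _ _ _ _ _ _ Hin3 F4 eq_refl eq_refl) as Hin4.
  pose proof (input_ok_frame _ _ _ _ _ _ _ Hin4 F5 eq_refl eq_refl) as Hin5.
  assert (Ew5 : hr s5 wt = hr s wt)
    by (rewrite (frame_hr wt _ _ _ F5 eq_refl), (frame_hr wt _ _ _ F4 eq_refl),
      (frame_hr wt _ _ _ F3 eq_refl); exact Ew2).
  assert (Et5 : hr s5 tau 0%nat = t)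
    by (rewrite (frame_hr tau _ _ _ F5 eq_refl), (frame_hr tau _ _ _ F4 eq_refl),
      (frame_hr tau _ _ _ F3 eq_refl); exact Et2).
  eapply tc_seq.
  { exact (hull_correct false n s5 (Hn _ Hin5) (Hxs _ Hin5)). }
  intros s6 F6 (Hum & Hu).
  pose proof (input_ok_frame _ _ _ _ _ _ _ Hin5 F6 eq_refl eq_refl) as Hin6.
  assert (Ex : forall s', input_ok n k x y s' -> hr s' px = x) by (intros s' H; apply H).
  assert (Ey : forall s', input_ok n k x y s' -> hr s' py = y) by (intros s' H; apply H).
  rewrite (Ex _ Hin2), (Ey _ Hin2), Ew2, Et2 in Hl.
  rewrite (Ex _ Hin5), (Ey _ Hin5), Ew5, Et5 in Hu.
  set (Q := heavy n (hr s wt) t) in *. simpl yval in Hl, Hu.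
  assert (Els : hi s6 ls 0%nat = hi s3 us 0%nat).
  { rewrite (frame_hi ls _ _ _ F6 eq_refl), E5, upd_eq, (frame_hi us _ _ _ F4 eq_refl).
    reflexivity. }
  assert (Hl6 : upper_hull x (mirror y) Q (hi s6 lh) (hi s6 ls 0%nat)).
  { rewrite Els. apply (upper_hull_ext _ _ _ (hi s3 uh) _ _ n); auto.
    intros a Ha. rewrite (frame_hi lh _ _ _ F6 eq_refl), (frame_hi lh _ _ _ F5 eq_refl).
    now apply Hcopy. }
  eapply tc_seq.
  { apply (calipers_correct n (hr s wt) t s6); rewrite ?(Ex _ Hin6), ?(Ey _ Hin6); auto.
    (* The point that supplies the threshold is itself heavy. *)
    - exists (hi s ws m). split; [apply Hsort; lia|apply Rle_refl].
    - now rewrite Els. }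
  intros s7 F7 (Hp & Hq & Hd & Hmax).
  rewrite (Ex _ Hin6), (Ey _ Hin6) in Hd, Hmax. fold Q in Hp, Hq, Hmax.
  pose proof (input_ok_frame _ _ _ _ _ _ _ Hin6 F7 eq_refl eq_refl) as Hin7.
  assert (keep : forall a, existsb (Nat.eqb a)
      [vi; us; uh; vp; lh; ls; vj; bp; bq; mid] = false -> hi s7 a = hi s a).
  { intros e He. cbn [existsb] in He. repeat rewrite orb_false_iff in He.
    rewrite (frame_hi e _ _ _ F7), (frame_hi e _ _ _ F6), (frame_hi e _ _ _ F5),
      (frame_hi e _ _ _ F4), (frame_hi e _ _ _ F3), (frame_hi e _ _ _ F2 eq_refl),
      (frame_hi e _ _ _ F1) by
      (cbn [modi modr app existsb hull hull_step calipers calipers_step copy];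
       repeat rewrite orb_false_iff; tauto). reflexivity. }
  assert (keepr : forall a, existsb (Nat.eqb a) [tau; diam] = false -> hr s7 a = hr s a).
  { intros e He. cbn [existsb] in He. repeat rewrite orb_false_iff in He.
    rewrite (frame_hr e _ _ _ F7), (frame_hr e _ _ _ F6 eq_refl), (frame_hr e _ _ _ F5 eq_refl),
      (frame_hr e _ _ _ F4 eq_refl), (frame_hr e _ _ _ F3 eq_refl), (frame_hr e _ _ _ F2),
      (frame_hr e _ _ _ F1 eq_refl) by
      (cbn [modi modr app existsb hull hull_step calipers calipers_step copy];
       repeat rewrite orb_false_iff; tauto). reflexivity. }
  assert (Em7 : hi s7 mid 0%nat = m).
  { rewrite (frame_hi mid _ _ _ F7 eq_refl), (frame_hi mid _ _ _ F6 eq_refl),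
      (frame_hi mid _ _ _ F5 eq_refl), (frame_hi mid _ _ _ F4 eq_refl),
      (frame_hi mid _ _ _ F3 eq_refl), (frame_hi mid _ _ _ F2 eq_refl), E1. apply upd_eq. }
  assert (Et7 : hr s7 tau 0%nat = t)
    by (rewrite (frame_hr tau _ _ _ F7 eq_refl), (frame_hr tau _ _ _ F6 eq_refl); exact Et5).
  (* [val] becomes min(t, D(t)), in squared distances; the smaller of the two decides which side of
     the interval is discarded. *)
  eapply (tc_seq _ _ _ 5 _ (fun s8 =>
    hr s8 val 0%nat <= t /\ hr s8 val 0%nat <= hr s7 diam 0%nat /\
    ((hi s8 vlo 0%nat = lo /\ hi s8 vhi 0%nat = m /\ hr s8 val 0%nat = hr s7 diam 0%nat) \/
     (hi s8 vlo 0%nat = (m + 1)%nat /\ hi s8 vhi 0%nat = h /\ hr s8 val 0%nat = t)))).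
  { block; [|cbn; lia]. hcbn. rewrite Et7, Em7, (keep vlo eq_refl), (keep vhi eq_refl).
    split; intros Hc; (split; [lra|split; [lra|]]); [left|right]; auto. }
  intros s8 F8 (Hv1 & Hv2 & Hcase).
  pose proof (input_ok_frame _ _ _ _ _ _ _ Hin7 F8 eq_refl eq_refl) as Hin8.
  assert (Eb8 : hr s8 best 0%nat = hr s best 0%nat)
    by (rewrite (frame_hr best _ _ _ F8 eq_refl), (keepr best eq_refl); reflexivity).
  assert (Er8 : hi s8 res = hi s res)
    by (rewrite (frame_hi res _ _ _ F8 eq_refl), (keep res eq_refl); reflexivity).
  assert (Ek8 : hi s8 k2 = hi s k2)
    by (rewrite (frame_hi k2 _ _ _ F8 eq_refl), (keep k2 eq_refl); reflexivity).
  assert (Hgoal : forall s9, hi s9 vlo = hi s8 vlo -> hi s9 vhi = hi s8 vhi ->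
    recorded x y n k s9 -> hr s best 0%nat <= hr s9 best 0%nat ->
    hr s8 val 0%nat <= hr s9 best 0%nat ->
    recorded x y n k s9 /\ hr s best 0%nat <= hr s9 best 0%nat /\
    ((hi s9 vlo 0%nat = lo /\ hi s9 vhi 0%nat = m /\
      forall p q, Q p -> Q q -> dist2 x y p q <= hr s9 best 0%nat) \/
     (hi s9 vlo 0%nat = (m + 1)%nat /\ hi s9 vhi 0%nat = h /\ t <= hr s9 best 0%nat))).
  { intros s9 -> -> H1 H2 H3. split; [exact H1|split; [exact H2|]].
    destruct Hcase as [(A & B & C)|(A & B & C)]; [left|right].
    - split; [exact A|split; [exact B|]]. intros p q Hp' Hq'. specialize (Hmax p q Hp' Hq'). lra.
    - split; [exact A|split; [exact B|lra]]. }
  replace (3 * hi s k2 0 + 4 + 2)%nat with (S (3 * hi s k2 0 + 4 + 1)) by lia.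
  apply tc_if; intros Hc; hcbn_in Hc.
  - eapply tc_seq; [rewrite <- Ek8; apply record_correct|].
    intros s9 F9 (R1 & R2 & R3).
    block; [|cbn; lia]. apply Hgoal; hcbn.
    + apply (frame_hi vlo _ _ _ F9 eq_refl).
    + apply (frame_hi vhi _ _ _ F9 eq_refl).
    + rewrite (frame_hr val _ _ _ F9 eq_refl). unfold recorded; hcbn.
      split; [destruct Hrec; lra|intros _].
      destruct Hin8 as (_ & Ek & _). rewrite Ek, Ek8 in *.
      rewrite <- Hk at 1.
      apply (spread_extend x y n _ (hi s tup) (hr s wt) _ (hi s8 bp 0%nat) (hi s8 bq 0%nat)); auto;
        try rewrite (frame_hi bp _ _ _ F8 eq_refl); try rewrite (frame_hi bq _ _ _ F8 eq_refl);
        try (apply Hp); try (apply Hq).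
      * apply Rle_trans with t; [exact Hv1|apply Hp].
      * apply Rle_trans with t; [exact Hv1|apply Hq].
      * lra.
      * intros a Ha. rewrite R1 by exact Ha.
        now rewrite (frame_hi tup _ _ _ F8 eq_refl), (keep tup eq_refl).
      * rewrite Nat.add_assoc, R3. now rewrite (frame_hi bq _ _ _ F8 eq_refl).
    + rewrite (frame_hr val _ _ _ F9 eq_refl). lra.
    + rewrite (frame_hr val _ _ _ F9 eq_refl). lra.
  - block; [|cbn; lia]. cbn [wp]. apply Hgoal; auto; try lra.
    unfold recorded in *. now rewrite Eb8, Er8.
Qed.

(** Says that [b] is at least every min(w p, w q, |pq|^2); quantifying over lower bounds [r] avoids
    writing the minimum. *)
Definition covered (x y w : nat -> R) (n : nat) (b : R) : Prop :=
  forall p q r, (p < n)%nat -> (q < n)%nat -> r <= w p -> r <= w q -> r <= dist2 x y p q -> r <= b.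

Lemma search_correct n k x y s :
  input_ok n k x y s -> distinct x y n -> (k <= n)%nat -> (2 <= k)%nat ->
  is_sort (hr s wt) n (hi s ws) ->
  weights x y n (hi s k2 0%nat) (hi s tup) (hr s wt) ->
  recorded x y n k s ->
  tc search s (400 * (n * lg n)) (fun s' =>
    recorded x y n k s' /\ hr s best 0%nat <= hr s' best 0%nat /\
    covered x y (hr s wt) n (hr s' best 0%nat)).
Proof.
  intros Hin Hdist Hkn Hk Hsort Hwt Hrec.
  set (w := hr s wt) in *. set (out := hi s ws) in *.
  eapply (tc_weaken _ _ (1 + (1 + (lg n * (300 * n + 1) + 1))));
    [|assert (2 <= lg n)%nat by (unfold lg; lia); nia|intros s' _ H; exact H].
  apply tc_seti_seq; intros s1 F1 E1. hcbn_in E1.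
  apply tc_seti_seq; intros s2 F2 E2. hcbn_in E2.
  pose proof (input_ok_frame _ _ _ _ _ _ _ Hin F1 eq_refl eq_refl) as Hin1.
  pose proof (input_ok_frame _ _ _ _ _ _ _ Hin1 F2 eq_refl eq_refl) as Hin2.
  rewrite (proj1 (proj1 Hin1)) in E2.
  assert (keep : forall s3, frame (While (BLe (IPl (V vlo) (IN 1)) (V vhi)) probe) s2 s3 ->
    hi s3 ws = out /\ hi s3 tup = hi s tup /\ hi s3 k2 = hi s k2 /\ hr s3 wt = w).
  { intros s3 F.
    rewrite (frame_hi ws _ _ _ F eq_refl), (frame_hi tup _ _ _ F eq_refl),
      (frame_hi k2 _ _ _ F eq_refl), (frame_hr wt _ _ _ F eq_refl).
    rewrite (frame_hi ws _ _ _ F2 eq_refl), (frame_hi tup _ _ _ F2 eq_refl),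
      (frame_hi k2 _ _ _ F2 eq_refl), (frame_hr wt _ _ _ F2 eq_refl).
    rewrite (frame_hi ws _ _ _ F1 eq_refl), (frame_hi tup _ _ _ F1 eq_refl),
      (frame_hi k2 _ _ _ F1 eq_refl), (frame_hr wt _ _ _ F1 eq_refl).
    repeat split; reflexivity. }
  (* Each bound [r] is achieved already, or the lighter weight of its pair is a threshold in the
     open interval. Remembering an index [j] instead of a weight makes ties harmless. *)
  apply (tc_while _ _ s2 (fun m s' =>
    (hi s' vhi 0 <= n)%nat /\ (hi s' vhi 0 - hi s' vlo 0 < 2 ^ m)%nat /\
    recorded x y n k s' /\ hr s best 0%nat <= hr s' best 0%nat /\
    forall p q r, (p < n)%nat -> (q < n)%nat -> r <= w p -> r <= w q -> r <= dist2 x y p q ->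
      r <= hr s' best 0%nat \/
      exists j, (hi s' vlo 0 <= j < hi s' vhi 0)%nat /\ r <= w (out j) /\
        w (out j) <= w p /\ w (out j) <= w q)).
  - rewrite E2, (frame_hi vlo _ _ _ F2 eq_refl), E1, !upd_eq.
    rewrite (frame_hr best _ _ _ F2 eq_refl), (frame_hr best _ _ _ F1 eq_refl).
    split; [lia|split; [|split; [|split; [lra|]]]].
    + pose proof (lg_spec n ltac:(lia)). lia.
    + unfold recorded in *. rewrite (frame_hr best _ _ _ F2 eq_refl),
        (frame_hr best _ _ _ F1 eq_refl), (frame_hi res _ _ _ F2 eq_refl),
        (frame_hi res _ _ _ F1 eq_refl). exact Hrec.
    + intros p q r Hp Hq H1 H2 _. right.
      destruct (is_sort_surj w n out p Hsort Hp) as (jp & Hjp & Ep).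
      destruct (is_sort_surj w n out q Hsort Hq) as (jq & Hjq & Eq).
      destruct (Rle_lt_dec (w p) (w q)).
      * exists jp. rewrite Ep. split; [lia|]. lra.
      * exists jq. rewrite Eq. split; [lia|]. lra.
  - intros m s3 F (Hh & Hm & Hrec3 & Hle & Hcov) Hb. hcbn_in Hb.
    destruct (keep s3 F) as (K1 & K2 & K3 & K4).
    pose proof (input_ok_frame _ _ _ _ _ _ _ Hin2 F eq_refl eq_refl) as Hin3.
    set (lo := hi s3 vlo 0%nat) in *. set (h := hi s3 vhi 0%nat) in *.
    set (md := ((lo + h) / 2)%nat).
    assert (Hmd : (lo <= md < h)%nat).
    { subst md. split; [apply Nat.div_le_lower_bound; lia|apply Nat.Div0.div_lt_upper_bound; lia]. }
    eapply tc_weaken; [apply (probe_correct n k x y s3); auto| apply Nat.le_refl|].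
    + rewrite K4, K1. exact Hsort.
    + rewrite K2, K3, K4. exact Hwt.
    + fold lo h. lia.
    + fold lo h md. cbv beta zeta. rewrite K1, K4.
      intros s4 _ (Hrec4 & Hle4 & Hcase) _.
      destruct m as [|m]; [simpl in Hm; lia|]. exists m. split; [lia|].
      pose proof (Nat.div_mod_eq (lo + h) 2). fold md in H.
      pose proof (Nat.mod_upper_bound (lo + h) 2 ltac:(lia)). rewrite Nat.pow_succ_r' in Hm.
      destruct Hcase as [(-> & -> & Hd)|(-> & -> & Ht)];
        (split; [lia|split; [lia|split; [exact Hrec4|split; [lra|]]]]);
        intros p q r Hp Hq H1 H2 H3;
        (destruct (Hcov p q r Hp Hq H1 H2 H3) as [Hr|(j & Hj & H4 & H5 & H6)]; [left; lra|]).
      * destruct (Nat.lt_ge_cases j md) as [Hl|Hg]; [right; exists j; split; [lia|auto]|left].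
        assert (w (out md) <= w (out j)) by (apply Hsort; lia).
        specialize (Hd p q). unfold heavy in Hd.
        apply Rle_trans with (dist2 x y p q); [exact H3|]. apply Hd; split; auto; lra.
      * destruct (Nat.le_gt_cases j md) as [Hl|Hg]; [left|right; exists j; split; [lia|auto]].
        assert (w (out j) <= w (out md)) by (apply Hsort; lia). lra.
  - intros m s3 F (Hh & Hm & Hrec3 & Hle & Hcov) Hb. hcbn_in Hb.
    split; [exact Hrec3|split; [exact Hle|]].
    intros p q r Hp Hq H1 H2 H3.
    destruct (Hcov p q r Hp Hq H1 H2 H3) as [Hr|(j & Hj & _)]; [exact Hr|lia].
Qed.

(** * Enumeration of the tuples *)

Notation carry := 25%nat (only parsing).
Notation w0 := 9%nat (only parsing).
Notation cap := 10%nat (only parsing).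

(** The minimum of [B] and the values in [P], given by its universal property; [B] stands in for
    infinity when [P] is empty. *)
Definition is_inf (B : R) (P : R -> Prop) (v : R) : Prop :=
  v <= B /\ (forall d, P d -> v <= d) /\
  (forall r, r <= B -> (forall d, P d -> r <= d) -> r <= v).

Lemma is_inf_ext B P P' v : (forall d, P d <-> P' d) -> is_inf B P v -> is_inf B P' v.
Proof.
  intros H (H0 & H1 & H2); split; [exact H0|split; [intros d Hd; apply H1, H, Hd|]].
  intros r Hr Hd; apply H2; [exact Hr|]. intros d Hp; apply Hd, H, Hp.
Qed.

Lemma is_inf_lower B P v d : is_inf B P v -> d < v -> is_inf B (fun e => P e \/ e = d) d.
Proof.
  intros (H0 & H1 & H2) Hd; split; [lra|split].
  - intros e [He| ->]; [specialize (H1 e He)|]; lra.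
  - intros r _ Hr; apply Hr; now right.
Qed.

Lemma is_inf_keep B P v d : is_inf B P v -> v <= d -> is_inf B (fun e => P e \/ e = d) v.
Proof.
  intros (H0 & H1 & H2) Hd; split; [exact H0|split].
  - intros e [He| ->]; auto.
  - intros r HB Hr; apply H2; auto.
Qed.

Definition pair_weight : cmd :=
  w0 :::= W cap ;;
  va ::= IN 0 ;;
  While (BLe (IPl (V va) (IN 1)) (V k2))
    (vb ::= IN 0 ;;
     While (BLe (IPl (V vb) (IN 1)) (V va))
       (let d := dist2_exp (IA tup (V vb)) (IA tup (V va)) in
        If (BLt d (W w0)) (w0 :::= d) Skip ;; vb ::= IPl (V vb) (IN 1)) ;;
     va ::= IPl (V va) (IN 1)).

Definition point_weights : cmd :=
  vp ::= IN 0 ;;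
  While (BLe (IPl (V vp) (IN 1)) (V vn))
    (SetR wt (V vp) (W w0) ;;
     va ::= IN 0 ;;
     While (BLe (IPl (V va) (IN 1)) (V k2))
       (let d := dist2_exp (IA tup (V va)) (V vp) in
        If (BLt d (RA wt (V vp))) (SetR wt (V vp) d) Skip ;; va ::= IPl (V va) (IN 1)) ;;
     vp ::= IPl (V vp) (IN 1)).

(** The pairs visited when the outer loop stands at [a] and the inner one at [b]; [a = m], [b = 0]
    gives all of them. *)
Definition tuple_pairs (x y : nat -> R) (T : nat -> nat) (a b : nat) (d : R) : Prop :=
  exists i j, (j < i)%nat /\ (i < a \/ i = a /\ j < b)%nat /\ d = dist2 x y (T j) (T i).

Lemma pair_weight_correct s :
  let x := hr s px in let y := hr s py in let T := hi s tup in let m := hi s k2 0%nat in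
  tc pair_weight s (8 * (m * m) + 8 * m + 8) (fun s' =>
    is_inf (hr s cap 0%nat) (tuple_pairs x y T m 0) (hr s' w0 0%nat)).
Proof.
  intros x y T m.
  eapply (tc_weaken _ _ (1 + (1 + (m * ((1 + ((m * (4 + 1) + 1) + 1)) + 1) + 1))));
    [|lia|intros s' _ H; exact H].
  apply tc_setr_seq; intros s1 F1 E1. hcbn_in E1.
  apply tc_seti_seq; intros s2 F2 E2. hcbn_in E2.
  apply (tc_while _ _ s2 (fun c s' =>
    (hi s' va 0 + c = m)%nat /\
    is_inf (hr s cap 0%nat) (tuple_pairs x y T (hi s' va 0%nat) 0) (hr s' w0 0%nat))).
  - rewrite (frame_hr w0 _ _ _ F2 eq_refl), E1, E2, !upd_eq. split; [reflexivity|].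
    split; [lra|split; [|auto]]. intros d (i & j & _ & H & _). lia.
  - intros c s3 F (Hc & Hinf) Hb. hcbn_in Hb.
    rewrite (frame_hi k2 _ _ _ F eq_refl), (frame_hi k2 _ _ _ F2 eq_refl),
      (frame_hi k2 _ _ _ F1 eq_refl) in Hb. fold m in Hb.
    assert (Ex : hr s3 px = x) by (rewrite (frame_hr px _ _ _ F eq_refl),
      (frame_hr px _ _ _ F2 eq_refl), (frame_hr px _ _ _ F1 eq_refl); reflexivity).
    assert (Ey : hr s3 py = y) by (rewrite (frame_hr py _ _ _ F eq_refl),
      (frame_hr py _ _ _ F2 eq_refl), (frame_hr py _ _ _ F1 eq_refl); reflexivity).
    assert (ET : hi s3 tup = T) by (rewrite (frame_hi tup _ _ _ F eq_refl),
      (frame_hi tup _ _ _ F2 eq_refl), (frame_hi tup _ _ _ F1 eq_refl); reflexivity).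
    apply tc_seti_seq; intros s4 F4 E4. hcbn_in E4.
    set (a := hi s3 va 0%nat) in *.
    assert (Ea : forall s5, frame (SetI vb (IN 0) (IN 0)) s3 s4 -> hi s5 va = hi s4 va ->
      hi s5 va 0%nat = a)
      by (intros s5 _ ->; now rewrite (frame_hi va _ _ _ F4 eq_refl)).
    eapply tc_seq.
    { eapply tc_weaken; [apply (tc_while _ _ s4 (fun e s' =>
        (hi s' vb 0 + e = a)%nat /\
        is_inf (hr s cap 0%nat) (tuple_pairs x y T a (hi s' vb 0%nat)) (hr s' w0 0%nat)) 4 a
        (fun s' => is_inf (hr s cap 0%nat) (tuple_pairs x y T a a) (hr s' w0 0%nat)))
        |nia|intros s' _ H; exact H].
      - rewrite E4, upd_eq, (frame_hr w0 _ _ _ F4 eq_refl). split; [reflexivity|exact Hinf].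
      - intros e s5 F5 (He & Hinf5) Hb5. hcbn_in Hb5.
        pose proof (Ea s5 F4 (frame_hi va _ _ _ F5 eq_refl)) as Ea5.
        rewrite Ea5 in Hb5.
        block; [|cbn; lia]. cbn [wp btrue bfalse]; rewrite !evr_dist2; hcbn.
        rewrite Ea5, (frame_hi tup _ _ _ F5 eq_refl), (frame_hi tup _ _ _ F4 eq_refl), ET,
          (frame_hr px _ _ _ F5 eq_refl), (frame_hr px _ _ _ F4 eq_refl), Ex,
          (frame_hr py _ _ _ F5 eq_refl), (frame_hr py _ _ _ F4 eq_refl), Ey.
        set (b := hi s5 vb 0%nat) in *.
        assert (Hext : forall d, tuple_pairs x y T a b d \/ d = dist2 x y (T b) (T a) <->
          tuple_pairs x y T a (b + 1) d).
        { intros d; split.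
          - intros [(i & j & H1 & H2 & H3)| ->]; [exists i, j; repeat split; auto; lia|].
            exists a, b; repeat split; lia.
          - intros (i & j & H1 & H2 & H3).
            destruct (Nat.eq_dec i a) as [->|]; [destruct (Nat.eq_dec j b) as [->|]|].
            + now right.
            + left; exists a, j; repeat split; auto; lia.
            + left; exists i, j; repeat split; auto; lia. }
        split; intros Hd _; exists (e - 1)%nat; (split; [lia|split; [lia|]]);
          (eapply is_inf_ext; [exact Hext|]).
        + now apply is_inf_lower with (v := hr s5 w0 0%nat).
        + now apply is_inf_keep.
      - intros e s5 F5 (He & Hinf5) Hb5. hcbn_in Hb5.
        rewrite (Ea s5 F4 (frame_hi va _ _ _ F5 eq_refl)) in Hb5.
        replace (hi s5 vb 0%nat) with a in Hinf5 by lia. exact Hinf5. }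
    intros s5 F5 Hinf5. block; [|cbn; lia]. hcbn. intros _.
    rewrite (Ea s5 F4 (frame_hi va _ _ _ F5 eq_refl)).
    exists (c - 1)%nat. split; [lia|split; [lia|]].
    eapply is_inf_ext; [|exact Hinf5]. intros d; split.
    + intros (i & j & H1 & H2 & H3); exists i, j; repeat split; auto; lia.
    + intros (i & j & H1 & H2 & H3); exists i, j; repeat split; auto; lia.
  - intros c s3 F (Hc & Hinf) Hb. hcbn_in Hb.
    rewrite (frame_hi k2 _ _ _ F eq_refl), (frame_hi k2 _ _ _ F2 eq_refl),
      (frame_hi k2 _ _ _ F1 eq_refl) in Hb. fold m in Hb.
    replace (hi s3 va 0%nat) with m in Hinf by lia. exact Hinf.
Qed.

Lemma point_weights_correct s :
  let x := hr s px in let y := hr s py in let T := hi s tup in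
  let m := hi s k2 0%nat in let n := hi s vn 0%nat in
  tc point_weights s (8 * (n * m) + 8 * n + 8) (fun s' =>
    forall p, (p < n)%nat ->
    is_inf (hr s w0 0%nat) (fun d => exists a, (a < m)%nat /\ d = dist2 x y (T a) p) (hr s' wt p)).
Proof.
  intros x y T m n.
  eapply (tc_weaken _ _ (1 + (n * ((1 + (1 + ((m * (4 + 1) + 1) + 1))) + 1) + 1)));
    [|nia|intros s' _ H; exact H].
  apply tc_seti_seq; intros s2 F2 E2. hcbn_in E2.
  set (P := fun m p d => exists a, (a < m)%nat /\ d = dist2 x y (T a) p).
  apply (tc_while _ _ s2 (fun c s' =>
    (hi s' vp 0 + c = n)%nat /\
    forall p, (p < hi s' vp 0)%nat -> is_inf (hr s w0 0%nat) (P m p) (hr s' wt p))).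
  - rewrite E2, upd_eq. split; [reflexivity|lia].
  - intros c s3 F (Hc & Hinf) Hb. hcbn_in Hb.
    rewrite (frame_hi vn _ _ _ F eq_refl), (frame_hi vn _ _ _ F2 eq_refl) in Hb. fold n in Hb.
    apply tc_setr_seq; intros s4 F4 E4. hcbn_in E4.
    apply tc_seti_seq; intros s5 F5 E5. hcbn_in E5.
    assert (Ex : hr s5 px = x) by (rewrite (frame_hr px _ _ _ F5 eq_refl),
      (frame_hr px _ _ _ F4 eq_refl), (frame_hr px _ _ _ F eq_refl),
      (frame_hr px _ _ _ F2 eq_refl); reflexivity).
    assert (Ey : hr s5 py = y) by (rewrite (frame_hr py _ _ _ F5 eq_refl),
      (frame_hr py _ _ _ F4 eq_refl), (frame_hr py _ _ _ F eq_refl),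
      (frame_hr py _ _ _ F2 eq_refl); reflexivity).
    assert (ET : hi s5 tup = T) by (rewrite (frame_hi tup _ _ _ F5 eq_refl),
      (frame_hi tup _ _ _ F4 eq_refl), (frame_hi tup _ _ _ F eq_refl),
      (frame_hi tup _ _ _ F2 eq_refl); reflexivity).
    assert (Ek : hi s5 k2 0%nat = m) by (rewrite (frame_hi k2 _ _ _ F5 eq_refl),
      (frame_hi k2 _ _ _ F4 eq_refl), (frame_hi k2 _ _ _ F eq_refl),
      (frame_hi k2 _ _ _ F2 eq_refl); reflexivity).
    assert (Ew : hr s3 w0 0%nat = hr s w0 0%nat) by (rewrite
      (frame_hr w0 _ _ _ F eq_refl), (frame_hr w0 _ _ _ F2 eq_refl); reflexivity).
    set (p := hi s3 vp 0%nat) in *.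
    assert (Ep : hi s5 vp 0%nat = p)
      by now rewrite (frame_hi vp _ _ _ F5 eq_refl), (frame_hi vp _ _ _ F4 eq_refl).
    rewrite Ew in E4.
    eapply tc_seq.
    { apply (tc_while _ _ s5 (fun e s' =>
        (hi s' va 0 + e = m)%nat /\
        (forall q, (q < p)%nat -> is_inf (hr s w0 0%nat) (P m q) (hr s' wt q)) /\
        is_inf (hr s w0 0%nat) (P (hi s' va 0%nat) p) (hr s' wt p)) 4 m
        (fun s' => forall q, (q < p + 1)%nat -> is_inf (hr s w0 0%nat) (P m q) (hr s' wt q))).
      - rewrite E5, upd_eq, (frame_hr wt _ _ _ F5 eq_refl), E4. split; [reflexivity|split].
        + intros q Hq. rewrite upd_neq by lia. now apply Hinf.
        + rewrite upd_eq. split; [lra|split; [|auto]]. intros d (a & Ha & _). lia.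
      - intros e s6 F6 (He & Hq & Hp) Hb6. hcbn_in Hb6.
        rewrite (frame_hi k2 _ _ _ F6 eq_refl), Ek in Hb6.
        pose proof (frame_hi vp _ _ _ F6 eq_refl) as Ep6.
        block; [|cbn; lia]. cbn [wp btrue bfalse]; rewrite !evr_dist2; hcbn.
        rewrite Ep6, Ep, (frame_hi tup _ _ _ F6 eq_refl), ET,
          (frame_hr px _ _ _ F6 eq_refl), Ex, (frame_hr py _ _ _ F6 eq_refl), Ey.
        set (a := hi s6 va 0%nat) in *.
        assert (Hext : forall d, P a p d \/ d = dist2 x y (T a) p <-> P (a + 1)%nat p d).
        { intros d; split.
          - intros [(i & H1 & H2)| ->]; [exists i; split; auto; lia|exists a; split; auto; lia].
          - intros (i & H1 & H2). destruct (Nat.eq_dec i a) as [->|]; [now right|].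
            left; exists i; split; auto; lia. }
        split; intros Hd _; exists (e - 1)%nat; (split; [lia|split; [lia|split]]).
        + intros q Hqp. rewrite upd_neq by lia. now apply Hq.
        + rewrite upd_eq. eapply is_inf_ext; [exact Hext|].
          now apply is_inf_lower with (v := hr s6 wt p).
        + exact Hq.
        + eapply is_inf_ext; [exact Hext|]. now apply is_inf_keep.
      - intros e s6 F6 (He & Hq & Hp) Hb6. hcbn_in Hb6.
        rewrite (frame_hi k2 _ _ _ F6 eq_refl), Ek in Hb6.
        replace (hi s6 va 0%nat) with m in Hp by lia.
        intros q Hqp. destruct (Nat.eq_dec q p) as [->|]; [exact Hp|]. apply Hq; lia. }
    intros s6 F6 Hq. block; [|cbn; lia]. hcbn. intros _.
    rewrite (frame_hi vp _ _ _ F6 eq_refl), Ep.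
    exists (c - 1)%nat. split; [lia|split; [lia|exact Hq]].
  - intros c s3 F (Hc & Hinf) Hb. hcbn_in Hb.
    rewrite (frame_hi vn _ _ _ F eq_refl), (frame_hi vn _ _ _ F2 eq_refl) in Hb. fold n in Hb.
    intros p Hp. apply Hinf. lia.
Qed.

(** Reads the tuple in base [n], entry 0 being the least significant digit. Progress of the
    enumeration is then one number below [n ^ m], and injectivity turns a statement about all values
    into one about all tuples. *)
Fixpoint digits_value (n m : nat) (T : nat -> nat) : nat :=
  match m with O => 0 | S m' => digits_value n m' T + T m' * n ^ m' end.

Lemma digits_value_lt n m T :
  (forall a, (a < m)%nat -> (T a < n)%nat) -> (digits_value n m T < n ^ m)%nat.
Proof.
  induction m as [|m IH]; intros H; simpl; [lia|].
  specialize (IH ltac:(intros; apply H; lia)). specialize (H m ltac:(lia)). nia.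
Qed.

Lemma digits_value_ext n m T T' :
  (forall a, (a < m)%nat -> T a = T' a) -> digits_value n m T = digits_value n m T'.
Proof.
  induction m as [|m IH]; intros H; simpl; [reflexivity|].
  rewrite (H m), IH; auto; intros; apply H; lia.
Qed.

Lemma digits_value_inj n m T T' :
  (forall a, (a < m)%nat -> (T a < n)%nat) -> (forall a, (a < m)%nat -> (T' a < n)%nat) ->
  digits_value n m T = digits_value n m T' -> forall a, (a < m)%nat -> T a = T' a.
Proof.
  induction m as [|m IH]; intros H H' E a Ha; [lia|]. simpl in E.
  pose proof (digits_value_lt n m T ltac:(intros; apply H; lia)).
  pose proof (digits_value_lt n m T' ltac:(intros; apply H'; lia)).
  assert (Em : T m = T' m).
  { destruct (Nat.lt_total (T m) (T' m)) as [|[|]]; auto; exfalso; nia. }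
  destruct (Nat.eq_dec a m) as [->|]; [exact Em|].
  apply IH; [intros; apply H; lia|intros; apply H'; lia|rewrite Em in E; lia|lia].
Qed.

(** A carry left over after the last digit ends the main loop. For [k = 2] there is no digit, so the
    carry survives at once and the empty tuple is processed exactly once. *)
Definition next_tuple : cmd :=
  carry ::= IN 1 ;;
  va ::= IN 0 ;;
  While (BLe (IPl (V va) (IN 1)) (V k2))
    (If (BLe (IN 1) (V carry))
       (If (BLe (IPl (IA tup (V va)) (IN 2)) (V vn))
          (SetI tup (V va) (IPl (IA tup (V va)) (IN 1)) ;; carry ::= IN 0)
          (SetI tup (V va) (IN 0))) Skip ;;
     va ::= IPl (V va) (IN 1)).

Lemma next_tuple_correct s :
  let n := hi s vn 0%nat in let m := hi s k2 0%nat in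
  (forall a, (a < m)%nat -> (hi s tup a < n)%nat) ->
  tc next_tuple s (8 * m + 3) (fun s' =>
    (forall a, (a < m)%nat -> (hi s' tup a < n)%nat) /\
    ((hi s' carry 0 = 0 /\ digits_value n m (hi s' tup) = S (digits_value n m (hi s tup))) \/
     (hi s' carry 0 = 1 /\ S (digits_value n m (hi s tup)) = n ^ m))%nat).
Proof.
  intros n m HT.
  eapply (tc_weaken _ _ (1 + (1 + (m * (7 + 1) + 1)))); [|lia|intros s' _ H; exact H].
  apply tc_seti_seq; intros s1 F1 E1. hcbn_in E1.
  apply tc_seti_seq; intros s2 F2 E2. hcbn_in E2.
  (* Addition of 1 in base [n]: the carry weighs [n ^ va], and the digits from [va] on still have
     their old values. *)
  apply (tc_while _ _ s2 (fun c s' =>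
    (hi s' va 0 + c = m)%nat /\ (hi s' carry 0 <= 1)%nat /\
    (forall a, (a < m)%nat -> (hi s' tup a < n)%nat) /\
    (forall a, (hi s' va 0 <= a)%nat -> hi s' tup a = hi s tup a) /\
    (digits_value n (hi s' va 0) (hi s' tup) + hi s' carry 0 * n ^ hi s' va 0 =
       S (digits_value n (hi s' va 0) (hi s tup)))%nat)).
  - rewrite E2, (frame_hi carry _ _ _ F2 eq_refl), E1, (frame_hi tup _ _ _ F2 eq_refl),
      (frame_hi tup _ _ _ F1 eq_refl), !upd_eq. simpl. repeat split; auto; lia.
  - intros c s3 F (Hc & Hcy & HT3 & Hsame & Hval) Hb. hcbn_in Hb.
    rewrite (frame_hi k2 _ _ _ F eq_refl), (frame_hi k2 _ _ _ F2 eq_refl),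
      (frame_hi k2 _ _ _ F1 eq_refl) in Hb. fold m in Hb.
    assert (En : hi s3 vn 0%nat = n) by (rewrite (frame_hi vn _ _ _ F eq_refl),
      (frame_hi vn _ _ _ F2 eq_refl), (frame_hi vn _ _ _ F1 eq_refl); reflexivity).
    block; [|cbn; lia]. hcbn. rewrite En. set (a := hi s3 va 0%nat) in *.
    pose proof (HT3 a ltac:(lia)) as Ha. pose proof (Hsame a ltac:(lia)) as Ea.
    set (T := hi s3 tup) in *. set (T0 := hi s tup) in *.
    assert (Hupd : forall v, digits_value n (a + 1) (upd T a v) = (digits_value n a T + v * n ^ a)%nat).
    { intros v. rewrite Nat.add_1_r; simpl. rewrite upd_eq. f_equal.
      apply digits_value_ext; intros b Hb'. apply upd_neq; lia. }
    assert (H0 : digits_value n (a + 1) T0 = (digits_value n a T0 + T0 a * n ^ a)%nat)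
      by (rewrite Nat.add_1_r; reflexivity).
    assert (Hu : forall v, (v < n)%nat -> (forall b, (b < m)%nat -> (upd T a v b < n)%nat) /\
      (forall b, (a + 1 <= b)%nat -> upd T a v b = T0 b)).
    { intros v Hv; split.
      - intros b Hb'. destruct (Nat.eq_dec b a) as [->|]; [now rewrite upd_eq|].
        rewrite upd_neq by auto. auto.
      - intros b Hb'. rewrite upd_neq by lia. apply Hsame; lia. }
    split; intros H1; [split; intros H2|]; intros _; exists (c - 1)%nat;
      (split; [lia|split; [lia|split; [lia|]]]).
    + destruct (Hu (T a + 1)%nat ltac:(lia)) as [U1 U2].
      split; [exact U1|split; [exact U2|]]. rewrite Hupd, H0, <- Ea. nia.
    + destruct (Hu 0%nat ltac:(lia)) as [U1 U2].
      split; [exact U1|split; [exact U2|]]. rewrite Hupd, H0, <- Ea.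
      replace (hi s3 carry 0%nat) with 1%nat in * by lia.
      replace n with (S (T a)) at 2 by lia. rewrite Nat.add_1_r, Nat.pow_succ_r'. nia.
    + split; [exact HT3|split; [intros b Hb'; apply Hsame; lia|]].
      replace (hi s3 carry 0%nat) with 0%nat in * by lia.
      rewrite H0, <- Ea. rewrite Nat.add_1_r. simpl. lia.
  - intros c s3 F (Hc & Hcy & HT3 & Hsame & Hval) Hb. hcbn_in Hb.
    rewrite (frame_hi k2 _ _ _ F eq_refl), (frame_hi k2 _ _ _ F2 eq_refl),
      (frame_hi k2 _ _ _ F1 eq_refl) in Hb. fold m in Hb.
    replace (hi s3 va 0%nat) with m in * by lia.
    split; [exact HT3|].
    pose proof (digits_value_lt n m _ HT3). pose proof (digits_value_lt n m _ HT).
    destruct (Nat.eq_dec (hi s3 carry 0%nat) 0) as [E|E]; [left|right].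
    + rewrite E in Hval. split; [exact E|lia].
    + replace (hi s3 carry 0%nat) with 1%nat in * by lia. split; [reflexivity|lia].
Qed.

(** * Initialization and the main loop *)

Definition fill_half : cmd :=
  vi ::= IN 0 ;;
  While (BLe (IPl (V vi) (IN 1)) (V vn))
    (SetI half (IPl (V vi) (V vi)) (V vi) ;;
     SetI half (IPl (IPl (V vi) (V vi)) (IN 1)) (V vi) ;;
     vi ::= IPl (V vi) (IN 1)).

(** Since [|p - q|^2 <= 2 |p|^2 + 2 |q|^2], four times the larger squared norm suffices, and the sum
    over all points dominates it. This gives in linear time a bound on every squared distance. *)
Definition fill_cap : cmd :=
  cap :::= RN 0 ;;
  vi ::= IN 0 ;;
  While (BLe (IPl (V vi) (IN 1)) (V vn))
    (cap :::= RPl (W cap) (RMu (RN 4)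
       (RPl (RMu (RA px (V vi)) (RA px (V vi))) (RMu (RA py (V vi)) (RA py (V vi))))) ;;
     vi ::= IPl (V vi) (IN 1)).

Definition process_tuple : cmd :=
  pair_weight ;; point_weights ;; sort wt ;; search ;; next_tuple.

Definition main_loop : cmd := While (BLe (V carry) (IN 0)) process_tuple.

Definition dispersion : cmd :=
  fill_half ;; fill_cap ;; k2 ::= IMi (V vk) (IN 2) ;; sort px ;; copy ws xs ;;
  best :::= RN 0 ;; carry ::= IN 0 ;; main_loop.

Lemma fill_half_correct n s :
  hi s vn 0%nat = n -> tc fill_half s (4 * n + 2) (fun s' => env n s').
Proof.
  intros Hn.
  eapply (tc_weaken _ _ (1 + (n * (3 + 1) + 1))); [|lia|intros s' _ H; exact H].
  apply tc_seti_seq; intros s1 F1 E1. hcbn_in E1.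
  apply (tc_while _ _ s1 (fun m s' => (hi s' vi 0 + m = n)%nat /\
    forall v, (v < 2 * hi s' vi 0)%nat -> hi s' half v = (v / 2)%nat)).
  - rewrite E1, upd_eq. split; [reflexivity|lia].
  - intros m s2 F (Hm & Hh) Hb. hcbn_in Hb.
    rewrite (frame_hi vn _ _ _ F eq_refl), (frame_hi vn _ _ _ F1 eq_refl), Hn in Hb.
    block; [|apply Nat.le_refl]. hcbn. intros _. set (i := hi s2 vi 0%nat) in *.
    exists (m - 1)%nat. split; [lia|split; [lia|]]. intros v Hv.
    destruct (Nat.eq_dec v (i + i + 1)) as [->|].
    { rewrite upd_eq. apply (Nat.div_unique _ 2 i 1); lia. }
    rewrite upd_neq by auto.
    destruct (Nat.eq_dec v (i + i)) as [->|].
    { rewrite upd_eq. apply (Nat.div_unique _ 2 i 0); lia. }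
    rewrite upd_neq by auto. apply Hh; lia.
  - intros m s2 F (Hm & Hh) Hb. hcbn_in Hb.
    rewrite (frame_hi vn _ _ _ F eq_refl), (frame_hi vn _ _ _ F1 eq_refl), Hn in Hb.
    split.
    + rewrite (frame_hi vn _ _ _ F eq_refl), (frame_hi vn _ _ _ F1 eq_refl). exact Hn.
    + intros v Hv. apply Hh. lia.
Qed.

Lemma fill_cap_correct n s :
  hi s vn 0%nat = n ->
  tc fill_cap s (3 * n + 3) (fun s' => forall p q, (p < n)%nat -> (q < n)%nat ->
    dist2 (hr s px) (hr s py) p q <= hr s' cap 0%nat).
Proof.
  intros Hn. set (x := hr s px). set (y := hr s py).
  eapply (tc_weaken _ _ (1 + (1 + (n * (2 + 1) + 1)))); [|lia|intros s' _ H; exact H].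
  apply tc_setr_seq; intros s1 F1 E1. hcbn_in E1.
  apply tc_seti_seq; intros s2 F2 E2. hcbn_in E2.
  apply (tc_while _ _ s2 (fun m s' => (hi s' vi 0 + m = n)%nat /\ 0 <= hr s' cap 0%nat /\
    forall v, (v < hi s' vi 0)%nat -> 4 * (x v * x v + y v * y v) <= hr s' cap 0%nat)).
  - rewrite E2, (frame_hr cap _ _ _ F2 eq_refl), E1, !upd_eq.
    split; [reflexivity|split; [lra|lia]].
  - intros m s3 F (Hm & H0 & Hh) Hb. hcbn_in Hb.
    rewrite (frame_hi vn _ _ _ F eq_refl), (frame_hi vn _ _ _ F2 eq_refl),
      (frame_hi vn _ _ _ F1 eq_refl), Hn in Hb.
    block; [|apply Nat.le_refl]. hcbn. intros _.
    rewrite (frame_hr px _ _ _ F eq_refl), (frame_hr px _ _ _ F2 eq_refl),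
      (frame_hr px _ _ _ F1 eq_refl), (frame_hr py _ _ _ F eq_refl),
      (frame_hr py _ _ _ F2 eq_refl), (frame_hr py _ _ _ F1 eq_refl).
    fold x y. set (i := hi s3 vi 0%nat) in *.
    pose proof (Rle_0_sqr (x i)); pose proof (Rle_0_sqr (y i)); unfold Rsqr in *.
    exists (m - 1)%nat. split; [lia|split; [lia|split; [lra|]]]. intros v Hv.
    destruct (Nat.eq_dec v i) as [->|]; [lra|].
    specialize (Hh v ltac:(lia)). lra.
  - intros m s3 F (Hm & H0 & Hh) Hb. hcbn_in Hb.
    rewrite (frame_hi vn _ _ _ F eq_refl), (frame_hi vn _ _ _ F2 eq_refl),
      (frame_hi vn _ _ _ F1 eq_refl), Hn in Hb.
    intros p q Hp Hq.
    pose proof (Hh p ltac:(lia)). pose proof (Hh q ltac:(lia)). unfold dist2.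
    pose proof (Rle_0_sqr (x p + x q)). pose proof (Rle_0_sqr (y p + y q)). unfold Rsqr in *. lra.
Qed.

Lemma weights_of_inf x y n m T B b0 w :
  (forall a, (a < m)%nat -> (T a < n)%nat) ->
  is_inf B (tuple_pairs x y T m 0) b0 ->
  (forall p, (p < n)%nat ->
     is_inf b0 (fun d => exists a, (a < m)%nat /\ d = dist2 x y (T a) p) (w p)) ->
  weights x y n m T w.
Proof.
  intros HT (_ & H1 & _) Hw; split; [exact HT|]. intros p Hp.
  destruct (Hw p Hp) as (W0 & W1 & _). split.
  - intros a b Hab Hb. apply Rle_trans with b0; [exact W0|]. apply H1.
    exists b, a; repeat split; auto.
  - intros a Ha. apply W1. now exists a.
Qed.

Lemma covered_spread x y n m T B b0 w b r S :
  is_inf B (tuple_pairs x y T m 0) b0 ->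
  (forall p, (p < n)%nat ->
     is_inf b0 (fun d => exists a, (a < m)%nat /\ d = dist2 x y (T a) p) (w p)) ->
  (forall p q, (p < n)%nat -> (q < n)%nat -> dist2 x y p q <= B) ->
  covered x y w n b ->
  spread x y n (m + 2) r S -> (forall a, (a < m)%nat -> S a = T a) -> r <= b.
Proof.
  intros (_ & _ & Hb0) Hw HB Hcov [HS Hr] E.
  assert (Hrb : r <= b0).
  { apply Hb0.
    (* [r] respects the cap because of the last two points, which are present even when [T] is
       empty. *)
    - apply Rle_trans with (dist2 x y (S m) (S (m + 1)%nat)); [apply Hr; lia|apply HB; apply HS; lia].
    - intros d (i & j & Hij & Hi & ->). rewrite <- !E by lia. apply Hr; lia. }
  apply (Hcov (S m) (S (m + 1)%nat)); try (apply HS; lia).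
  - apply Hw; [apply HS; lia|exact Hrb|]. intros d (a & Ha & ->). rewrite <- E by auto.
    apply Hr; lia.
  - apply Hw; [apply HS; lia|exact Hrb|]. intros d (a & Ha & ->). rewrite <- E by auto.
    apply Hr; lia.
  - apply Hr; lia.
Qed.

(** Only the first [k - 2] entries of [S] are compared with [v]: one pass settles all completions of
    a tuple by two points. *)
Definition solved_below (x y : nat -> R) (n k v : nat) (b : R) : Prop :=
  forall S r, spread x y n k r S -> (digits_value n (k - 2) S < v)%nat -> r <= b.

Lemma process_tuple_correct n k x y s :
  input_ok n k x y s -> distinct x y n -> (k <= n)%nat -> (2 <= k)%nat ->
  (forall p q, (p < n)%nat -> (q < n)%nat -> dist2 x y p q <= hr s cap 0%nat) ->
  (forall a, (a < k - 2)%nat -> (hi s tup a < n)%nat) ->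
  recorded x y n k s ->
  let v := digits_value n (k - 2) (hi s tup) in
  solved_below x y n k v (hr s best 0%nat) ->
  tc process_tuple s (500 * k * (n * lg n)) (fun s' =>
    (forall a, (a < k - 2)%nat -> (hi s' tup a < n)%nat) /\ recorded x y n k s' /\
    solved_below x y n k (S v) (hr s' best 0%nat) /\
    ((hi s' carry 0 = 0 /\ digits_value n (k - 2) (hi s' tup) = S v) \/
     (hi s' carry 0 = 1 /\ S v = n ^ (k - 2)))%nat).
Proof.
  intros Hin Hdist Hkn Hk HB HT Hrec v Hsolved.
  assert (Hk2 : forall s', input_ok n k x y s' -> hi s' k2 0%nat = (k - 2)%nat)
    by (intros s' (_ & _ & H & _); lia).
  assert (Hn : forall s', input_ok n k x y s' -> hi s' vn 0%nat = n)
    by (intros s' [[H _] _]; exact H).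
  assert (Ex : forall s', input_ok n k x y s' -> hr s' px = x) by (intros s' H; apply H).
  assert (Ey : forall s', input_ok n k x y s' -> hr s' py = y) by (intros s' H; apply H).
  set (m := (k - 2)%nat) in *. set (T := hi s tup) in *.
  eapply (tc_weaken _ _ ((8 * (m * m) + 8 * m + 8) + ((8 * (n * m) + 8 * n + 8) +
    (50 * (n * lg n) + (400 * (n * lg n) + (8 * m + 3)))))); [| |intros s' _ H; exact H].
  (* The cost quadratic in [m] is at most [k * n], because [m < k <= n]; the factor [k] of the bound
     absorbs it. *)
  2: { assert (2 <= lg n)%nat by (unfold lg; lia).
       assert (m * m <= k * n)%nat by (apply Nat.mul_le_mono; lia).
       assert (n * m <= k * n)%nat by (rewrite Nat.mul_comm; apply Nat.mul_le_mono; lia).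
       assert (k * n * 2 <= k * n * lg n)%nat by (apply Nat.mul_le_mono_l; lia).
       assert (2 * (n * lg n) <= k * (n * lg n))%nat by (apply Nat.mul_le_mono_r; lia).
       assert (2 * n <= k * n)%nat by (apply Nat.mul_le_mono_r; lia).
       rewrite <- !Nat.mul_assoc in *. lia. }
  pose proof (pair_weight_correct s) as Hpair; cbv zeta in Hpair.
  rewrite (Hk2 _ Hin), (Ex _ Hin), (Ey _ Hin) in Hpair. fold T in Hpair.
  eapply tc_seq; [exact Hpair|]. intros s1 F1 H1.
  pose proof (input_ok_frame _ _ _ _ _ _ _ Hin F1 eq_refl eq_refl) as Hin1.
  pose proof (point_weights_correct s1) as Hpoint; cbv zeta in Hpoint.
  rewrite (Hk2 _ Hin1), (Hn _ Hin1), (Ex _ Hin1), (Ey _ Hin1),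
    (frame_hi tup _ _ _ F1 eq_refl) in Hpoint. fold T in Hpoint.
  eapply tc_seq; [exact Hpoint|]. intros s2 F2 H2.
  pose proof (input_ok_frame _ _ _ _ _ _ _ Hin1 F2 eq_refl eq_refl) as Hin2.
  eapply tc_seq; [apply (sort_correct wt n s2); [lia|apply Hin2]|]. intros s3 F3 H3.
  pose proof (input_ok_frame _ _ _ _ _ _ _ Hin2 F3 eq_refl eq_refl) as Hin3.
  assert (Ew : hr s3 wt = hr s2 wt) by exact (frame_hr wt _ _ _ F3 eq_refl).
  assert (ET : hi s3 tup = T).
  { rewrite (frame_hi tup _ _ _ F3 eq_refl), (frame_hi tup _ _ _ F2 eq_refl).
    exact (frame_hi tup _ _ _ F1 eq_refl). }
  assert (Ebest : hr s3 best 0%nat = hr s best 0%nat).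
  { rewrite (frame_hr best _ _ _ F3 eq_refl), (frame_hr best _ _ _ F2 eq_refl),
      (frame_hr best _ _ _ F1 eq_refl). reflexivity. }
  eapply tc_seq.
  { apply (search_correct n k x y s3); auto.
    - rewrite Ew. exact H3.
    - rewrite ET, Ew, (Hk2 _ Hin3). exact (weights_of_inf _ _ _ _ _ _ _ _ HT H1 H2).
    - unfold recorded in *.
      rewrite Ebest, (frame_hi res _ _ _ F3 eq_refl), (frame_hi res _ _ _ F2 eq_refl),
        (frame_hi res _ _ _ F1 eq_refl). exact Hrec. }
  intros s4 F4 (Hrec4 & Hle & Hcov).
  pose proof (input_ok_frame _ _ _ _ _ _ _ Hin3 F4 eq_refl eq_refl) as Hin4.
  rewrite Ebest in Hle. rewrite Ew in Hcov.
  assert (ET4 : hi s4 tup = T) by (rewrite (frame_hi tup _ _ _ F4 eq_refl); exact ET).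
  pose proof (next_tuple_correct s4) as Hnext; cbv zeta in Hnext.
  rewrite (Hk2 _ Hin4), (Hn _ Hin4), ET4 in Hnext.
  eapply tc_weaken; [apply (Hnext HT)|apply Nat.le_refl|].
  intros s5 F5 (HT5 & Hcarry).
  split; [exact HT5|].
  assert (Eb5 : hr s5 best = hr s4 best) by exact (frame_hr best _ _ _ F5 eq_refl).
  split; [|split; [|exact Hcarry]].
  - unfold recorded in *. rewrite Eb5, (frame_hi res _ _ _ F5 eq_refl). exact Hrec4.
  - rewrite Eb5. intros S r HS Hlt.
    destruct (Nat.eq_dec (digits_value n (k - 2) S) v) as [E|E].
    + apply (covered_spread x y n m T (hr s cap 0%nat) (hr s1 w0 0%nat) (hr s2 wt) _ r S); auto.
      * replace (m + 2)%nat with k by (unfold m; lia). exact HS.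
      * apply (digits_value_inj n m S T); auto. intros a Ha; apply HS; unfold m in Ha; lia.
    + apply Rle_trans with (hr s best 0%nat); [|exact Hle]. apply (Hsolved S r HS). lia.
Qed.

Lemma main_loop_correct n k x y s :
  input_ok n k x y s -> distinct x y n -> (k <= n)%nat -> (2 <= k)%nat ->
  (forall p q, (p < n)%nat -> (q < n)%nat -> dist2 x y p q <= hr s cap 0%nat) ->
  (forall a, hi s tup a = 0%nat) -> hi s carry 0%nat = 0%nat -> hr s best 0%nat = 0 ->
  tc main_loop s (n ^ (k - 2) * (500 * k * (n * lg n) + 1) + 1) (fun s' =>
    recorded x y n k s' /\ forall S r, spread x y n k r S -> r <= hr s' best 0%nat).
Proof.
  intros Hin Hdist Hkn Hk HB HT0 Hc0 Hb0.
  (* With carry 0 the measure counts the tuples not yet processed, including the current one; with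
     carry 1 every tuple has been settled. *)
  apply (tc_while _ _ s (fun m s' =>
    (forall a, (a < k - 2)%nat -> (hi s' tup a < n)%nat) /\ recorded x y n k s' /\
    ((hi s' carry 0 = 0 /\ m + digits_value n (k - 2) (hi s' tup) = n ^ (k - 2))%nat /\
       solved_below x y n k (digits_value n (k - 2) (hi s' tup)) (hr s' best 0%nat) \/
     (hi s' carry 0%nat = 1%nat /\ solved_below x y n k (n ^ (k - 2)) (hr s' best 0%nat))))).
  - assert (E0 : digits_value n (k - 2) (hi s tup) = 0%nat).
    { generalize (k - 2)%nat; intros m; induction m; simpl; [reflexivity|]. rewrite HT0; lia. }
    split; [intros a _; rewrite HT0; lia|split].
    + unfold recorded; rewrite Hb0. split; [apply Rle_refl|lra].
    + left. rewrite E0, Nat.add_0_r. split; [auto|]. intros S r _ Hlt; lia.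
  - intros m s1 F (HT & Hrec & Hcase) Hb. hcbn_in Hb.
    destruct Hcase as [[[Hc Hm] Hs]|[Hc _]]; [|lia].
    pose proof (input_ok_frame _ _ _ _ _ _ _ Hin F eq_refl eq_refl) as Hin1.
    eapply tc_weaken; [apply (process_tuple_correct n k x y s1); auto|apply Nat.le_refl|].
    + rewrite (frame_hr cap _ _ _ F eq_refl). exact HB.
    + intros s2 _ (HT2 & Hrec2 & Hs2 & Hcase2) _.
      pose proof (digits_value_lt n (k - 2) _ HT) as Hlt.
      exists (m - 1)%nat. split; [lia|split; [exact HT2|split; [exact Hrec2|]]].
      destruct Hcase2 as [[Hc2 Hv]|[Hc2 Hv]]; [left|right].
      * rewrite Hv. split; [split; [exact Hc2|lia]|exact Hs2].
      * rewrite <- Hv. auto.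
  - intros m s1 F (HT & Hrec & Hcase) Hb. hcbn_in Hb.
    destruct Hcase as [[[Hc Hm] Hs]|[Hc Hs]]; [lia|].
    split; [exact Hrec|]. intros S r HS. apply (Hs S r HS).
    apply digits_value_lt. intros a Ha; apply HS; lia.
Qed.

Lemma dispersion_correct n k x y s :
  hi s vn 0%nat = n -> hi s vk 0%nat = k -> hr s px = x -> hr s py = y ->
  (forall a, hi s tup a = 0%nat) ->
  distinct x y n -> (k <= n)%nat -> (2 <= k)%nat ->
  tc dispersion s (1000 * k * (n ^ (k - 1) * lg n)) (fun s' =>
    recorded x y n k s' /\ forall S r, spread x y n k r S -> r <= hr s' best 0%nat).
Proof.
  intros Hn Hvk Hx Hy HT Hdist Hkn Hk.
  eapply (tc_weaken _ _ ((4 * n + 2) + ((3 * n + 3) + (1 + (50 * (n * lg n) + ((3 * n + 2) +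
    (1 + (1 + (n ^ (k - 2) * (500 * k * (n * lg n) + 1) + 1)))))))));
    [| |intros s' _ H; exact H].
  2: { replace (k - 1)%nat with (S (k - 2)) by lia. rewrite Nat.pow_succ_r'.
       assert (1 <= n ^ (k - 2))%nat by (apply Nat.neq_0_lt_0, Nat.pow_nonzero; lia).
       assert (2 <= lg n)%nat by (unfold lg; lia).
       set (N := (n ^ (k - 2))%nat) in *.
       replace (n * N * lg n)%nat with (N * (n * lg n))%nat by ring.
       set (L := (n * lg n)%nat).
       assert (2 * n <= L)%nat by (unfold L; nia).
       assert (L <= N * L)%nat by nia.
       assert (N <= N * L)%nat by nia.
       set (M := (N * L)%nat) in *.
       replace (N * (500 * k * L + 1))%nat with (500 * (k * M) + N)%nat by (unfold M; ring).
       assert (2 * M <= k * M)%nat by (apply Nat.mul_le_mono_r; lia).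
       rewrite <- !Nat.mul_assoc. lia. }
  eapply tc_seq; [apply (fill_half_correct n s Hn)|]. intros s1 F1 Henv1.
  eapply tc_seq; [apply (fill_cap_correct n s1), Henv1|]. intros s2 F2 HB.
  apply tc_seti_seq; intros s3 F3 E3. hcbn_in E3.
  pose proof (env_frame _ _ _ _ Henv1 F2 eq_refl eq_refl) as Henv2.
  pose proof (env_frame _ _ _ _ Henv2 F3 eq_refl eq_refl) as Henv3.
  assert (Ex3 : hr s3 px = x) by (rewrite (frame_hr px _ _ _ F3 eq_refl),
    (frame_hr px _ _ _ F2 eq_refl), (frame_hr px _ _ _ F1 eq_refl); exact Hx).
  assert (Ey3 : hr s3 py = y) by (rewrite (frame_hr py _ _ _ F3 eq_refl),
    (frame_hr py _ _ _ F2 eq_refl), (frame_hr py _ _ _ F1 eq_refl); exact Hy).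
  rewrite (frame_hr px _ _ _ F1 eq_refl), (frame_hr py _ _ _ F1 eq_refl), Hx, Hy in HB.
  assert (Ek3 : hi s3 vk 0%nat = k) by (rewrite (frame_hi vk _ _ _ F3 eq_refl),
    (frame_hi vk _ _ _ F2 eq_refl), (frame_hi vk _ _ _ F1 eq_refl); exact Hvk).
  eapply tc_seq; [apply (sort_correct px n s3); [lia|exact Henv3]|]. intros s4 F4 Hsort.
  rewrite Ex3 in Hsort.
  pose proof (env_frame _ _ _ _ Henv3 F4 eq_refl eq_refl) as Henv4.
  eapply tc_seq; [apply (copy_correct ws xs n s4); [apply Henv4|reflexivity|reflexivity]|].
  intros s5 F5 Hcopy. cbv beta in Hcopy.
  pose proof (env_frame _ _ _ _ Henv4 F5 eq_refl eq_refl) as Henv5.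
  assert (Hin5 : input_ok n k x y s5).
  { unfold input_ok. split; [exact Henv5|].
    rewrite (frame_hi vk _ _ _ F5 eq_refl), (frame_hi vk _ _ _ F4 eq_refl), Ek3.
    rewrite (frame_hi k2 _ _ _ F5 eq_refl), (frame_hi k2 _ _ _ F4 eq_refl), E3, upd_eq.
    rewrite (frame_hi vk _ _ _ F2 eq_refl), (frame_hi vk _ _ _ F1 eq_refl), Hvk.
    rewrite (frame_hr px _ _ _ F5 eq_refl), (frame_hr px _ _ _ F4 eq_refl),
      (frame_hr py _ _ _ F5 eq_refl), (frame_hr py _ _ _ F4 eq_refl).
    repeat (split; [first [assumption|lia]|]).
    destruct Hsort as (A & B & C). split; [|split].
    - intros o Ho. rewrite Hcopy by exact Ho. auto.
    - intros o o' Ho Ho'. rewrite !Hcopy by assumption. auto.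
    - intros o o' Ho Ho'. rewrite !Hcopy by lia. auto. }
  apply tc_setr_seq; intros s6 F6 E6. hcbn_in E6.
  apply tc_seti_seq; intros s7 F7 E7. hcbn_in E7.
  pose proof (input_ok_frame _ _ _ _ _ _ _ Hin5 F6 eq_refl eq_refl) as Hin6.
  pose proof (input_ok_frame _ _ _ _ _ _ _ Hin6 F7 eq_refl eq_refl) as Hin7.
  apply main_loop_correct; auto.
  - rewrite (frame_hr cap _ _ _ F7 eq_refl), (frame_hr cap _ _ _ F6 eq_refl),
      (frame_hr cap _ _ _ F5 eq_refl), (frame_hr cap _ _ _ F4 eq_refl),
      (frame_hr cap _ _ _ F3 eq_refl). exact HB.
  - intros a. rewrite (frame_hi tup _ _ _ F7 eq_refl), (frame_hi tup _ _ _ F6 eq_refl),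
      (frame_hi tup _ _ _ F5 eq_refl), (frame_hi tup _ _ _ F4 eq_refl),
      (frame_hi tup _ _ _ F3 eq_refl), (frame_hi tup _ _ _ F2 eq_refl),
      (frame_hi tup _ _ _ F1 eq_refl). apply HT.
  - rewrite E7. apply upd_eq.
  - rewrite (frame_hr best _ _ _ F7 eq_refl), E6. apply upd_eq.
Qed.

(** * Input relocation and output *)

Definition fetch_point : list instr :=
  [IConst 52 1; ISub 49 49 52; IAdd 50 49 49; RLoad 0 50; IConst 52 0; IAdd 51 49 52].

Definition put_point : list instr :=
  [RStore 51 0; IConst 52 1; IAdd 50 50 52; RLoad 0 50; IAdd 51 51 52; RStore 51 0].

(** The ordinate of point 0 is still at address 1: the relocation loop writes only to address 0 and
    to addresses from 66 on. *)
Definition last_point : list instr :=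
  [IConst 51 3; RStore 51 1; RLoad 0 48; IConst 51 2; RStore 51 0].

(* Point [j] moves from addresses [2 j, 2 j + 1] to [64 j + 2, 64 j + 3]; going
   down from [n - 1], no unread coordinate is overwritten. The abscissa of point [0]
   is parked at address [64 n] because real register 0 serves as the buffer. *)
Definition prologue : low :=
  LSeq (lseq ([IConst 49 0; IAdd 48 0 49] ++ addr_code 0 48 ++
              [RStore 48 0; IConst 50 0; IAdd 49 0 50; IConst 53 2]))
  (LSeq (LWhile LSkip (TI 53 49) (lseq (fetch_point ++ addr_code 2 51 ++ put_point)))
        (lseq last_point)).

Ltac run_block := unfold effs; cbn [fold_left eff step nth at_pc fst snd pc ireg rreg].
Ltac read_regs := unfold upd; cbn [Nat.eqb].
Ltac other_reg :=
  repeat match goal with |- upd ?f ?i ?v ?j = _ => rewrite (upd_neq f i j v) by lia end;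
  reflexivity.

Lemma fetch_point_effect m j :
  fst m 49%nat = Z.of_nat (S j) ->
  let m' := effs fetch_point m in
  fst m' 49%nat = Z.of_nat j /\ fst m' 50%nat = Z.of_nat (2 * j) /\ fst m' 51%nat = Z.of_nat j /\
  (forall d, (d < 49 \/ 52 < d)%nat -> fst m' d = fst m d) /\
  snd m' = upd (snd m) 0 (snd m (2 * j)%nat).
Proof.
  intros H; unfold fetch_point; run_block.
  repeat split.
  - read_regs; lia.
  - read_regs; lia.
  - read_regs; lia.
  - intros d Hd; other_reg.
  - do 2 f_equal. read_regs; lia.
Qed.

Lemma put_point_effect m j :
  fst m 50%nat = Z.of_nat (2 * j) -> fst m 51%nat = Z.of_nat (64 * j + 2) ->
  let m' := effs put_point m in
  (forall d, (d < 50 \/ 52 < d)%nat -> fst m' d = fst m d) /\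
  snd m' = let r := upd (snd m) (64 * j + 2) (snd m 0%nat) in
    upd (upd r 0 (r (2 * j + 1)%nat)) (64 * j + 3) (r (2 * j + 1)%nat).
Proof.
  intros H0 H1; unfold put_point; run_block. split.
  - intros d Hd; other_reg.
  - rewrite upd_eq. rewrite H1, Nat2Z.id.
    set (r := upd (snd m) (64 * j + 2) (snd m 0%nat)).
    repeat match goal with |- context [Z.to_nat ?z] => progress
      (let z' := eval unfold upd in z in let z' := eval cbn [Nat.eqb] in z' in
       change z with z') end.
    rewrite H0, H1.
    replace (Z.to_nat (Z.of_nat (2 * j) + 1)) with (2 * j + 1)%nat by lia.
    replace (Z.to_nat (Z.of_nat (64 * j + 2) + 1)) with (64 * j + 3)%nat by lia.
    reflexivity.
Qed.

Definition moved_above (n k : nat) (r : nat -> R) (j : nat) (m : mem) : Prop :=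
  fst m 0%nat = Z.of_nat n /\ fst m 1%nat = Z.of_nat k /\
  (forall a, (2 <= a < 48 \/ 64 <= a)%nat -> fst m a = 0%Z) /\
  fst m 48%nat = Z.of_nat (64 * n) /\ fst m 49%nat = Z.of_nat j /\ fst m 53%nat = 2%Z /\
  snd m (64 * n)%nat = r 0%nat /\
  (forall a, (1 <= a < 2 * j)%nat -> snd m a = r a) /\
  (forall i, (j <= i < n)%nat ->
     snd m (64 * i + 2)%nat = r (2 * i)%nat /\ snd m (64 * i + 3)%nat = r (2 * i + 1)%nat).

Lemma move_point n k r j m :
  (1 <= j)%nat -> (S j <= n)%nat -> moved_above n k r (S j) m ->
  moved_above n k r j (effs (fetch_point ++ addr_code 2 51 ++ put_point) m).
Proof.
  intros Hj Hn (H0 & H1 & Ha & H48 & H49 & H53 & Hs & Hlow & Hhigh).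
  rewrite !effs_app.
  destruct (fetch_point_effect m j H49) as (A49 & A50 & A51 & Aother & Ar).
  set (m1 := effs fetch_point m) in *.
  destruct (addr_code_correct 2 51 m1 j A51) as (B51 & Bother & Br).
  set (m2 := effs (addr_code 2 51) m1) in *.
  rewrite <- (Bother 50%nat) in A50 by lia.
  destruct (put_point_effect m2 j A50 B51) as (Cother & Cr).
  set (m3 := effs put_point m2) in *.
  assert (Hother : forall d, (d < 49 \/ 52 < d)%nat -> fst m3 d = fst m d).
  { intros d Hd. rewrite Cother, Bother, Aother by lia. reflexivity. }
  assert (E49 : fst m3 49%nat = Z.of_nat j) by (rewrite Cother, Bother by lia; exact A49).
  rewrite Br, Ar in Cr. cbv zeta in Cr.
  rewrite (upd_eq (snd m)) in Cr.
  rewrite (upd_neq _ (64 * j + 2) (2 * j + 1)), (upd_neq _ 0 (2 * j + 1)) in Cr by lia.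
  rewrite (Hlow (2 * j)%nat), (Hlow (2 * j + 1)%nat) in Cr by lia.
  unfold moved_above. rewrite !Hother, E49, Cr by lia.
  repeat (split; [assumption|]).
  split; [intros a Haa; rewrite Hother by lia; now apply Ha|].
  repeat (split; [first [assumption|reflexivity]|]).
  split; [rewrite !upd_neq by lia; exact Hs|split].
  (* Unread coordinates lie at addresses from 1 to [2 * j - 1]; the cells written are 0,
     [64 * j + 2] and [64 * j + 3]. *)
  - intros a Haa. rewrite !upd_neq by lia. apply Hlow; lia.
  - intros i Hi. destruct (Nat.eq_dec i j) as [->|].
    + split; [|apply upd_eq].
      rewrite (upd_neq _ (64 * j + 3)), (upd_neq _ 0) by lia. apply upd_eq.
    + rewrite !upd_neq by lia. apply Hhigh; lia.
Qed.

Lemma move_points n k r : forall j m,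
  (1 <= j)%nat -> (j <= n)%nat -> moved_above n k r j m ->
  exists m' t, lexec (LWhile LSkip (TI 53 49) (lseq (fetch_point ++ addr_code 2 51 ++ put_point)))
    m m' t /\ moved_above n k r 1 m' /\ (t <= 30 * j)%nat.
Proof.
  induction j as [|j IH]; intros m Hj Hn Hm; [lia|].
  assert (Ht : holds (TI 53 49) m = Nat.leb 2 (S j)).
  { destruct Hm as (_ & _ & _ & _ & H49 & H53 & _). simpl holds. rewrite H49, H53.
    destruct (Nat.leb_spec 2 (S j)); [apply Z.leb_le|apply Z.leb_gt]; lia. }
  destruct j as [|j].
  - exists m, (0 + 2)%nat. split; [now constructor; [constructor|]|split; [exact Hm|lia]].
  - destruct (IH _ ltac:(lia) ltac:(lia) (move_point n k r (S j) m ltac:(lia) Hn Hm))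
      as (m' & t & E & Hm' & Htime).
    eexists m', _. split; [|split; [exact Hm'|]].
    + eapply lexec_while_true; [constructor|exact Ht|now apply lexec_lseq|exact E].
    + simpl length. lia.
Qed.

(** The enumeration starts from the zero tuple, which the program takes from blank memory. *)
Definition loaded (n k : nat) (r : nat -> R) (s : hstate) : Prop :=
  hi s vn 0%nat = n /\ hi s vk 0%nat = k /\ (forall a, hi s tup a = 0%nat) /\
  forall i, (i < n)%nat -> hr s px i = r (2 * i)%nat /\ hr s py i = r (2 * i + 1)%nat.

Lemma prologue_correct n k I r :
  (1 <= n)%nat -> I 0%nat = Z.of_nat n -> I 1%nat = Z.of_nat k ->
  (forall a, (2 <= a)%nat -> I a = 0%Z) ->
  exists s m' t, lexec prologue (I, r) m' t /\ rel s m' /\ loaded n k r s /\ (t <= 60 * n)%nat.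
Proof.
  intros Hn H0 H1 Ha.
  set (m1 := effs [IConst 49 0; IAdd 48 0 49] (I, r)).
  assert (E1 : fst m1 48%nat = Z.of_nat n) by (subst m1; run_block; read_regs; lia).
  assert (E1' : forall d, (d < 48 \/ 49 < d)%nat -> fst m1 d = I d)
    by (subst m1; run_block; intros d Hd; other_reg).
  assert (E1r : snd m1 = r) by reflexivity.
  destruct (addr_code_correct 0 48 m1 n E1) as (E2 & E2' & E2r).
  set (m2 := effs (addr_code 0 48) m1) in *. rewrite Nat.add_0_r in E2.
  set (m3 := effs [RStore 48 0; IConst 50 0; IAdd 49 0 50; IConst 53 2] m2).
  assert (E3 : fst m3 49%nat = Z.of_nat n).
  { subst m3; run_block; read_regs. rewrite E2', E1', H0 by lia. lia. }
  assert (E3' : forall d, (d < 49 \/ 50 < d < 53 \/ 53 < d)%nat -> fst m3 d = fst m2 d)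
    by (subst m3; run_block; intros d Hd; other_reg).
  assert (E3r : snd m3 = upd r (64 * n) (r 0%nat)).
  { subst m3; run_block. rewrite E2, E2r, E1r, Nat2Z.id. reflexivity. }
  assert (Hm3 : moved_above n k r n m3).
  { unfold moved_above. rewrite !E3', E2, E3, E3r by lia. rewrite !E2', !E1' by lia.
    repeat (split; [first [assumption|reflexivity]|]).
    split; [intros a Haa; rewrite E3', E2', E1' by lia; apply Ha; lia|].
    repeat (split; [reflexivity|]).
    split; [apply upd_eq|split; [|lia]].
    intros a Haa. rewrite upd_neq by lia. reflexivity. }
  destruct (move_points n k r n m3 Hn (le_n n) Hm3) as (m4 & t & E & Hm4 & Ht).
  destruct Hm4 as (A0 & A1 & Aa & A48 & _ & _ & As & Alow & Ahigh).
  set (m5 := effs last_point m4).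
  assert (E5 : forall d, d <> 51%nat -> fst m5 d = fst m4 d)
    by (subst m5; unfold last_point; run_block; intros d Hd; other_reg).
  assert (E5r : snd m5 = upd (upd (upd (snd m4) 3 (r 1%nat)) 0 (r 0%nat)) 2 (r 0%nat)).
  { subst m5; unfold last_point; run_block. rewrite upd_eq.
    repeat match goal with |- context [Z.to_nat ?z] => progress
      (let z' := eval unfold upd in z in let z' := eval cbn [Nat.eqb] in z' in
       change z with z') end.
    rewrite A48, Nat2Z.id, (Alow 1%nat) by lia.
    change (Z.to_nat 3) with 3%nat. change (Z.to_nat 2) with 2%nat.
    rewrite (upd_neq _ 3 (64 * n)), As by lia. reflexivity. }
  (* The source state is read off the memory, so [rel] only requires that the integer array cells
     are nonnegative. *)
  exists (mkH (fun a i => Z.to_nat (fst m5 (64 * i + a)%nat)) (fun a i => snd m5 (64 * i + a)%nat)).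
  exists m5. eexists. split; [|split; [|split]].
  - eapply lexec_seq; [now apply lexec_lseq|eapply lexec_seq; [|now apply lexec_lseq]].
    rewrite !effs_app. exact E.
  - intros a i Hai. cbn [hi hr]. split; [|reflexivity].
    rewrite E5 by lia.
    destruct (Nat.eq_dec (64 * i + a) 0) as [E0|N0]; [rewrite E0, A0; lia|].
    destruct (Nat.eq_dec (64 * i + a) 1) as [E01|N1]; [rewrite E01, A1; lia|].
    rewrite Aa; lia.
  - unfold loaded; cbn [hi hr].
    change (64 * 0 + 0)%nat with 0%nat; change (64 * 0 + 1)%nat with 1%nat. rewrite !E5 by lia.
    rewrite A0, A1. split; [lia|split; [lia|split]].
    + intros a. rewrite E5, Aa by lia. reflexivity.
    + intros i Hi. rewrite E5r. destruct i as [|i].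
      * split; [apply upd_eq|reflexivity].
      * rewrite !upd_neq by lia. apply Ahigh; lia.
  - rewrite !length_app. simpl length. lia.
Qed.

(* The results sit at addresses [64 (k + j) + 21 > k], beyond the output cells.
   Cells from 64 on are filled by a loop; each of the first 64 registers then
   receives the address of its own result and is loaded through itself. *)
Definition epilogue : low :=
  LSeq (lseq ([IConst 49 0; IAdd 48 1 49] ++ addr_code 21 48 ++
              [IConst 50 64; IConst 51 4096; IAdd 51 51 48; IConst 53 1; IConst 55 64]))
  (LSeq (LWhile (LPrim (IAdd 54 50 53)) (TI 54 1)
           (lseq [ILoad 52 51; IStore 50 52; IAdd 50 50 53; IAdd 51 51 55]))
  (LSeq (lseq ([IConst 49 0; IAdd 0 48 49; IConst 1 64; IAdd 2 0 1; IAdd 2 2 1] ++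
               map (fun j => IAdd (S j) j 1) (seq 2 61) ++ [IAdd 1 0 1]))
        (lseq (map (fun j => ILoad j j) (seq 0 64))))).

(** Each pointer is the previous one plus the stride 64 kept in register 1, which is why register 1
    gets its own pointer last. *)
Lemma pointers_effect c : forall a m b,
  (2 <= a)%nat -> fst m 1%nat = 64%Z -> fst m a = Z.of_nat (b + 64 * a) ->
  let m' := effs (map (fun j => IAdd (S j) j 1) (seq a c)) m in
  (forall j, (a <= j <= a + c)%nat -> fst m' j = Z.of_nat (b + 64 * j)) /\
  (forall j, (j < a \/ a + c < j)%nat -> fst m' j = fst m j).
Proof.
  induction c as [|c IH]; intros a m b Ha H1 Hm; cbv zeta.
  - simpl. split; [intros j Hj; replace j with a by lia; exact Hm|reflexivity].
  - cbn [seq map]. change (effs (?i :: ?l) m) with (effs l (eff i m)).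
    set (m1 := eff (IAdd (S a) a 1) m).
    assert (E : fst m1 (S a) = Z.of_nat (b + 64 * S a)).
    { subst m1; cbn [eff step nth at_pc fst snd pc ireg rreg]. rewrite upd_eq, Hm, H1. lia. }
    assert (E' : forall j, j <> S a -> fst m1 j = fst m j).
    { intros j Hj; subst m1; cbn [eff step nth at_pc fst snd pc ireg rreg]. now apply upd_neq. }
    destruct (IH (S a) m1 b ltac:(lia) ltac:(rewrite E' by lia; exact H1) E) as [A B].
    split.
    + intros j Hj. destruct (Nat.eq_dec j a) as [->|]; [rewrite B, E' by lia; exact Hm|].
      apply A; lia.
    + intros j Hj. rewrite B, E' by lia. reflexivity.
Qed.

(** All loads read from address 64 on and write below it, so they do not interfere. Loading a
    register through itself uses no temporary, and none is left when all 64 registers are output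
    cells. *)
Lemma loads_effect c : forall a m,
  (a + c <= 64)%nat -> (forall j, (a <= j < a + c)%nat -> (64 <= fst m j)%Z) ->
  let m' := effs (map (fun j => ILoad j j) (seq a c)) m in
  (forall j, (a <= j < a + c)%nat -> fst m' j = fst m (Z.to_nat (fst m j))) /\
  (forall j, (j < a \/ a + c <= j)%nat -> fst m' j = fst m j).
Proof.
  induction c as [|c IH]; intros a m Hc Hm; cbv zeta.
  - simpl. split; [intros j Hj; lia|reflexivity].
  - cbn [seq map]. change (effs (?i :: ?l) m) with (effs l (eff i m)).
    set (m1 := eff (ILoad a a) m).
    assert (E : fst m1 a = fst m (Z.to_nat (fst m a)))
      by (subst m1; cbn [eff step nth at_pc fst snd pc ireg rreg]; apply upd_eq).
    assert (E' : forall j, j <> a -> fst m1 j = fst m j).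
    { intros j Hj; subst m1; cbn [eff step nth at_pc fst snd pc ireg rreg]. now apply upd_neq. }
    destruct (IH (S a) m1 ltac:(lia)) as [A B];
      [intros j Hj; rewrite E' by lia; apply Hm; lia|].
    split.
    + intros j Hj. destruct (Nat.eq_dec j a) as [->|]; [rewrite B by lia; exact E|].
      specialize (Hm j ltac:(lia)). rewrite A, (E' j) by lia. apply E'. lia.
    + intros j Hj. rewrite B, E' by lia. reflexivity.
Qed.

Definition copied_below (k j : nat) (I : nat -> Z) (m : mem) : Prop :=
  (forall d, (d < 48 \/ k <= d /\ 64 <= d)%nat -> fst m d = I d) /\
  fst m 48%nat = Z.of_nat (64 * k + 21) /\ fst m 53%nat = 1%Z /\ fst m 55%nat = 64%Z /\
  fst m 50%nat = Z.of_nat j /\ fst m 51%nat = Z.of_nat (64 * (k + j) + 21) /\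
  (forall i, (64 <= i < j)%nat -> fst m i = I (64 * (k + i) + 21)%nat).

Lemma copy_results k I : forall c j m,
  (64 <= j)%nat -> (k <= j + c)%nat -> I 1%nat = Z.of_nat k -> copied_below k j I m ->
  exists m' t j', lexec (LWhile (LPrim (IAdd 54 50 53)) (TI 54 1)
    (lseq [ILoad 52 51; IStore 50 52; IAdd 50 50 53; IAdd 51 51 55])) m m' t /\
    copied_below k j' I m' /\ (k <= j')%nat /\ (t <= 10 * c + 10)%nat.
Proof.
  induction c as [|c IH]; intros j m Hj Hk HI Hm.
  (* The loop head runs in both cases of the induction, so its effect is computed for both at
     once. *)
  all: pose proof Hm as (A & B48 & B53 & B55 & B50 & B51 & Hcp).
  all: set (m1 := eff (IAdd 54 50 53) m).
  all: assert (E54 : fst m1 54%nat = Z.of_nat (j + 1))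
    by (subst m1; cbn [eff step nth at_pc fst snd pc ireg rreg]; rewrite upd_eq; lia).
  all: assert (Eo : forall d, d <> 54%nat -> fst m1 d = fst m d)
    by (intros d Hd; subst m1; cbn [eff step nth at_pc fst snd pc ireg rreg]; now apply upd_neq).
  all: assert (Hm1 : copied_below k j I m1) by
    (unfold copied_below; rewrite !Eo by lia;
     split; [intros d Hd; rewrite Eo by lia; now apply A|];
     repeat (split; [assumption|]); intros i Hi; rewrite Eo by lia; now apply Hcp).
  all: assert (Ht : holds (TI 54 1) m1 = Nat.leb (j + 1) k) by
    (change (holds (TI 54 1) m1) with (Z.leb (fst m1 54%nat) (fst m1 1%nat));
     rewrite E54, Eo, A, HI by lia;
     destruct (Nat.leb_spec (j + 1) k); [apply Z.leb_le|apply Z.leb_gt]; lia).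
  all: destruct (Nat.leb_spec (j + 1) k) as [Hl|Hg]; try lia.
  all: try (exists m1, (1 + 2)%nat, j; split; [constructor; [now constructor|exact Ht]|];
            split; [exact Hm1|lia]).
  set (m2 := effs [ILoad 52 51; IStore 50 52; IAdd 50 50 53; IAdd 51 51 55] m1).
  assert (Hm2 : copied_below k (j + 1) I m2).
  { destruct Hm1 as (A1 & C48 & C53 & C55 & C50 & C51 & Ccp).
    assert (E2 : forall d, fst m2 d = if Nat.eqb d 51 then Z.of_nat (64 * (k + (j + 1)) + 21)
      else if Nat.eqb d 50 then Z.of_nat (j + 1)
      else if Nat.eqb d j then I (64 * (k + j) + 21)%nat
      else if Nat.eqb d 52 then I (64 * (k + j) + 21)%nat else fst m1 d).
    { intros d. subst m2; run_block. rewrite C51, Nat2Z.id.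
      rewrite (upd_neq _ 52 50), C50, Nat2Z.id, upd_eq, A1 by lia.
      unfold upd.
      destruct (Nat.eqb_spec d 51); [|destruct (Nat.eqb_spec d 50); [|reflexivity]].
      - rewrite (proj2 (Nat.eqb_neq 51 j)), (proj2 (Nat.eqb_neq 55 j)) by lia. cbn [Nat.eqb].
        rewrite C51, C55. lia.
      - rewrite (proj2 (Nat.eqb_neq 50 j)), (proj2 (Nat.eqb_neq 53 j)) by lia. cbn [Nat.eqb].
        rewrite C50, C53. lia. }
    unfold copied_below. rewrite !E2.
    rewrite (proj2 (Nat.eqb_neq 48 j)), (proj2 (Nat.eqb_neq 53 j)), (proj2 (Nat.eqb_neq 55 j)) by lia.
    cbn [Nat.eqb].
    split; [|repeat (split; [first [assumption|reflexivity]|])].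
    - intros d Hd. rewrite E2.
      rewrite (proj2 (Nat.eqb_neq d 51)), (proj2 (Nat.eqb_neq d 50)),
        (proj2 (Nat.eqb_neq d j)), (proj2 (Nat.eqb_neq d 52)) by lia. now apply A1.
    - intros i Hi. rewrite E2.
      destruct (Nat.eqb_spec i 51); [lia|]. destruct (Nat.eqb_spec i 50); [lia|].
      destruct (Nat.eqb_spec i j) as [->|]; [reflexivity|].
      destruct (Nat.eqb_spec i 52); [lia|]. apply Ccp; lia. }
  destruct (IH (j + 1)%nat m2 ltac:(lia) ltac:(lia) HI Hm2) as (m' & t & j' & E & H & Hj' & Htm).
  exists m'. eexists. exists j'. split; [|split; [exact H|split; [exact Hj'|]]].
  - eapply lexec_while_true; [now constructor|exact Ht|now apply lexec_lseq|exact E].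
  - simpl length. lia.
Qed.

Lemma epilogue_correct k m :
  (2 <= k)%nat -> fst m 1%nat = Z.of_nat k ->
  exists m' t, lexec epilogue m m' t /\ (t <= 10 * k + 300)%nat /\
    forall j, (j < k)%nat -> fst m' j = fst m (64 * (k + j) + 21)%nat.
Proof.
  intros Hk H1. set (I := fst m).
  set (m1 := effs [IConst 49 0; IAdd 48 1 49] m).
  assert (E1 : fst m1 48%nat = Z.of_nat k) by (subst m1; run_block; read_regs; lia).
  assert (E1' : forall d, (d < 48 \/ 49 < d)%nat -> fst m1 d = I d)
    by (subst m1; run_block; intros d Hd; other_reg).
  destruct (addr_code_correct 21 48 m1 k E1) as (E2 & E2' & _).
  set (m2 := effs (addr_code 21 48) m1) in *.
  set (m3 := effs [IConst 50 64; IConst 51 4096; IAdd 51 51 48; IConst 53 1; IConst 55 64] m2).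
  assert (Hm3 : copied_below k 64 I m3).
  { unfold copied_below. repeat split; try (subst m3; run_block; read_regs; lia).
    intros d Hd. transitivity (fst m2 d); [subst m3; run_block; other_reg|].
    rewrite E2', E1' by lia. reflexivity. }
  destruct (copy_results k I k 64 m3 ltac:(lia) ltac:(lia) H1 Hm3)
    as (m4 & t & j' & E & (A & B48 & _ & _ & _ & _ & Hcp) & Hj' & Ht).
  set (m5 := effs [IConst 49 0; IAdd 0 48 49; IConst 1 64; IAdd 2 0 1; IAdd 2 2 1] m4).
  set (m6 := effs (map (fun j => IAdd (S j) j 1) (seq 2 61)) m5).
  set (m7 := effs [IAdd 1 0 1] m6).
  set (b := (64 * k + 21)%nat) in *.
  assert (E5 : forall d, (2 < d < 49 \/ 49 < d)%nat -> fst m5 d = fst m4 d)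
    by (subst m5; run_block; intros d Hd; other_reg).
  destruct (pointers_effect 61 2 m5 b ltac:(lia)) as [C1 C2].
  { subst m5; run_block; read_regs; reflexivity. }
  { subst m5; run_block; read_regs; lia. }
  fold m6 in C1, C2.
  assert (E60 : fst m6 0%nat = Z.of_nat b)
    by (rewrite C2 by lia; subst m5; run_block; read_regs; lia).
  assert (E61 : fst m6 1%nat = 64%Z)
    by (rewrite C2 by lia; subst m5; run_block; read_regs; reflexivity).
  assert (Hptr : forall j, (j < 64)%nat -> fst m7 j = Z.of_nat (b + 64 * j)).
  { intros j Hj. subst m7; run_block. unfold upd.
    destruct (Nat.eqb_spec j 1) as [->|]; [lia|].
    destruct (Nat.eq_dec j 0) as [->|]; [lia|]. apply C1; lia. }
  assert (E7 : forall d, (64 <= d)%nat -> fst m7 d = fst m4 d).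
  { intros d Hd. subst m7; run_block. rewrite upd_neq, C2, E5 by lia. reflexivity. }
  destruct (loads_effect 64 0 m7 ltac:(lia)) as [D1 D2].
  { intros j Hj. rewrite Hptr by lia. lia. }
  exists (effs (map (fun j => ILoad j j) (seq 0 64)) m7). eexists. split; [|split].
  - eapply lexec_seq; [now apply lexec_lseq|]. rewrite !effs_app. fold m1 m2 m3.
    eapply lexec_seq; [exact E|]. eapply lexec_seq; [now apply lexec_lseq|].
    rewrite !effs_app. fold m5 m6 m7. now apply lexec_lseq.
  - rewrite !length_app, !length_map, !length_seq. simpl length. lia.
  - intros j Hj. destruct (Nat.lt_ge_cases j 64) as [Hl|Hg].
    + rewrite D1, (Hptr j), Nat2Z.id by lia. unfold b. rewrite E7, A by lia. unfold I; f_equal; lia.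
    + rewrite D2, E7 by lia. apply Hcp; lia.
Qed.

(** * The dispersion theorem *)

Definition dispersion_program : program := code (LSeq prologue (LSeq (comp dispersion) epilogue)) 0.

Definition px_of (P : list point) (i : nat) : R := fst (nth i P (0, 0)).
Definition py_of (P : list point) (i : nat) : R := snd (nth i P (0, 0)).

Lemma program_correct P k :
  (2 <= k)%nat -> (k <= length P)%nat -> distinct (px_of P) (py_of P) (length P) ->
  let n := length P in
  exists t s S b,
    run dispersion_program t (input_state P k) = Some s /\
    (forall j, (j < k)%nat -> ireg s j = Z.of_nat (S j)) /\
    0 <= b /\ (0 < b -> spread (px_of P) (py_of P) n k b S) /\
    (forall T r, spread (px_of P) (py_of P) n k r T -> r <= b) /\
    (t <= (400 + size (comp dispersion) * (1000 * k)) * (n ^ (k - 1) * lg n))%nat.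
Proof.
  intros Hk Hkn Hdist n.
  set (I0 := fun j => if Nat.eqb j 0 then Z.of_nat n else if Nat.eqb j 1 then Z.of_nat k else 0%Z).
  set (r0 := fun j => if Nat.eqb (j mod 2) 0 then px_of P (j / 2) else py_of P (j / 2)).
  destruct (prologue_correct n k I0 r0) as (s1 & m1 & t1 & X1 & R1 & L1 & T1);
    [unfold n; lia|reflexivity|reflexivity| |].
  { intros a Ha. unfold I0. now rewrite (proj2 (Nat.eqb_neq a 0)), (proj2 (Nat.eqb_neq a 1)) by lia. }
  destruct L1 as (Ln & Lk & LT & Lr).
  assert (Ex : forall i, (i < n)%nat -> hr s1 px i = px_of P i /\ hr s1 py i = py_of P i).
  { intros i Hi. destruct (Lr i Hi) as [-> ->]. unfold r0.
    replace (2 * i)%nat with (i * 2)%nat by lia.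
    rewrite Nat.Div0.mod_mul, Nat.div_mul by lia.
    rewrite (Nat.add_comm (i * 2)), Nat.Div0.mod_add, Nat.div_add by lia.
    now rewrite Nat.add_0_l. }
  (* The loaded arrays agree with [P] only below [n]; distances and selections look no further. *)
  assert (Ed : forall p q, (p < n)%nat -> (q < n)%nat ->
    dist2 (hr s1 px) (hr s1 py) p q = dist2 (px_of P) (py_of P) p q).
  { intros p q Hp Hq. unfold dist2.
    destruct (Ex p Hp) as [-> ->], (Ex q Hq) as [-> ->]. reflexivity. }
  assert (Es : forall r T, spread (hr s1 px) (hr s1 py) n k r T <->
    spread (px_of P) (py_of P) n k r T).
  { intros r T; split; intros [H1 H2]; (split; [exact H1|]); intros a b Hab Hb;
      specialize (H2 a b Hab Hb); rewrite Ed in * by (apply H1; lia); exact H2. }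
  destruct (dispersion_correct n k (hr s1 px) (hr s1 py) s1) as (s2 & u & X2 & U & Hrec & Hopt);
    auto.
  { intros p q Hp Hq Hpq. rewrite Ed by assumption. now apply Hdist. }
  destruct (comp_correct _ _ _ _ X2 eq_refl m1 R1) as (m2 & t2 & Y2 & R2 & T2).
  pose proof (hexec_frame _ _ _ _ X2) as F.
  destruct (epilogue_correct k m2 Hk) as (m3 & t3 & Y3 & T3 & Hout).
  { destruct (R2 vk 0%nat ltac:(lia)) as [E _]. change (64 * 0 + 1)%nat with 1%nat in E.
    rewrite E, (frame_hi vk _ _ _ F eq_refl), Lk. reflexivity. }
  set (c := LSeq prologue (LSeq (comp dispersion) epilogue)).
  assert (X : lexec c (I0, r0) m3 (t1 + (t2 + t3)))
    by (eapply lexec_seq; [exact X1|eapply lexec_seq; [exact Y2|exact Y3]]).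
  exists (t1 + (t2 + t3))%nat, (at_pc (0 + size c) m3), (fun a => hi s2 res (k + a)%nat), (hr s2 best 0%nat).
  split; [|split; [|split; [|split; [|split]]]].
  - apply nsteps_run.
    + exact (code_correct _ _ _ _ X dispersion_program 0%nat (fun i _ => eq_refl)).
    (* The program has no final [Halt]: control runs off its end, where [nth] defaults to [Halt]. *)
    + unfold step. change (pc (at_pc (0 + size c) m3)) with (size c).
      rewrite nth_overflow; [reflexivity|]. unfold dispersion_program. fold c.
      rewrite length_code. apply le_n.
  - intros j Hj. change (ireg (at_pc (0 + size c) m3) j) with (fst m3 j).
    rewrite Hout by exact Hj. apply R2. lia.
  - apply Hrec.
  - intros Hb. apply Es. now apply Hrec.
  - intros T r HT. apply (Hopt T r). now apply Es.
  - replace (k - 1)%nat with (S (k - 2)) by lia. replace (k - 1)%nat with (S (k - 2)) in U by lia.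
    rewrite Nat.pow_succ_r' in *.
    assert (1 <= n ^ (k - 2))%nat by (apply Nat.neq_0_lt_0, Nat.pow_nonzero; unfold n; lia).
    assert (2 <= lg n)%nat by (unfold lg; lia).
    set (M := (n * n ^ (k - 2) * lg n)%nat) in *.
    assert (2 * n <= M)%nat.
    { unfold M. rewrite <- Nat.mul_assoc, Nat.mul_comm. apply Nat.mul_le_mono_l. nia. }
    assert (t2 <= size (comp dispersion) * (1000 * k) * M)%nat.
    { eapply Nat.le_trans; [exact T2|]. rewrite <- Nat.mul_assoc. now apply Nat.mul_le_mono_l. }
    rewrite Nat.mul_add_distr_r. unfold n in *. lia.
Qed.

(** * From squared distances to the minimum pairwise distance *)

Lemma dist_sqrt P p q :
  Defs.dist (nth p P (0, 0)) (nth q P (0, 0)) = sqrt (dist2 (px_of P) (py_of P) p q).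
Proof. unfold Defs.dist, dist2, px_of, py_of. unfold point. apply f_equal. ring. Qed.

Lemma nodup_distinct P : NoDup P -> distinct (px_of P) (py_of P) (length P).
Proof.
  intros HP p q Hp Hq Hne.
  destruct (dist2_nonneg (px_of P) (py_of P) p q) as [H|H]; [exact H|exfalso].
  apply Hne, (proj1 (NoDup_nth P (0, 0)) HP); auto.
  symmetry in H. unfold dist2 in H.
  destruct (Rplus_sqr_eq_0 (px_of P p - px_of P q) (py_of P p - py_of P q)) as [Hx Hy];
    [exact H|].
  unfold px_of, py_of in *. apply injective_projections; lra.
Qed.

Lemma in_pair_dists (l : list point) d :
  In d (pair_dists l) <-> exists a b, (a < b < length l)%nat /\
    d = Defs.dist (nth a l (0, 0)) (nth b l (0, 0)).
Proof.
  induction l as [|p l IH]; simpl.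
  - split; [tauto|]. intros (a & b & H & _). lia.
  - rewrite in_app_iff, in_map_iff, IH. split.
    + intros [(q & <- & Hq)|(a & b & H & E)].
      * destruct (In_nth l q (0, 0) Hq) as (b & Hb & <-).
        exists 0%nat, (S b). split; [lia|reflexivity].
      * exists (S a), (S b). split; [lia|exact E].
    + intros (a & b & H & E). destruct b as [|b]; [lia|]. destruct a as [|a].
      * left. exists (nth b l (0, 0)). split; [now symmetry|apply nth_In; lia].
      * right. exists a, b. split; [lia|exact E].
Qed.

Lemma fold_Rmin_spec (l : list R) : forall d r,
  r <= fold_right Rmin d l <-> r <= d /\ forall e, In e l -> r <= e.
Proof.
  induction l as [|e l IH]; intros d r; simpl.
  - split; [intros H; split; [exact H|tauto]|tauto].
  - split.
    + intros H. assert (H1 := Rmin_l e (fold_right Rmin d l)).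
      assert (H2 := Rmin_r e (fold_right Rmin d l)).
      destruct (proj1 (IH d r)) as [H3 H4]; [lra|]. split; [exact H3|].
      intros e' [<-|He]; [lra|auto].
    + intros [H1 H2]. apply Rmin_glb; [auto|]. apply IH; auto.
Qed.

(** A minimum is determined by its lower bounds, the form in which [spread] speaks. The length
    condition keeps away from the default value 0 of [min_dist]. *)
Lemma le_min_dist (l : list point) r :
  (2 <= length l)%nat ->
  (r <= min_dist l <-> forall a b, (a < b < length l)%nat ->
    r <= Defs.dist (nth a l (0, 0)) (nth b l (0, 0))).
Proof.
  intros Hl. transitivity (forall d, In d (pair_dists l) -> r <= d).
  - unfold min_dist. destruct (pair_dists l) as [|d ds] eqn:E.
    + assert (H : In (Defs.dist (nth 0 l (0, 0)) (nth 1 l (0, 0))) (pair_dists l))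
        by (apply in_pair_dists; exists 0%nat, 1%nat; split; [lia|reflexivity]).
      rewrite E in H; destruct H.
    + rewrite fold_Rmin_spec. split.
      * intros [H1 H2] e [<-|He]; auto.
      * intros H; split; [apply H; now left|intros e He; apply H; now right].
  - split.
    + intros H a b Hab. apply H, in_pair_dists. eauto.
    + intros H d Hd. apply in_pair_dists in Hd. destruct Hd as (a & b & Hab & ->). auto.
Qed.

Lemma nth_selected P T a :
  (a < length T)%nat -> nth a (selected P T) (0, 0) = nth (nth a T 0%nat) P (0, 0).
Proof.
  intros Ha. unfold selected.
  rewrite (nth_indep _ _ (nth (length P) P (0, 0))) by (rewrite length_map; exact Ha).
  now rewrite (map_nth (fun i => nth i P (0, 0)) T (length P)), (nth_indep T _ 0%nat).
Qed.

Lemma spread_min_dist P k T r :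
  (2 <= k)%nat -> length T = k -> Forall (fun i => (i < length P)%nat) T -> 0 <= r ->
  (sqrt r <= min_dist (selected P T) <->
   spread (px_of P) (py_of P) (length P) k r (fun a => nth a T 0%nat)).
Proof.
  intros Hk HT HF Hr.
  assert (Hl : length (selected P T) = k) by (unfold selected; now rewrite length_map).
  rewrite le_min_dist, Hl by lia. split.
  - intros H; split.
    + intros a Ha. rewrite Forall_forall in HF. apply HF, nth_In. lia.
    + intros a b Hab Hb. apply sqrt_le_0; [exact Hr|apply dist2_nonneg|].
      rewrite <- dist_sqrt, <- !nth_selected by lia. apply H; lia.
  - intros [_ H] a b Hab. rewrite !nth_selected, dist_sqrt by lia.
    apply sqrt_le_1_alt, H; lia.
Qed.

(** Witnessed by the first [k] points. It makes the final value of [best] positive, which is what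
    renders the recorded selection meaningful. *)
Lemma positive_spread x y n k :
  distinct x y n -> (k <= n)%nat -> exists r, 0 < r /\ spread x y n k r (fun a => a).
Proof.
  intros Hd. induction k as [|k IH]; intros Hk.
  - exists 1. split; [lra|split; intros; lia].
  - destruct IH as (r & Hr & _ & Hs); [lia|].
    assert (Hm : forall m, (m <= k)%nat -> exists e, 0 < e /\
      forall a, (a < m)%nat -> e <= dist2 x y a k).
    { induction m as [|m IHm]; intros Hm; [exists 1; split; [lra|lia]|].
      destruct IHm as (e & He & H); [lia|].
      pose proof (Hd m k ltac:(lia) ltac:(lia) ltac:(lia)).
      exists (Rmin e (dist2 x y m k)). split; [now apply Rmin_glb_lt|].
      intros a Ha. pose proof (Rmin_l e (dist2 x y m k)). pose proof (Rmin_r e (dist2 x y m k)).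
      destruct (Nat.eq_dec a m) as [->|]; [lra|]. specialize (H a ltac:(lia)). lra. }
    destruct (Hm k (le_n k)) as (e & He & H).
    pose proof (Rmin_l r e). pose proof (Rmin_r r e).
    exists (Rmin r e). split; [now apply Rmin_glb_lt|split; [intros; lia|]].
    intros a b Hab Hb. destruct (Nat.eq_dec b k) as [->|].
    + specialize (H a Hab). lra.
    + specialize (Hs a b Hab ltac:(lia)). lra.
Qed.

Lemma ln_monotone a b : 0 < a -> a <= b -> ln a <= ln b.
Proof. intros Ha [H| ->]; [left; now apply ln_increasing|apply Rle_refl]. Qed.

(** The additive 2 in [lg] costs the factor 3, as [log2 n >= 1] here. *)
Lemma lg_log2 n : (2 <= n)%nat -> INR (lg n) <= 3 * log2 (INR n).
Proof.
  intros Hn. assert (H2 : 0 < ln 2) by (rewrite <- ln_1; apply ln_increasing; lra).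
  assert (Hn' : 2 <= INR n) by (apply le_INR in Hn; exact Hn).
  assert (Hl : 1 <= log2 (INR n)).
  { unfold log2. apply Rmult_le_reg_r with (ln 2); [exact H2|].
    unfold Rdiv. rewrite Rmult_assoc, Rinv_l, Rmult_1_l, Rmult_1_r by lra.
    apply ln_monotone; lra. }
  assert (Hf : INR (Nat.log2 n) <= log2 (INR n)).
  { unfold log2. apply Rmult_le_reg_r with (ln 2); [exact H2|].
    unfold Rdiv. rewrite (Rmult_assoc (ln _)), Rinv_l, Rmult_1_r by lra.
    rewrite <- ln_pow by lra. apply ln_monotone; [apply pow_lt; lra|].
    change 2 with (INR 2). rewrite <- pow_INR. apply le_INR, Nat.log2_spec. lia. }
  unfold lg. rewrite plus_INR. simpl (INR 2). lra.
Qed.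

(* A single Real-RAM program which, given P (n distinct points) and k with
   2 <= k <= n, outputs an optimal k-dispersion subset; for every fixed k its
   worst-case running time is O(n^(k-1) log n). *)
Theorem theorem1 :
  exists p : program,
    forall k : nat, (2 <= k)%nat ->
      exists (C : R) (N0 : nat),
        forall P : list point,
          NoDup P -> (k <= length P)%nat ->
          exists (t : nat) (s : state),
            run p t (input_state P k) = Some s /\
            valid_output s k /\
            is_k_dispersion P k (output s k) /\
            ((N0 <= length P)%nat ->
             INR t <= C * INR (length P) ^ (k - 1) * log2 (INR (length P))).
Proof.
  exists dispersion_program. intros k Hk.
  set (K := (400 + size (comp dispersion) * (1000 * k))%nat).
  (* [K] is the factor of [program_correct] and 3 comes from [lg_log2]. As [2 <= k <= n], the bound
     holds for every admissible input and the threshold can be 0. *)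
  exists (3 * INR K), 0%nat. intros P HP Hkn.
  pose proof (nodup_distinct P HP) as Hdist.
  destruct (program_correct P k Hk Hkn Hdist) as (t & s & S & b & Hrun & HS & Hb & Hw & Hopt & Ht).
  exists t, s. split; [exact Hrun|split; [|split]].
  - intros j Hj. rewrite HS by exact Hj. lia.
  - assert (Hpos : 0 < b).
    { destruct (positive_spread _ _ _ k Hdist Hkn) as (r & Hr & Hs).
      apply Rlt_le_trans with r; [exact Hr|]. exact (Hopt _ r Hs). }
    destruct (Hw Hpos) as [HSn HSd].
    assert (Eo : output s k = map S (seq 0 k)).
    { unfold output. apply map_ext_in. intros j Hj; apply in_seq in Hj.
      rewrite HS by lia. apply Nat2Z.id. }
    assert (Hlen : length (output s k) = k) by (rewrite Eo, length_map; apply length_seq).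
    assert (Hnth : forall a, (a < k)%nat -> nth a (output s k) 0%nat = S a).
    { intros a Ha. rewrite Eo, (nth_indep _ _ (S 0%nat)) by (rewrite length_map, length_seq; exact Ha).
      now rewrite map_nth, seq_nth. }
    assert (HF : Forall (fun i => (i < length P)%nat) (output s k)).
    { rewrite Eo, Forall_forall. intros i Hi. apply in_map_iff in Hi.
      destruct Hi as (j & <- & Hj). apply in_seq in Hj. apply HSn; lia. }
    assert (Hsp : spread (px_of P) (py_of P) (length P) k b (fun a => nth a (output s k) 0%nat)).
    { split.
      - intros a Ha. rewrite Hnth by exact Ha. now apply HSn.
      - intros c d Hcd Hd. rewrite !Hnth by lia. now apply HSd. }
    split; [split; [exact Hlen|split; [|exact HF]]|].
    (* A repeated index would put two selected points at distance 0, against [0 < b]. *)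
    + apply (NoDup_nth _ 0%nat). rewrite Hlen. intros i j Hi Hj E.
      destruct (Nat.lt_total i j) as [H|[H|H]]; [|exact H|]; exfalso.
      * pose proof (proj2 Hsp i j H Hj) as Hd; cbv beta in Hd.
        rewrite E, dist2_refl in Hd. lra.
      * pose proof (proj2 Hsp j i H Hi) as Hd; cbv beta in Hd.
        rewrite E, dist2_refl in Hd. lra.
    + intros T (HT & HTd & HTF).
      set (r := min_dist (selected P T)).
      assert (Hr : 0 <= r).
      { apply le_min_dist; [unfold selected; rewrite length_map; lia|].
        intros a c _. unfold Defs.dist. apply sqrt_pos. }
      (* [Hopt] compares squared distances, so the competitor enters it with [r * r]. *)
      assert (Es : sqrt (r * r) = r) by now apply sqrt_square.
      assert (HTs : spread (px_of P) (py_of P) (length P) k (r * r) (fun a => nth a T 0%nat)).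
      { apply (spread_min_dist P k T (r * r) Hk HT HTF); [nra|]. rewrite Es. apply Rle_refl. }
      rewrite <- Es. apply Rle_trans with (sqrt b).
      * apply sqrt_le_1_alt. exact (Hopt _ _ HTs).
      * now apply (spread_min_dist P k _ b Hk Hlen HF Hb).
  - intros _. apply le_INR in Ht. rewrite !mult_INR, pow_INR in Ht. fold K in Ht.
    set (N := INR (length P) ^ (k - 1)) in *.
    assert (0 <= N) by (apply pow_le, pos_INR).
    pose proof (lg_log2 (length P) ltac:(lia)) as Hlg.
    apply Rle_trans with (1 := Ht).
    replace (3 * INR K * N * log2 (INR (length P)))
      with (INR K * (N * (3 * log2 (INR (length P))))) by ring.
    apply Rmult_le_compat_l; [apply pos_INR|]. now apply Rmult_le_compat_l.
Qed.
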